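(* Let $1\le k\le L$ and write $\overline{\boldsymbol\delta}=\boldsymbol 1-\boldsymbol\delta$. (a) Take $a=0$ and $x\ge0$. Then $$\overline{\boldsymbol\delta}_+(0,x,k)=\big(I-\Psi^{(0)}_x\Upsilon^{(0)}\big)^{-1}\Bigg(\sum_{n=0}^{k-1}\Lambda^{(n)}_x\boldsymbol 1+\sum_{\substack{n,l\ge0\\ 1\le n+l\le k-1}}\Psi^{(n)}_x\Upsilon^{(l)}\overline{\boldsymbol\delta}_+(0,x,k-n-l)\Bigg),$$ and the conditional distribution of the maximum $M_0(\mathcal Y_k)$ given the initial level $0$ is given by $$\boldsymbol\delta_+(0,x,k)=\boldsymbol 1-\overline{\boldsymbol\delta}_+(0,x,k),\qquad \boldsymbol\delta_-(0,x,k)=\boldsymbol 1-\sum_{n=0}^{k-1}\Upsilon^{(n)}\overline{\boldsymbol\delta}_+(0,x,k-n).$$ (b) Take $a>0$. For $x\ge a$, $$\overline{\boldsymbol\delta}_+(a,x,k)=\big(I-\Psi^{(0)}_{x-a}\hat\Psi^{(0)}_a\big)^{-1}\Bigg[\sum_{n=0}^{k-1}\Lambda^{(n)}_{x-a}\boldsymbol 1+\Psi^{(0)}_{x-a}\hat\Lambda^{(0)}_a\overline{\boldsymbol\delta}_-(0,x,k)$$ $$\qquad+\sum_{\substack{n,l\ge0\\ 1\le n+l\le k-1}}\Psi^{(n)}_{x-a}\Big(\hat\Psi^{(l)}_a\overline{\boldsymbol\delta}_+(a,x,k-n-l)+\hat\Lambda^{(l)}_a\overline{\boldsymbol\delta}_-(0,x,k-n-l)\Big)\Bigg],$$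 and the conditional distribution of $M_0(\mathcal Y_k)$ given the initial level $a$ is given, for $x\ge a$, by $$\boldsymbol\delta_+(a,x,k)=\boldsymbol 1-\overline{\boldsymbol\delta}_+(a,x,k),\qquad \boldsymbol\delta_-(a,x,k)=\boldsymbol 1-\sum_{n=0}^{k-1}\Big(\hat\Psi^{(n)}_a\overline{\boldsymbol\delta}_+(a,x,k-n)+\hat\Lambda^{(n)}_a\overline{\boldsymbol\delta}_-(0,x,k-n)\Big),$$ and, for $a>x$, by $\boldsymbol\delta_+(a,x,k)=\boldsymbol 0$ and $\boldsymbol\delta_-(a,x,k)=\boldsymbol 0$.
   Context: Random walk: $\{\varphi(t)\}_{t\ge0}$ is a continuous-time Markov chain on a finite set $\mathcal S$ (phases) with infinitesimal generator $A$; each phase $i$ has a rate $c_i\in\mathbb R\setminus\{0\}$; $\mathcal S_+=\{i:c_i>0\}$, $\mathcal S_-=\{i:c_i<0\}$. The unrestricted level is $X(t)=X(0)+\int_0^t c_{\varphi(s)}\,ds$. Fluid queue: the level with boundary at $0$ and initial level $a\ge0$ is $Z(t)=X(t)-\min\{0,\inf_{0\le v\le t}X(v)\}$ with $X(0)=a$ (it stays at $0$ as long as it is at $0$ and the current rate is negative). Erlang clock: $\nu>0$ and an integer $L\ge1$ are fixed; $Y_1,Y_2,\dots$ are i.i.d. exponential random variables with parameter $\nu$, independent of $\varphi$ and $X$; $\mathcal Y_k=\sum_{n=1}^kY_n$ ($\mathcal Y_0=0$), $T=\mathcal Y_L$. For $t<T$ the stage at time $t$ is $\phi(t)=n$ if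 $\mathcal Y_n\le t<\mathcal Y_{n+1}$, $0\le n\le L-1$. Put $\Phi(t)=(\varphi(t),\phi(t))$; for a random time $\tau$, ''$\Phi(\tau)=(j,n)$'' means $\tau<\infty$, $\varphi(\tau)=j$ and $\mathcal Y_n\le\tau<\mathcal Y_{n+1}$ (so $\tau<T$). $\mathbb P_i^a[\cdot]$ is the conditional probability given initial level $a$, $\varphi(0)=i$ and initial stage $0$. With $\tau_+(x)=\inf\{t>0:X(t)>x\}$, $\tau_-(x)=\inf\{t>0:X(t)<x\}$, define for $x\ge0$, $0\le k\le L-1$: $(\Lambda^{(k)}_x)_{ij}=\mathbb P_i^0[\tau_+(x)<\tau_-(0),\ \Phi(\tau_+(x))=(j,k)]$ for $i,j\in\mathcal S_+$; $(\Psi^{(k)}_x)_{iu}=\mathbb P_i^0[\tau_-(0)<\tau_+(x),\ \Phi(\tau_-(0))=(u,k)]$ for $i\in\mathcal S_+$, $u\in\mathcal S_-$; $(\hat\Lambda^{(k)}_x)_{ij}=\mathbb P_i^x[\tau_-(0)<\tau_+(x),\ \Phi(\tau_-(0))=(j,k)]$ for $i,j\in\mathcal S_-$; $(\hat\Psi^{(k)}_x)_{iu}=\mathbb P_i^x[\tau_+(x)<\tau_-(0),\ \Phi(\tau_+(x))=(u,k)]$ for $i\in\mathcal S_-$, $u\in\mathcal S_+$. With $\beta=\inf\{t>0:\varphi(t)\in\mathcal S_+\}$, $\Upsilon^{(n)}_{ij}=\mathbb P_i^0[\Phi(\beta)=(j,n)]$ for $i\in\mathcal S_-$, $j\in\mathcal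 S_+$, $0\le n\le L-1$: the probability that the fluid queue started at level $0$ in phase $i$ leaves level $0$ in phase $j$ during stage $n$. $M_0(t)=\max\{Z(v):0\le v\le t\}$ and $\delta_i(a,x,k)=\mathbb P_i^a[M_0(\mathcal Y_k)\le x]$ for $i\in\mathcal S$, with subvectors $\boldsymbol\delta_\pm$ indexed by $\mathcal S_\pm$. $\boldsymbol 1$, $\boldsymbol 0$ are column vectors of ones and zeros; empty sums are zero. *)

(* Defs.v *)
From HB Require Import structures.
From mathcomp Require Import all_boot all_order all_algebra.
From mathcomp Require Import all_classical all_reals all_analysis.

Set Implicit Arguments.
Unset Strict Implicit.
Unset Printing Implicit Defensive.

Import Order.TTheory GRing.Theory Num.Theory.
Import numFieldNormedType.Exports.

Local Open Scope classical_set_scope.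
Local Open Scope ring_scope.

(* The finite set of phases is 'I_m; S_+ and S_- are Sp and Sm below, and
   vectors and matrices over them are indexed through enum_val. *)

Section Chain.
Context {R : realType} {m : nat} {d : measure_display} {T : measurableType d}.

Definition is_generator (A : 'M[R]_m) : Prop :=
  (forall i j, i != j -> 0 <= A i j) /\ (forall i, \sum_j A i j = 0).

Definition expmx (M : 'M[R]_m) : 'M[R]_m :=
  \matrix_(i, j) limn (series (fun n : nat => (M ^+ n) i j / n`!%:R)).

(* Continuous-time Markov chain with generator A: cadlag paths (for the
   discrete topology on the phases) and transition function t |-> e^(tA). *)
Definition is_ctmc (P : probability T R) (A : 'M[R]_m)
    (phi : R -> T -> 'I_m) : Prop :=
  [/\ forall t j, 0 <= t -> measurable [set w | phi t w = j],
      forall w t, 0 <= t -> \forall s \near t^'+, phi s w = phi t w,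
      forall w t, 0 < t -> exists j, \forall s \near t^'-, phi s w = j
    & forall (n : nat) (t : nat -> R) (j : nat -> 'I_m),
        t 0%N = 0 -> (forall k, (k < n)%N -> t k <= t k.+1) ->
        P [set w | forall k, (k <= n)%N -> phi (t k) w = j k] =
        (P [set w | phi 0%R w = j 0%N] *
         (\prod_(k < n)
            expmx ((t k.+1 - t k) *: A) (j k) (j k.+1))%:E)%E].

Definition iid_exponential (P : probability T R) (nu : R)
    (Y : nat -> {mfun T >-> R}) : Prop :=
  (forall n (B : set R), measurable B ->
     distribution P (Y n) B = exponential_prob nu B) /\
  (forall (s : seq nat) (B : nat -> set R), uniq s ->
     (forall n, measurable (B n)) ->
     P (\bigcap_(n in [set` s]) (Y n @^-1` B n)) =
     (\prod_(n <- s) P (Y n @^-1` B n))%E).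

Definition sigma_phases (phi : R -> T -> 'I_m) : set (set T) :=
  <<s [set E | exists t j, 0 <= t /\ E = [set w | phi t w = j]] >>.

Definition sigma_clock (Y : nat -> {mfun T >-> R}) : set (set T) :=
  <<s [set E | exists n B, measurable B /\ E = Y n @^-1` B] >>.

Definition independent_clock (P : probability T R) (phi : R -> T -> 'I_m)
    (Y : nat -> {mfun T >-> R}) : Prop :=
  forall E F, sigma_phases phi E -> sigma_clock Y F ->
    P (E `&` F) = (P E * P F)%E.

End Chain.

Section Paths.
Context {R : realType} {m : nat}.
Variable c : 'I_m -> R.

Definition Sp : {set 'I_m} := [set i | 0 < c i].
Definition Sm : {set 'I_m} := [set i | c i < 0].

Definition level (f : R -> 'I_m) (a t : R) : R :=
  a + \int[lebesgue_measure]_(s in `[0, t]) c (f s).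

Definition queue (f : R -> 'I_m) (a t : R) : R :=
  level f a t - Num.min 0 (inf [set level f a v | v in `[0, t]]).

Definition queue_max (f : R -> 'I_m) (a t : R) : R :=
  sup [set queue f a v | v in `[0, t]].

(* First passage times are extended reals, +oo when the set is empty. *)
Definition tau_above (f : R -> 'I_m) (a x : R) : \bar R :=
  ereal_inf [set t%:E | t in [set t | 0 < t /\ x < level f a t]].

Definition tau_below (f : R -> 'I_m) (a x : R) : \bar R :=
  ereal_inf [set t%:E | t in [set t | 0 < t /\ level f a t < x]].

Definition beta (f : R -> 'I_m) : \bar R :=
  ereal_inf [set t%:E | t in [set t | 0 < t /\ f t \in Sp]].

End Paths.

Section Model.
Context {R : realType} {m : nat} {d : measure_display} {T : measurableType d}.
Variables (c : 'I_m -> R) (P : 'I_m -> probability T R).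
Variables (phi : R -> T -> 'I_m) (Y : nat -> {mfun T >-> R}).

(* Y n is the (n+1)-st exponential variable, so erlang k is the sum of the
   first k of them. *)
Definition erlang (k : nat) (w : T) : R := \sum_(n < k) Y n w.

Definition path_of (w : T) : R -> 'I_m := phi ^~ w.

Definition Phi_at (w : T) (tau : \bar R) (j : 'I_m) (n : nat) : Prop :=
  [/\ (tau < +oo)%E, path_of w (fine tau) = j,
      ((erlang n w)%:E <= tau)%E & (tau < (erlang n.+1 w)%:E)%E].

(* Pr i E is the probability of E given initial phase i; the initial level is
   the argument a of level, queue_max, tau_above and tau_below. *)
Definition Pr (i : 'I_m) (E : set T) : R := fine (P i E).

Definition Lambda (x : R) (k : nat) : 'M[R]_(#|Sp c|, #|Sp c|) :=
  \matrix_(i, j) Pr (enum_val i)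
    [set w | (tau_above c (path_of w) 0 x < tau_below c (path_of w) 0 0)%E /\
             Phi_at w (tau_above c (path_of w) 0 x) (enum_val j) k].

Definition Psi (x : R) (k : nat) : 'M[R]_(#|Sp c|, #|Sm c|) :=
  \matrix_(i, u) Pr (enum_val i)
    [set w | (tau_below c (path_of w) 0 0 < tau_above c (path_of w) 0 x)%E /\
             Phi_at w (tau_below c (path_of w) 0 0) (enum_val u) k].

Definition hLambda (x : R) (k : nat) : 'M[R]_(#|Sm c|, #|Sm c|) :=
  \matrix_(i, j) Pr (enum_val i)
    [set w | (tau_below c (path_of w) x 0 < tau_above c (path_of w) x x)%E /\
             Phi_at w (tau_below c (path_of w) x 0) (enum_val j) k].

Definition hPsi (x : R) (k : nat) : 'M[R]_(#|Sm c|, #|Sp c|) :=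
  \matrix_(i, u) Pr (enum_val i)
    [set w | (tau_above c (path_of w) x x < tau_below c (path_of w) x 0)%E /\
             Phi_at w (tau_above c (path_of w) x x) (enum_val u) k].

Definition Upsilon (n : nat) : 'M[R]_(#|Sm c|, #|Sp c|) :=
  \matrix_(i, j) Pr (enum_val i)
    [set w | Phi_at w (beta c (path_of w)) (enum_val j) n].

Definition delta (i : 'I_m) (a x : R) (k : nat) : R :=
  Pr i [set w | queue_max c (path_of w) a (erlang k w) <= x].

Definition delta_plus (a x : R) (k : nat) : 'cV[R]_#|Sp c| :=
  \col_i delta (enum_val i) a x k.

Definition delta_minus (a x : R) (k : nat) : 'cV[R]_#|Sm c| :=
  \col_i delta (enum_val i) a x k.

Definition cdelta_plus (a x : R) (k : nat) : 'cV[R]_#|Sp c| :=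
  const_mx 1 - delta_plus a x k.

Definition cdelta_minus (a x : R) (k : nat) : 'cV[R]_#|Sm c| :=
  const_mx 1 - delta_minus a x k.

End Model.

(* Main.v *)
Require Import Defs.
From HB Require Import structures.
From mathcomp Require Import all_boot all_order all_algebra.
From mathcomp Require Import all_classical all_reals all_analysis.
From mathcomp Require Import measurable_realfun ring lra zify.

Set Implicit Arguments.
Unset Strict Implicit.
Unset Printing Implicit Defensive.

Import Order.TTheory GRing.Theory Num.Theory.
Import numFieldNormedType.Exports.

Local Open Scope classical_set_scope.
Local Open Scope ring_scope.

(** The identities decompose the path at a first passage time, and they hold
    because the pair formed by the phase process and the Erlang clock has the
    strong Markov property.

    Along a path, the event that the queue started at [a] exceeds [x] before
    time [T] can be read on the unrestricted level ([exceeds],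
    [queue_max_exceeds]): at some time before [T] the level is above [x], or
    it is more than [x] above one of its earlier values.  Let [tau] be a
    passage time before which this cannot happen.  Then [x] is exceeded before
    [T] exactly when [tau < T] and the path restarted at [tau], from the queue
    content at [tau], exceeds [x] before [T - tau] ([exceeds_restart]).
    For an initial phase in S_+ the time [tau] is the exit of the level from
    the interval from [a] to [x], and an exit through [x] already settles the
    question ([exceeds_up]); for an initial phase in S_- and [a > 0] it is the
    exit from the interval from [0] to [a] ([exceeds_down]); at level [0] in
    S_- it is the end of the stay at [0] ([exceeds_boundary]).

    In probability, given that [tau] falls in phase [u] and stage [n], the
    restarted path and the time left before the [k]-th tick are distributed
    as the path and the [(k - n)]-th tick under [P u] ([strong_markov]).  To
    see it, replace [tau] by the next point of a grid of mesh [1 / (N + 1)].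
    At a grid point the past and the future of the phases are separated by
    the Markov property, obtained from the finite dimensional laws
    ([markov_stop]), the elapsed and the remaining clock by lack of memory
    ([erlang_memoryless]), and phases and clock are independent; so the
    probability factors ([slice_factor]).  All the conditions are
    right-continuous in time, and the factorisation survives as the mesh
    tends to [0] ([stopped_factor]).  Finite dimensional conditions are then
    replaced by the event [exceeds] by a pi-lambda argument
    ([law_eq_pi_system]), where one has to know that passage events and
    [exceeds] are measurable functionals of a right-continuous path.

    Summing over the exits, the stages and the phases at the exit, which
    partition the event almost surely because the ticks are positive, gives
    three renewal equations ([renewal_up], [renewal_boundary],
    [renewal_down]).  The theorem is the result of substituting the last two
    into the first one and of solving for the unknown.  The matrix to invert
    is the identity minus a nonnegative matrix with row sums less than [1]: a
    path that starts in S_+ needs a positive time to come down, and the first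
    tick may come before ([sum_stopped_lt1], [unitmx_substochastic]). *)

(** * Grids approaching a time from the right *)

Section Grid.
Context {R : realType}.

Definition mesh (N k : nat) : R := k.+1%:R / N.+1%:R.

(** Half-open on the right, so that the grid point attached to a cell lies
    strictly after every point of the cell: a right-continuous path can be
    read there. *)
Definition cell (N k : nat) : set R :=
  [set t | k%:R <= t * N.+1%:R < k.+1%:R].

Lemma cell_ex N (t : R) : 0 <= t -> exists k, cell N k t.
Proof.
move=> t0; exists (Num.truncn (t * N.+1%:R)) => /=.
by apply: truncn_itv; rewrite mulr_ge0.
Qed.

Lemma cell_inj N k l (t : R) : cell N k t -> cell N l t -> k = l.
Proof. by move=> /truncn_def <- /truncn_def <-. Qed.

Lemma mesh_gt N k (t : R) : cell N k t -> t < mesh N k.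
Proof. by move=> /andP[_ h]; rewrite /mesh ltr_pdivlMr. Qed.

Lemma mesh_ge0 N k : 0 <= mesh N k :> R.
Proof. by rewrite /mesh divr_ge0. Qed.

Lemma mesh_le N k (t : R) : cell N k t -> mesh N k <= t + N.+1%:R^-1.
Proof.
move=> /andP[h _]; rewrite /mesh ler_pdivrMr// mulrDl mulVf ?pnatr_eq0//.
by rewrite -natr1 lerD2r.
Qed.

Lemma near_rightP (t : R) (Q : set R) :
  (\forall s \near t^'+, Q s) <->
  exists2 e, 0 < e & forall s, t < s -> s < t + e -> Q s.
Proof.
split; last first.
  move=> [e e0 h]; apply/nbhs_ballP; exists e => //= s; rewrite /ball/= => ste ts.
  by apply: h => //; move: ste; rewrite distrC gtr0_norm ?subr_gt0// ltrBlDl.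
move=> /nbhs_ballP[e /= e0 h]; exists e => // s ts se.
by apply: h => //; rewrite /ball /= distrC gtr0_norm ?subr_gt0// ltrBlDl.
Qed.

(** Right-continuity turns into convergence along the grid: what holds just
    after [t] holds at the grid point that follows [t] on every fine grid. *)
Lemma mesh_near (t : R) (Q : set R) :
  (\forall s \near t^'+, Q s) ->
  exists N0, forall N k, (N0 <= N)%N -> cell N k t -> Q (mesh N k).
Proof.
move=> /near_rightP[e e0 Qe].
have [N0 _ hN0] := near_infty_natSinv_lt (PosNum e0).
exists N0 => N k N0N tk; apply: Qe; first exact: mesh_gt tk.
by apply: (le_lt_trans (mesh_le tk)); rewrite ltrD2l; exact: hN0.
Qed.

End Grid.

(** * The level along a right-continuous path *)

Section Level.
Context {R : realType} {m : nat}.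
Variable c : 'I_m -> R.
Implicit Types (f : R -> 'I_m) (a x y s t u v : R).

Definition right_const f :=
  forall t, 0 <= t -> \forall s \near t^'+, f s = f t.

Lemma right_const_shift f s : right_const f -> 0 <= s ->
  right_const (fun r => f (s + r)).
Proof.
move=> hf s0 t t0; have [e e0 he] := (near_rightP _ _).1 (hf (s + t) (addr_ge0 s0 t0)).
apply/near_rightP; exists e => // r tr re; apply: he; first by rewrite ltrD2l.
by rewrite -addrA ltrD2l.
Qed.

Definition rate_bound : R := \sum_i `|c i|.

Lemma rate_le i : `|c i| <= rate_bound.
Proof.
by rewrite /rate_bound (bigD1 i)//= lerDl sumr_ge0.
Qed.

End Level.

Section JointMeasurability.
Context {R : realType} {m : nat} {d} {T : measurableType d}.
Variables (c : 'I_m -> R) (psi : R -> T -> 'I_m).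
Hypothesis mpsi : forall (t : R) j, 0 <= t -> measurable [set w | psi t w = j].
Hypothesis rpsi : forall w, right_const (psi ^~ w).

Lemma measurable_eventually d' (U : measurableType d') (W : (set U)^nat) :
  (forall N, measurable (W N)) ->
  measurable [set w | exists N0, forall N, (N0 <= N)%N -> W N w].
Proof.
move=> mW.
rewrite (_ : [set _ | _] = \bigcup_N0 \bigcap_N (if (N0 <= N)%N then W N else setT)).
  by apply: bigcup_measurable => N0 _; apply: bigcapT_measurable => N; case: ifP.
apply/seteqP; split => w /=.
  by move=> [N0 h]; exists N0 => // N _ /=; case: ifPn => // /h.
by move=> [N0 _ h]; exists N0 => N N0N; have := h N I; rewrite N0N.
Qed.

Lemma measurable_cell N k : measurable (cell N k : set (measurableTypeR R)).
Proof.
rewrite (_ : cell N k = `[k%:R / N.+1%:R, k.+1%:R / N.+1%:R[%classic).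
  exact: measurable_itv.
apply/seteqP; split => t /=; rewrite in_itv/=;
by rewrite /cell/= ler_pdivrMr// ltr_pdivlMr.
Qed.

(** The process read at the grid point that follows [t] is a countable
    combination of rectangles, and by right-continuity it is eventually equal
    to the process at [t]. *)
Lemma measurable_process (j : 'I_m) :
  measurable [set p : T * measurableTypeR R | 0 <= p.2 /\ psi p.2 p.1 = j].
Proof.
pose W N : set (T * measurableTypeR R) :=
  \bigcup_k ([set w | psi (mesh N k) w = j] `*` cell N k).
have mW N : measurable (W N).
  apply: bigcup_measurable => k _; apply: measurableX; last exact: measurable_cell.
  by apply: mpsi; exact: mesh_ge0.
have := measurable_eventually mW; congr measurable.
apply/seteqP; split => -[w t] /=.
  move=> [N0 h].
  have t0 : 0 <= t.
    have [k _ [/= _ /andP[k0 _]]] := h N0 (leqnn _).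
    by rewrite -(pmulr_lge0 _ (ltr0Sn R N0)); exact: le_trans k0.
  split=> //; have [N1 hN1] := mesh_near (rpsi w t0).
  have [k _ [/= <- tk]] := h (maxn N0 N1) (leq_maxl _ _).
  by apply/esym/(hN1 _ _ _ tk); exact: leq_maxr.
move=> [t0 tj]; have [N1 hN1] := mesh_near (rpsi w t0).
exists N1 => N N1N; have [k tk] := cell_ex N t0.
by exists k => //; split => //=; rewrite (hN1 N k).
Qed.

(** Negative times are sent to [0], since the paths are only controlled on
    nonnegative times; the level only integrates over the latter. *)
Let rate (p : T * measurableTypeR R) : R := c (psi (Num.max 0 p.2) p.1).

Lemma measurable_rate : measurable_fun setT rate.
Proof.
move=> _ B mB; rewrite setTI.
rewrite (_ : _ @^-1` _ = \bigcup_(j in [set j | B (c j)])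
   (fun p => (p.1, Num.max 0 p.2)) @^-1`
   [set p : T * measurableTypeR R | 0 <= p.2 /\ psi p.2 p.1 = j]).
  apply: fin_bigcup_measurable; first exact: finite_finset.
  move=> j _; rewrite -[X in measurable X]setTI.
  have mf : measurable_fun setT
    (fun p : T * measurableTypeR R => (p.1, (Num.max 0 p.2 : measurableTypeR R))).
    apply/measurable_fun_pair => //; apply: measurable_maxr => //.

  apply: (mf measurableT); exact: measurable_process.
apply/seteqP; split => -[w t] /=.
  by move=> h; exists (psi (Num.max 0 t) w) => //=; rewrite le_max lexx.
by move=> [j /= Bj [_ /= h]]; rewrite /rate/= h.
Qed.

End JointMeasurability.

Lemma measurable_cst_prop d (T : measurableType d) (Q : Prop) :
  measurable [set _ : T | Q].
Proof.
have [q|q] := pselect Q.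
  by rewrite (_ : [set _ | _] = setT)//; apply/seteqP; split.
by rewrite (_ : [set _ | _] = set0)//; apply/seteqP; split.
Qed.

Section LevelFacts.
Context {R : realType} {m : nat}.
Variable c : 'I_m -> R.
Implicit Types (f : R -> 'I_m) (a x y s t u v : R).

Lemma measurable_path_rate f (hf : right_const f) :
  measurable_fun setT (fun s : measurableTypeR R => c (f (Num.max 0 s))).
Proof.
have mf : measurable_fun setT
    (fun p : unit * measurableTypeR R => c (f (Num.max 0 p.2))).
  apply: (@measurable_rate _ _ _ unit c (fun s _ => f s)) => [t j t0|_ //].
  exact: measurable_cst_prop.
exact: (measurable_fun_pair2 tt mf).
Qed.

Lemma integrable_path_rate f (hf : right_const f) (A : set R) :
  measurable A -> (lebesgue_measure A < +oo)%E ->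
  lebesgue_measure.-integrable A (EFin \o (fun s => c (f (Num.max 0 s)))).
Proof.
move=> mA Afin; apply: measurable_bounded_integrable => //.
  by apply: (@measurable_funS _ _ _ _ setT) => //; exact: measurable_path_rate.
exists (rate_bound c); split; first exact: num_real.
by move=> M hM s _ /=; rewrite (le_trans (rate_le _ _))// ltW.
Qed.

Lemma level_max f a t : level c f a t =
  a + \int[lebesgue_measure]_(s in `[0, t]) c (f (Num.max 0 s)).
Proof.
congr (_ + _); apply: eq_Rintegral => s; rewrite inE/= in_itv/= => /andP[s0 _].
by rewrite max_r.
Qed.

Lemma level_start f a t : level c f a t = a + level c f 0 t.
Proof. by rewrite /level add0r. Qed.

Lemma level0 f a : level c f a 0 = a.
Proof. by rewrite /level set_itv1 Rintegral_set1 addr0. Qed.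

Lemma level_congr f g a t : (forall s, 0 <= s <= t -> f s = g s) ->
  level c f a t = level c g a t.
Proof.
move=> fg; congr (_ + _); apply: eq_Rintegral => s.
by rewrite inE/= in_itv/= => /fg ->.
Qed.

Lemma level_incr f (hf : right_const f) a s t : 0 <= s -> s <= t ->
  level c f a t - level c f a s =
  \int[lebesgue_measure]_(r in `]s, t[) c (f (Num.max 0 r)).
Proof.
move=> s0 st; rewrite !level_max opprD addrACA subrr add0r.
rewrite Rintegral_itvB ?bnd_simp//.
  rewrite -Rintegral_itv_bndo_bndc//; apply: integrable_path_rate => //.
  by rewrite lebesgue_measure_itv/=; case: ifP => // _; rewrite ltry.
apply: integrable_path_rate => //.
by rewrite lebesgue_measure_itv/=; case: ifP => // _; rewrite ltry.
Qed.

(** The level is only ever estimated through bounds on the rate: [M = 0] gives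
    monotonicity on stretches of negative rate, and the largest absolute rate
    gives Lipschitz continuity. *)
Lemma level_le f (hf : right_const f) a s t M : 0 <= s -> s <= t ->
  (forall r, s < r < t -> c (f r) <= M) ->
  level c f a t - level c f a s <= M * (t - s).
Proof.
move=> s0 st hM; rewrite (level_incr hf)//.
have ist : (lebesgue_measure (`]s, t[%classic : set R) < +oo)%E.
  by rewrite lebesgue_measure_itv/=; case: ifP => // _; rewrite ltry.
have -> : M * (t - s) = \int[lebesgue_measure]_(r in `]s, t[) M.
  rewrite Rintegral_cst//.
  congr (_ * _); apply: (@eq_trans _ _ (fine (lebesgue_measure (`]s, t[%classic : set
    R)))) => //.
  rewrite lebesgue_measure_itv/= lte_fin.
  by move: st; rewrite le_eqVlt => /predU1P[->|->//]; rewrite ltxx subrr.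
apply: le_Rintegral => //; first exact: integrable_path_rate.
  apply: measurable_bounded_integrable => //.
  by exists `|M|; split; [exact: num_real|move=> N hN r _ /=; exact: ltW].
move=> r /=; rewrite in_itv/= => str; rewrite max_r ?hM//.
by case/andP: str => /ltW sr _; exact: le_trans sr.
Qed.

End LevelFacts.

Lemma lebesgue_measure_shift (R : realType) (s : R) (A : set R) :
  measurable A ->
  pushforward lebesgue_measure
    (fun r : measurableTypeR R => s + r : measurableTypeR R) A =
  lebesgue_measure A.
Proof.
have mt : measurable_fun setT (fun r : measurableTypeR R => s + r : measurableTypeR R).
  by apply: measurable_funD => //; exact: measurable_cst.
move=> mA; apply/esym.
pose mu' := [the measure _ _ of pushforward lebesgue_measure (fun r : measurableTypeR R
  => s + r : measurableTypeR R)].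
apply: (@lebesgue_measure_unique R (mu' mt)) => // _ [[a b]] _ <-.
rewrite /mu'/= /pushforward.
rewrite (_ : _ @^-1` _ = `]a - s, b - s]%classic).
  rewrite !lebesgue_measure_itv/= !lte_fin ltrD2r -!EFinD.
  by rewrite opprD addrACA opprK addNr addr0.
by apply/seteqP; split => r /=; rewrite !in_itv/= ltrBlDl lerBrDl.
Qed.

Section LevelNeg.
Context {R : realType} {m : nat}.
Variable c : 'I_m -> R.
Implicit Types (f : R -> 'I_m) (a x y s t u v : R).

(** Reflection exchanges the two barriers, so that facts about the passage
    below a level follow from facts about the passage above one. *)
Lemma level_opp f (hf : right_const f) a t :
  level (fun i => - c i) f (- a) t = - level c f a t.
Proof.
rewrite !level_max opprD; congr (_ + _).
have it : (lebesgue_measure (`[0%R, t]%classic : set R) < +oo)%E.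
  by rewrite lebesgue_measure_itv/=; case: ifP => // _; rewrite ltry.
have it2 := @integrable_path_rate R m c f hf _ (measurable_itv _) it.
rewrite -[RHS]mulN1r -RintegralZl//.
by apply: eq_Rintegral => s _; rewrite mulN1r.
Qed.

Lemma level_ge f (hf : right_const f) a s t M : 0 <= s -> s <= t ->
  (forall r, s < r < t -> M <= c (f r)) ->
  M * (t - s) <= level c f a t - level c f a s.
Proof.
move=> s0 st hM.
have := @level_le R m (fun i => - c i) f hf (- a) s t (- M) s0 st.
rewrite !level_opp// => h.
suff : - level c f a t - - level c f a s <= - M * (t - s) by lra.
by apply: h => r /hM; rewrite lerN2.
Qed.

Lemma level_lip f (hf : right_const f) a s t : 0 <= s -> s <= t ->
  `|level c f a t - level c f a s| <= rate_bound c * (t - s).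
Proof.
move=> s0 st; rewrite ler_norml -mulNr level_ge ?level_le// => r _.
  by rewrite (le_trans (ler_norm _))// rate_le.
by rewrite lerNl (le_trans (ler_norm _))// normrN rate_le.
Qed.

Lemma level_shift f (hf : right_const f) a s v : 0 <= s -> 0 <= v ->
  level c f a (s + v) = level c (fun r => f (s + r)) (level c f a s) v.
Proof.
move=> s0 v0; have svi : s <= s + v by rewrite lerDl.
pose g := fun r => f (s + r); have hg : right_const g := right_const_shift hf s0.
rewrite [RHS]level_start; apply/eqP; rewrite [eqbRHS]addrC -subr_eq; apply/eqP.
rewrite (level_incr c hf)// -[RHS]subr0 -[X in _ - X](level0 c g 0) (level_incr c hg)//.
have mt : measurable_fun setT (fun r : measurableTypeR R => (s + r : measurableTypeR R)).
  by apply: measurable_funD => //; exact: measurable_cst.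
rewrite /Rintegral.
transitivity (fine (\int[pushforward lebesgue_measure
    (fun r : measurableTypeR R => (s + r)%R : measurableTypeR R)]_(r in `]s, (s + v)%R[)
    (c (f (Num.max 0 r)))%:E)%E).
  by congr fine; apply: eq_measure_integral => A mA _; apply/esym/lebesgue_measure_shift.
have pre : (fun r : R => s + r) @^-1` `]s, (s + v)[%classic = `]0, v[%classic.
  by apply/seteqP; split => r /=; rewrite !in_itv/= ltrDl ltrD2l.
congr fine; rewrite integral_pushforward//.
- rewrite pre; apply: eq_integral => r; rewrite inE/= in_itv/= => /andP[r0 _].
  by rewrite !max_r// ?addr_ge0// ltW.
- by apply/measurable_EFinP; exact: (measurable_path_rate c hf).
- rewrite pre.
  have fin0v : (lebesgue_measure (`]0%R, v[%classic : set R) < +oo)%E.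
    by rewrite lebesgue_measure_itv/=; case: ifP => // _; rewrite ltry.
  have ig := @integrable_path_rate R m c g hg _ (measurable_itv _) fin0v.
  apply: eq_integrable ig => //.
  move=> r; rewrite inE/= in_itv/= => /andP[r0 _].
  by rewrite !max_r// ?addr_ge0// ltW.
Qed.

End LevelNeg.

(** * First passage times of the level *)

Section FirstPassage.
Context {R : realType} {m : nat}.
Implicit Types (c : 'I_m -> R) (f : R -> 'I_m) (a x y s t u v : R).

Lemma ereal_inf_ltP (S : set R) (r : R) :
  (ereal_inf [set t%:E | t in S] < r%:E)%E <-> exists2 t, S t & t < r.
Proof.
split=> [/ereal_inf_lt[_ [t St <-]]|[t St tr]]; first by rewrite lte_fin; exists t.
by apply: (le_lt_trans (ereal_inf_lbound _)); [exists t; first exact: St|].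
Qed.

Lemma tau_above_ltP c f a y (r : R) : (tau_above c f a y < r%:E)%E <->
  exists t, [/\ 0 < t, t < r & y < level c f a t].
Proof.
split=> [/ereal_inf_ltP[t [t0 yt] tr]|[t [t0 tr yt]]]; first by exists t.
by apply/ereal_inf_ltP; exists t.
Qed.

Lemma beta_ltP c f (r : R) : (beta c f < r%:E)%E <->
  exists t, [/\ 0 < t, t < r & f t \in Sp c].
Proof.
split=> [/ereal_inf_ltP[t [t0 yt] tr]|[t [t0 tr yt]]]; first by exists t.
by apply/ereal_inf_ltP; exists t.
Qed.

Lemma tau_above_ge0 c f a y : (0 <= tau_above c f a y)%E.
Proof. by apply: le_ereal_inf_tmp => _ [t [t0 _] <-]; rewrite lee_fin ltW. Qed.

Lemma beta_ge0 c f : (0 <= beta c f)%E.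
Proof. by apply: le_ereal_inf_tmp => _ [t [t0 _] <-]; rewrite lee_fin ltW. Qed.

Lemma tau_below_opp c f a y : right_const f ->
  tau_below c f a y = tau_above (fun i => - c i) f (- a) (- y).
Proof.
move=> hf; congr (ereal_inf [set t%:E | t in _]).
by apply/seteqP; split => t /= [t0]; rewrite level_opp// ltrN2.
Qed.

Lemma tau_above_opp c f a y : right_const f ->
  tau_above c f a y = tau_below (fun i => - c i) f (- a) (- y).
Proof.
move=> hf; congr (ereal_inf [set t%:E | t in _]).
by apply/seteqP; split => t /= [t0]; rewrite level_opp// ltrN2.
Qed.

Lemma rate_bound_ge0 c : 0 <= rate_bound c.
Proof. by rewrite sumr_ge0. Qed.

(** Continuity of the level, with a whole interval of witnesses so that a
    rational one can be found in it. *)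
Lemma level_above_left_itv c f a y l s : right_const f -> 0 <= l -> l < s ->
  y < level c f a s ->
  exists l', [/\ l <= l', l' < s & forall t, l' < t -> t < s -> y < level c f a t].
Proof.
move=> hf l0 ls ys; pose K := rate_bound c + 1.
have K0 : 0 < K by rewrite ltr_wpDl// rate_bound_ge0.
pose e := Num.min ((s - l) / 2) ((level c f a s - y) / K).
have e0 : 0 < e by rewrite lt_min !divr_gt0// subr_gt0.
have e1 : e <= (s - l) / 2 by rewrite ge_min lexx.
have e2 : e * K <= level c f a s - y by rewrite -ler_pdivlMr// ge_min lexx orbT.
exists (s - e); split; [lra|lra|move=> t tl ts].
have t0 : 0 <= t by lra.
have := @level_lip R m c f hf a t s t0 (ltW ts).
rewrite ler_norml => /andP[_ h].
have Kst : K * (s - t) <= K * e by rewrite ler_pM2l//; lra.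
have Ksum : K * (s - t) = rate_bound c * (s - t) + (s - t).
  by rewrite /K mulrDl mul1r.
by rewrite (mulrC K e) in Kst; lra.
Qed.

Lemma level_above_left c f a y l s : right_const f -> 0 <= l -> l < s ->
  y < level c f a s -> exists t, [/\ l < t, t < s & y < level c f a t].
Proof.
move=> hf l0 ls ys; have [l' [ll' l's h]] := level_above_left_itv hf l0 ls ys.
have l'm : l' < (l' + s) / 2 by lra.
have ms : (l' + s) / 2 < s by lra.
by exists ((l' + s) / 2); split => //; [exact: le_lt_trans l'm|exact: h].
Qed.

Lemma level_below_left_itv c f a y l s : right_const f -> 0 <= l -> l < s ->
  level c f a s < y ->
  exists l', [/\ l <= l', l' < s & forall t, l' < t -> t < s -> level c f a t < y].
Proof.
move=> hf l0 ls ys.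
have [|l' [ll' l's h]] := @level_above_left_itv (fun i => - c i) f (- a) (- y) l s hf l0 ls.
  by rewrite level_opp// ltrN2.
by exists l'; split => // t lt ts; have := h t lt ts; rewrite level_opp// ltrN2.
Qed.

Lemma level_above_right c f a y s : right_const f -> 0 <= s ->
  (forall e, 0 < e -> exists t, [/\ s < t, t < s + e & y < level c f a t]) ->
  y <= level c f a s.
Proof.
move=> hf s0 h; rewrite leNgt; apply/negP => ys; pose K := rate_bound c + 1.
have K0 : 0 < K by rewrite ltr_wpDl// rate_bound_ge0.
have [|t [st te yt]] := h ((y - level c f a s) / K).
  by rewrite divr_gt0// subr_gt0.
have := @level_lip R m c f hf a s t s0 (ltW st).
rewrite ler_norml => /andP[_]; apply/negP; rewrite -ltNge.
apply: (@lt_trans _ _ (y - level c f a s)); last by rewrite ltrD2r.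
rewrite -ltrBlDl ltr_pdivlMr// in te; apply: le_lt_trans te.
by rewrite mulrC ler_pM2l ?subr_gt0// lerDl.
Qed.

Section Above.
Variables (c : 'I_m -> R) (hc : forall i, c i != 0) (f : R -> 'I_m).
Hypothesis hf : right_const f.
Variables (a y : R) (ay : a <= y).
Let tau := tau_above c f a y.

(** A level above [y] at time [s] would by continuity already be above [y] a
    little earlier. *)
Lemma level_le_tau_above s : 0 <= s -> (s%:E <= tau)%E -> level c f a s <= y.
Proof.
move=> s0; rewrite leNgt => sle; rewrite leNgt; apply: contra sle => ys.
have s1 : 0 < s.
  by rewrite lt0r s0 andbT; apply: contraTneq ys => ->; rewrite level0 -leNgt.
have [t [t0 ts yt]] := level_above_left hf (lexx 0) s1 ys.
by apply/tau_above_ltP; exists t.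
Qed.

Variable t0 : R.
Hypothesis tau_t0 : tau = t0%:E.

Lemma tau_above_real_ge0 : 0 <= t0.
Proof. by rewrite -lee_fin -tau_t0 tau_above_ge0. Qed.

Lemma level_gt_after_tau_above e : 0 < e ->
  exists t, [/\ t0 < t, t < t0 + e & y < level c f a t].
Proof.
move=> e0; have /tau_above_ltP[t [tpos te yt]] : (tau < (t0 + e)%:E)%E.
  by rewrite tau_t0 lte_fin ltrDl.
exists t; split => //; rewrite ltNge; apply: contraTN yt => tt0.
by rewrite -leNgt level_le_tau_above ?(ltW tpos)// tau_t0 lee_fin.
Qed.

Lemma level_tau_above : level c f a t0 = y.
Proof.
apply/eqP; rewrite eq_le level_le_tau_above ?tau_above_real_ge0 ?tau_t0//=.
by apply: level_above_right => //; [exact: tau_above_real_ge0|exact: level_gt_after_tau_above].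
Qed.

(** With a negative rate at the passage time the level would go down for a
    while, instead of being above [y] immediately afterwards. *)
Lemma rate_tau_above : 0 < c (f t0).
Proof.
rewrite lt0r hc/= leNgt; apply/negP => cneg.
have [e e0 he] := (near_rightP _ _).1 (hf tau_above_real_ge0).
have [t [tt0 te]] := level_gt_after_tau_above e0.
apply/negP; rewrite -leNgt -level_tau_above -subr_le0.
apply: le_trans (@level_le R m c f hf a t0 t 0 tau_above_real_ge0 (ltW tt0) _) _.
  by move=> r /andP[r1 r2]; rewrite he// ?ltW//; exact: lt_trans te.
by rewrite mul0r.
Qed.

End Above.

End FirstPassage.

Section Below.
Context {R : realType} {m : nat}.
Variables (c : 'I_m -> R) (hc : forall i, c i != 0) (f : R -> 'I_m).
Hypothesis hf : right_const f.
Variables (a y : R) (ya : y <= a).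

Let hNc i : - c i != 0. Proof. by rewrite oppr_eq0. Qed.
Let Nay : - a <= - y. Proof. by rewrite lerN2. Qed.

Lemma level_ge_tau_below s : 0 <= s -> (s%:E <= tau_below c f a y)%E ->
  y <= level c f a s.
Proof.
move=> s0; rewrite tau_below_opp// => h.
by have := level_le_tau_above hf Nay s0 h; rewrite level_opp// lerN2.
Qed.

Lemma tau_below_ge0 : (0 <= tau_below c f a y)%E.
Proof. by rewrite tau_below_opp// tau_above_ge0. Qed.

Lemma level_tau_below t0 : tau_below c f a y = t0%:E -> level c f a t0 = y.
Proof.
rewrite tau_below_opp// => h.
have := level_tau_above hf Nay h; rewrite level_opp// => e.
by apply: oppr_inj.
Qed.

Lemma rate_tau_below t0 : tau_below c f a y = t0%:E -> c (f t0) < 0.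
Proof.
rewrite tau_below_opp// => h.
by have := rate_tau_above hNc hf Nay h; rewrite oppr_gt0.
Qed.

End Below.

Section Beta.
Context {R : realType} {m : nat}.
Variables (c : 'I_m -> R) (hc : forall i, c i != 0) (f : R -> 'I_m).
Hypothesis hf : right_const f.

Lemma rate_before_beta s : 0 < s -> (s%:E < beta c f)%E -> c (f s) <= 0.
Proof.
move=> s0 sb; rewrite leNgt; apply/negP => cs.
have : (beta c f <= s%:E)%E.
  by apply: ereal_inf_lbound; exists s => //; split => //; rewrite inE.
by rewrite leNgt sb.
Qed.

Lemma level_before_beta a s t : 0 <= s -> s <= t -> (t%:E <= beta c f)%E ->
  level c f a t <= level c f a s.
Proof.
move=> s0 st tb; rewrite -subr_le0 -[leRHS](mul0r (t - s)).
apply: level_le => // r /andP[sr rt]; apply: rate_before_beta.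
  exact: le_lt_trans sr.
by apply: lt_le_trans tb; rewrite lte_fin.
Qed.

Lemma phase_beta t0 : beta c f = t0%:E -> f t0 \in Sp c.
Proof.
move=> bt0; have t00 : 0 <= t0 by rewrite -lee_fin -bt0 beta_ge0.
have [e e0 he] := (near_rightP _ _).1 (hf t00).
have /beta_ltP[t [tpos te ft]] : (beta c f < (t0 + e)%:E)%E.
  by rewrite bt0 lte_fin ltrDl.
have : t0 <= t.
  rewrite leNgt; apply/negP => tt0.
  have : (beta c f < t0%:E)%E by apply/beta_ltP; exists t.
  by rewrite bt0 ltxx.
by rewrite le_eqVlt => /predU1P[->//|tt0]; rewrite -(he t).
Qed.

End Beta.

(** * The event that the queue exceeds a level *)

Section Exceeds.
Context {R : realType} {m : nat}.
Variable c : 'I_m -> R.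
Implicit Types (f : R -> 'I_m) (a x T : R).

(** This is [x < queue c f a v] with the regulator unfolded: the queue content
    is the largest of the level and of its increments from earlier times. *)
Definition overflow f a x v :=
  x < level c f a v \/ exists u, 0 <= u <= v /\ x < level c f a v - level c f a u.

(** The time interval is open, which costs nothing as the queue is continuous
    and starts at [a <= x], and which leaves room for rational times. *)
Definition exceeds f a x T := exists v, [/\ 0 < v, v < T & overflow f a x v].

Lemma overflow_queue f a x v : right_const f -> 0 <= v ->
  x < queue c f a v <-> overflow f a x v.
Proof.
move=> hf v0; rewrite /queue; set S := [set level c f a u | u in _].
have S0 : S !=set0 by exists (level c f a 0); exists 0 => //=; rewrite in_itv/= lexx.
have lS : has_lbound S.
  exists (a - rate_bound c * v) => _ [u /= /[!in_itv]/= /andP[u0 uv] <-].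
  have := level_lip c hf a (lexx 0) u0; rewrite level0 subr0 ler_norml.
  move=> /andP[h _]; have := ler_wpM2l (rate_bound_ge0 c) uv; lra.
split.
  case: (leP 0 (inf S)) => hi; rewrite ?subr0; first by left.
  rewrite ltrBrDr -ltrBrDl => /inf_lt[//|_ [u /= /[!in_itv]/= uv <-] h].
  by right; exists u; split => //; lra.
move=> [xv|[u [uv xu]]].
  by apply: (lt_le_trans xv); rewrite lerBrDr gerDl ge_min lexx.
apply: (lt_le_trans xu); rewrite lerD2l lerN2 ge_min; apply/orP; right.
by apply: ge_inf => //; exists u.
Qed.

Lemma overflow_left f a x l v : right_const f -> a <= x -> 0 <= x -> 0 <= l ->
  l < v -> overflow f a x v -> exists2 w, l < w < v & overflow f a x w.
Proof.
move=> hf ax x0 l0 lv [xv|[u [/andP[u0 uv] xu]]].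
  have [t [lt tv xt]] := level_above_left hf l0 lv xv.
  by exists t; [rewrite lt|left].
have {}uv : u < v by rewrite lt_neqAle uv andbT; apply: contraTneq xu => ->;
  rewrite subrr -leNgt.
have l'0 : 0 <= Num.max l u by rewrite le_max l0.
have l'v : Num.max l u < v by rewrite gt_max lv.
have [|t [+ tv xt]] := @level_above_left _ _ c f a (x + level c f a u) _ _ hf l'0 l'v;
  first by lra.
rewrite gt_max => /andP[lt ut].
by exists t; [rewrite lt|right; exists u; rewrite u0 ltW//; split => //; lra].
Qed.

Lemma queue_has_ubound f a T : right_const f -> 0 <= a ->
  has_ubound [set queue c f a v | v in `[0, T]].
Proof.
move=> hf a0; exists (a + 2 * (rate_bound c * T)) => _ [w /= /[!in_itv]/= /andP[w0 wT] <-].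
rewrite leNgt; apply/negP => /(overflow_queue _ _ hf w0).
have B t : 0 <= t -> t <= T -> `|level c f a t - a| <= rate_bound c * T.
  move=> t0 tT; have := level_lip c hf a (lexx 0) t0; rewrite level0 subr0.
  by move=> /le_trans; apply; rewrite ler_wpM2l// rate_bound_ge0.
have KT : 0 <= rate_bound c * T by rewrite mulr_ge0 ?rate_bound_ge0// (le_trans w0).
have := B w w0 wT; rewrite ler_norml => /andP[w1 w2] [|[u [/andP[u0 uw]]]].
  by lra.
have := B u u0 (le_trans uw wT); rewrite ler_norml => /andP[u1 u2]; lra.
Qed.

Lemma queue_max_exceeds f a x T : right_const f -> 0 <= a -> a <= x ->
  x < queue_max c f a T <-> exceeds f a x T.
Proof.
move=> hf a0 ax; have x0 : 0 <= x by exact: le_trans ax.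
rewrite /queue_max; set S := [set queue c f a v | v in _].
have not0 : ~ overflow f a x 0.
  case=> [|[u [/le_anti <-]]]; first by rewrite level0; lra.
  by lra.
split.
  have [T0|T0] := ltP T 0.
    rewrite (_ : S = set0) ?sup0; first by lra.
    apply/seteqP; split => // _ [v /= /[!in_itv]/= /andP[v0 vT] _].
    by have := lt_le_trans T0 (le_trans v0 vT); rewrite ltxx.
  have S0 : S !=set0.
    by exists (queue c f a 0); exists 0 => //=; rewrite in_itv/= lexx.
  move=> /(sup_gt S0)[_ [v /= /[!in_itv]/= /andP[v0 vT] <-]].
  move=> /(overflow_queue _ _ hf v0) cv.
  have {}v0 : 0 < v.
    by rewrite lt0r v0 andbT; apply/eqP => v0'; apply: not0; rewrite -v0'.
  have [w /andP[w0 wv] cw] := overflow_left hf ax x0 (lexx 0) v0 cv.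
  by exists w; split => //; exact: lt_le_trans vT.
move=> [v [v0 vT /(overflow_queue _ _ hf (ltW v0)) xv]].
apply: (lt_le_trans xv); apply: ub_le_sup; first exact: queue_has_ubound.
by exists v => //=; rewrite in_itv/= !ltW.
Qed.

Lemma queue_max_ge f a T : right_const f -> 0 <= a -> 0 <= T ->
  a <= queue_max c f a T.
Proof.
move=> hf a0 T0; apply: ub_le_sup; first exact: queue_has_ubound.
exists 0; first by rewrite /= in_itv/= lexx.
rewrite /queue (_ : [set level c f a v | v in `[0, 0]] = [set a]).
  by rewrite inf1 level0 min_l ?subr0.
rewrite set_itv1; apply/seteqP; split => y /=.
  by move=> [_ -> <-]; rewrite level0.
by move=> ->; exists 0; rewrite ?level0.
Qed.

Definition quiet f a x t0 := forall v, 0 < v -> v <= t0 -> ~ overflow f a x v.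

Lemma quiet_not_exceeds f a x t0 T : quiet f a x t0 -> T <= t0 ->
  ~ exceeds f a x T.
Proof.
by move=> q Tt0 [v [v0 vT]]; apply: q => //; rewrite (le_trans (ltW vT)).
Qed.

(** Here [a'] is the queue content at [t0].  The increments that straddle [t0]
    are accounted for by the level of the restarted path, because no increment
    that ends at [t0] is larger than [a']; conversely [a'] is the level at [t0]
    or one of these increments. *)
Lemma exceeds_restart f a x t0 a' T : right_const f -> 0 <= t0 ->
  quiet f a x t0 ->
  level c f a t0 <= a' ->
  (forall u, 0 <= u <= t0 -> level c f a t0 - level c f a u <= a') ->
  (a' = level c f a t0 \/
     exists u, 0 <= u <= t0 /\ a' = level c f a t0 - level c f a u) ->
  exceeds f a x T <-> t0 < T /\ exceeds (fun r => f (t0 + r)) a' x (T - t0).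
Proof.
move=> hf t00 q la' ua' a'P.
have sh v : 0 <= v -> level c (fun r => f (t0 + r)) a' v =
    a' - level c f a t0 + level c f a (t0 + v).
  by move=> v0; rewrite level_shift// (level_start c _ a') (level_start c _ (level c f
    a t0) v); lra.
split.
  move=> [v [v0 vT cv]].
  have vt0 : t0 < v by rewrite ltNge; apply/negP => /(q v v0).
  split; first exact: lt_trans vT.
  exists (v - t0); split; [lra|lra|].
  have sv : t0 + (v - t0) = v by lra.
  case: cv => [xv|[u [/andP[u0 uv] xu]]].
    by left; rewrite sh ?sv//; lra.
  have [tu|ut] := leP t0 u.
    right; exists (u - t0); split; first by apply/andP; split; lra.
    have su : t0 + (u - t0) = u by lra.
    by rewrite !sh ?sv ?su; lra.
  left; rewrite sh ?sv//; last by lra.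
  by have := ua' u; rewrite u0 (ltW ut) => /(_ isT); lra.
move=> [t0T [v [v0 vT cv]]]; exists (t0 + v); split; [lra|lra|].
case: cv => [|[u [/andP[u0 uv]]]]; rewrite !sh ?(ltW v0)//.
  case: a'P => [->|[u [/andP[u0 ut] ->]]] h; first by left; lra.
  by right; exists u; split; [rewrite u0; lra|lra].
by move=> h; right; exists (t0 + u); split; [apply/andP; split; lra|lra].
Qed.

End Exceeds.

(** * Decomposition of a path at its exit from a window *)

Section Decomposition.
Context {R : realType} {m : nat}.
Variables (c : 'I_m -> R) (hc : forall i, c i != 0).
Implicit Types (f : R -> 'I_m) (a b e x T lo hi : R).

Definition shift_path f (s : R) : R -> 'I_m := fun r => f (s + r).

Lemma quiet_between f a x t0 : right_const f -> 0 <= a -> a <= x ->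
  (forall s : R, 0 <= s <= t0 -> 0 <= level c f a s <= x) -> quiet c f a x t0.
Proof.
move=> hf a0 ax h v v0 vt0 [|[u [/andP[u0 uv]]]].
  by have := h v; rewrite (ltW v0) vt0 => /(_ isT)/andP[_]; lra.
have := h v; rewrite (ltW v0) vt0 => /(_ isT)/andP[_].
by have := h u; rewrite u0 (le_trans uv vt0) => /(_ isT)/andP[+ _]; lra.
Qed.

Lemma exceeds_from_top f x T : right_const f -> 0 < c (f 0) -> 0 < T ->
  exceeds c f x x T.
Proof.
move=> hf cf T0; have [e e0 he] := (near_rightP _ _).1 (hf 0 (lexx 0)).
pose v := Num.min e T / 2.
have v0 : 0 < v by rewrite divr_gt0// lt_min e0.
have ve : v < e by rewrite /v ltr_pdivrMr// gt_min; apply/orP; left; lra.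
have vT : v < T by rewrite /v ltr_pdivrMr// gt_min; apply/orP; right; lra.
exists v; split => //; left.
have := @level_ge R m c f hf x 0 v (c (f 0)) (lexx 0) (ltW v0).
rewrite level0 subr0 => h; have := mulr_gt0 cf v0.
suff : c (f 0) * v <= level c f x v - x by lra.
by apply: h => r /andP[r0 rv]; rewrite he// add0r (lt_trans rv).
Qed.

Lemma sandwich (e lo hi z x : R) : 0 <= e + lo -> e + hi <= x ->
  lo <= z -> z <= hi -> 0 <= e + z <= x.
Proof. by move=> *; apply/andP; split; lra. Qed.

Section Window.
Variables (f : R -> 'I_m) (hf : right_const f) (b lo hi e x : R).
Hypotheses (lob : lo <= b) (bhi : b <= hi) (elo : 0 <= e + lo ) (ehi : e + hi <= x ).
Let ta := tau_above c f b hi.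
Let tb := tau_below c f b lo.

Let levelE s : level c f (e + b) s = e + level c f b s.
Proof. by rewrite /level addrA. Qed.

Let between t0 : (t0%:E <= ta)%E -> (t0%:E <= tb)%E ->
  forall s : R, 0 <= s <= t0 -> 0 <= level c f (e + b) s <= x.
Proof.
move=> h1 h2 s /andP[s0 st0]; rewrite levelE.
have := @level_le_tau_above R m c f hf b hi bhi s s0.
have := @level_ge_tau_below R m c f hf b lo lob s s0.
have st0' : (s%:E <= t0%:E)%E by rewrite lee_fin.
move=> /(_ (le_trans st0' h2)) l1 /(_ (le_trans st0' h1)) l2.
exact: (sandwich elo ehi).
Qed.

Lemma window_quiet t0 : (t0%:E <= ta)%E -> (t0%:E <= tb)%E ->
  quiet c f (e + b) x t0.
Proof. have /andP[b0 bx] := sandwich elo ehi lob bhi.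
by move=> h1 h2; apply: quiet_between => //; exact: between. Qed.

Lemma window_restart t0 T a' : 0 <= t0 -> (t0%:E <= ta)%E -> (t0%:E <= tb)%E ->
  level c f b t0 = a' ->
  exceeds c f (e + b) x T <->
  t0 < T /\ exceeds c (shift_path f t0) (e + a') x (T - t0).
Proof.
move=> t00 h1 h2 <-; rewrite -levelE.
apply: exceeds_restart => //; [exact: window_quiet| |by left].
by move=> u /(between h1 h2)/andP[]; lra.
Qed.

(** At a finite common value the rate would be both positive and negative. *)
Lemma window_tie : ta = tb -> ta = +oo%E.
Proof.
have : (0 <= ta)%E by exact: tau_above_ge0.
case E : ta => [t0| |//] // _ tE.
have := rate_tau_above hc hf bhi E.
by have := rate_tau_below hc hf lob (esym tE) => /lt_trans h /h; rewrite ltxx.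
Qed.

Lemma finite_of_lt (t u : \bar R) : (0 <= t)%E -> (t < u)%E -> t = (fine t)%:E.
Proof.
by move=> t0 tu; rewrite fineK// ge0_fin_numE// (lt_le_trans tu)// leey.
Qed.

(** While the level is in the window the queue coincides with it and stays
    below [x].  The offset [e] is the difference between the starting point of
    the queue and that of the level whose exit is observed. *)
Lemma exceeds_window T : exceeds c f (e + b) x T <->
  [/\ (ta < tb)%E, (ta < T%:E)%E &
     exceeds c (shift_path f (fine ta)) (e + hi) x (T - fine ta)] \/
  [/\ (tb < ta)%E, (tb < T%:E)%E &
     exceeds c (shift_path f (fine tb)) (e + lo) x (T - fine tb)].
Proof.
have ta0 : (0 <= ta)%E by exact: tau_above_ge0.
have tb0 : (0 <= tb)%E by exact: tau_below_ge0.
have [lt|lt|eq] := ltgtP ta tb.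
- have E := finite_of_lt ta0 lt; have t00 : 0 <= fine ta by rewrite fine_ge0.
  have L := level_tau_above hf bhi E.
  have W : exceeds c f (e + b) x T <-> fine ta < T /\
      exceeds c (shift_path f (fine ta)) (e + hi) x (T - fine ta).
    by apply: window_restart => //; rewrite -E// ltW.
  rewrite W; split=> [[h1 h2]|[[_ h1 h2]|[//]]].
    by left; split => //; rewrite E lte_fin.
  by split => //; rewrite -lte_fin -E.
- have E := finite_of_lt tb0 lt; have t00 : 0 <= fine tb by rewrite fine_ge0.
  have L := level_tau_below hf lob E.
  have W : exceeds c f (e + b) x T <-> fine tb < T /\
      exceeds c (shift_path f (fine tb)) (e + lo) x (T - fine tb).
    by apply: window_restart => //; rewrite -E// ltW.
  rewrite W; split=> [[h1 h2]|[[//]|[_ h1 h2]]].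
    by right; split => //; rewrite E lte_fin.
  by split => //; rewrite -lte_fin -E.
- have tay := window_tie eq; split=> [|[[]|[]]//].
  move=> h; exfalso; apply: (@quiet_not_exceeds R m c f (e + b) x T T) h => //.
  by apply: window_quiet; rewrite -?eq tay leey.
Qed.

End Window.

(** The window from [a] to [x], in coordinates where [a] is the origin.  At the
    upper exit the queue is at [x] and the rate is positive, so [x] is exceeded
    immediately. *)
Lemma exceeds_up f a x T : right_const f -> 0 <= a -> a <= x ->
  let ta := tau_above c f 0 (x - a) in let tb := tau_below c f 0 0 in
  exceeds c f a x T <->
  ((ta < tb)%E /\ (ta < T%:E)%E) \/
  [/\ (tb < ta)%E, (tb < T%:E)%E &
     exceeds c (shift_path f (fine tb)) a x (T - fine tb)].
Proof.
move=> hf a0 ax ta tb.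
have W := @exceeds_window f hf 0 0 (x - a) a x (lexx 0) _ _ _ T.
rewrite addr0 subrKC in W.
have xa : 0 <= x - a by rewrite subr_ge0.
rewrite W//.
split=> [[[h1 h2 _]|[h1 h2 h3]]|[[h1 h2]|[h1 h2 h3]]]; [by left|by right| |by right].
left; split => //.
have E := finite_of_lt (tau_above_ge0 c f 0 (x - a)) h1.
apply: exceeds_from_top.
- by apply: right_const_shift => //; rewrite fine_ge0// tau_above_ge0.
- by rewrite /shift_path addr0; apply: (rate_tau_above hc hf xa E).
- by rewrite subr_gt0 -lte_fin -E.
Qed.

Lemma exceeds_down f a x T : right_const f -> 0 <= a -> a <= x ->
  let ta := tau_above c f a a in let tb := tau_below c f a 0 in
  exceeds c f a x T <->
  [/\ (ta < tb)%E, (ta < T%:E)%E &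
     exceeds c (shift_path f (fine ta)) a x (T - fine ta)] \/
  [/\ (tb < ta)%E, (tb < T%:E)%E &
     exceeds c (shift_path f (fine tb)) 0 x (T - fine tb)].
Proof.
move=> hf a0 ax ta tb.
have W := @exceeds_window f hf a 0 a 0 x a0 (lexx a) _ _ T.
by rewrite !add0r in W; apply: W.
Qed.

(** Up to the first visit to S_+ the queue stays empty while the level may go
    down a long way; the restart has to be made from the queue content. *)
Lemma exceeds_boundary f x T : right_const f -> 0 <= x ->
  let t := beta c f in
  exceeds c f 0 x T <->
  (t < T%:E)%E /\ exceeds c (shift_path f (fine t)) 0 x (T - fine t).
Proof.
move=> hf x0 t; have t0 : (0 <= t)%E by exact: beta_ge0.
have Q t1 : (t1%:E <= t)%E -> quiet c f 0 x t1.
  move=> t1t v v0 vt1 [|[u [/andP[u0 uv]]]].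
    have := @level_before_beta _ _ c f hf 0 0 v (lexx 0) (ltW v0).
    by rewrite level0 => /(_ (le_trans _ t1t)); rewrite lee_fin vt1 => /(_ isT); lra.
  have := @level_before_beta _ _ c f hf 0 u v u0 uv.
  by move=> /(_ (le_trans _ t1t)); rewrite lee_fin vt1 => /(_ isT); lra.
case E : t t0 Q => [t1| |//] t10 Q; last first.
  split=> [h|[]//]; exfalso.
  by apply: (@quiet_not_exceeds R m c f 0 x T T) h => //; apply: Q; rewrite leey.
rewrite lee_fin in t10; rewrite lte_fin /=.
have D u : 0 <= u <= t1 -> level c f 0 t1 <= level c f 0 u.
  by move=> /andP[u0 ut]; apply: level_before_beta => //; rewrite -/t E.
apply: exceeds_restart => //; first exact: Q.
- by have := D 0; rewrite lexx t10 level0 => /(_ isT).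
- by move=> u /D; lra.
- by right; exists t1; rewrite t10 lexx subrr.
Qed.

End Decomposition.

(** * Measurability of passage events *)

Section Windows.
Context {R : realType} {m : nat}.
Implicit Types (c : 'I_m -> R) (f g : R -> 'I_m) (a b y lo hi r s t : R).

(** Exit from the window through the top before time [r], in a form in which
    only the path before [r] appears. *)
Definition climbs_out c f b lo hi r := exists t, [/\ 0 < t, t < r,
  hi < level c f b t & forall s, 0 < s -> s < t -> lo <= level c f b s].

Lemma climbs_outP c f b lo hi r : right_const f ->
  ((tau_above c f b hi < tau_below c f b lo)%E /\
   (tau_above c f b hi < r%:E)%E) <-> climbs_out c f b lo hi r.
Proof.
move=> hf; split; last first.
  move=> [t [t0 tr ht hs]].
  have at_ : (tau_above c f b hi < t%:E)%E.
    have [u [u0 ut hu]] := level_above_left hf (lexx 0) t0 ht.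
    by apply/tau_above_ltP; exists u.
  split; last by apply: lt_trans at_ _; rewrite lte_fin.
  apply: (lt_le_trans at_); apply: le_ereal_inf_tmp => _ [u [u0 lu] <-].
  rewrite lee_fin leNgt; apply/negP => ut.
  by have := hs u u0 ut; rewrite leNgt lu.
move=> [ab ar].
have : (tau_above c f b hi < Order.min r%:E (tau_below c f b lo))%E.
  by rewrite lt_min ar ab.
move=> /ereal_inf_lt[_ [t [t0 ht] <-]]; rewrite lt_min lte_fin => /andP[tr tb].
exists t; split => // s s0 st; rewrite leNgt; apply/negP => ls.
have : (tau_below c f b lo <= s%:E)%E by apply: ereal_inf_lbound; exists s.
by rewrite leNgt (lt_trans _ tb)// lte_fin.
Qed.

Lemma falls_outP c f b lo hi r : right_const f ->
  ((tau_below c f b lo < tau_above c f b hi)%E /\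
   (tau_below c f b lo < r%:E)%E) <->
  climbs_out (fun i => - c i) f (- b) (- hi) (- lo) r.
Proof.
move=> hf; rewrite (tau_below_opp c b lo hf) (tau_above_opp c b hi hf).
exact: climbs_outP.
Qed.

Lemma climbs_out_congr c f g b lo hi r : (forall s, 0 <= s <= r -> f s = g s) ->
  climbs_out c f b lo hi r -> climbs_out c g b lo hi r.
Proof.
move=> fg [t [t0 tr ht hs]].
have L u : u <= t -> level c f b u = level c g b u.
  move=> ut; apply: level_congr => s /andP[s0 su]; apply: fg.
  by rewrite s0 (le_trans su)// (le_trans ut)// ltW.
by exists t; split; rewrite -?L// => s s0 st; rewrite -L ?hs// ltW.
Qed.

Lemma climbs_out_rat c f b lo hi r : right_const f ->
  climbs_out c f b lo hi r <->
  exists q : rat, [/\ 0 < ratr q :> R, ratr q < r, hi < level c f b (ratr q) &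
    forall p : rat, 0 < ratr p :> R -> ratr p < ratr q :> R ->
      lo <= level c f b (ratr p)].
Proof.
move=> hf; split.
  move=> [t [t0 tr ht hs]].
  have [l [l0 lt hl]] := level_above_left_itv hf (lexx 0) t0 ht.
  have [q] := rat_in_itvoo lt; rewrite in_itv/= => /andP[lq qt].
  exists q; split; [exact: le_lt_trans lq|exact: lt_trans tr|exact: hl|].
  by move=> p p0 pq; apply: hs => //; exact: lt_trans qt.
move=> [q [q0 qr hq hp]]; exists (ratr q); split => // s s0 sq.
rewrite leNgt; apply/negP => ls.
have [l [l0 ls' hl]] := level_below_left_itv hf (lexx 0) s0 ls.
have [p] := rat_in_itvoo ls'; rewrite in_itv/= => /andP[lp ps].
have := hp p (le_lt_trans l0 lp) (lt_trans ps sq).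
by rewrite leNgt hl.
Qed.

Lemma beta_rat c f r : right_const f ->
  (beta c f < r%:E)%E <->
  exists q : rat, [/\ 0 < ratr q :> R, ratr q < r & f (ratr q) \in Sp c].
Proof.
move=> hf; split=> [/beta_ltP[t [t0 tr ft]]|[q [q0 qr fq]]]; last first.
  by apply/beta_ltP; exists (ratr q).
have [e e0 he] := (near_rightP _ _).1 (hf t (ltW t0)).
have te : t < Num.min r (t + e) by rewrite lt_min tr ltrDl.
have [q] := rat_in_itvoo te; rewrite in_itv/= lt_min => /and3P[tq qr qe].
by exists q; split => //; [exact: lt_trans tq|rewrite he].
Qed.

Lemma exceeds_rat c f a x T : right_const f -> 0 <= a -> a <= x ->
  exceeds c f a x T <->
  exists q : rat, [/\ 0 < ratr q :> R, ratr q < T &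
    x < level c f a (ratr q) \/
    exists p : rat, [/\ 0 < ratr p :> R, ratr p < ratr q :> R &
       x < level c f a (ratr q) - level c f a (ratr p)]].
Proof.
move=> hf a0 ax; have x0 : 0 <= x by exact: le_trans ax.
split; last first.
  move=> [q [q0 qT h]]; exists (ratr q); split => //.
  case: h => [|[p [p0 pq xp]]]; first by left.
  by right; exists (ratr p); rewrite !ltW.
move=> [v [v0 vT [xv|[u [/andP[u0 uv] xu]]]]].
  have [l [l0 lv hl]] := level_above_left_itv hf (lexx 0) v0 xv.
  have [q] := rat_in_itvoo lv; rewrite in_itv/= => /andP[lq qv].
  exists q; split; [exact: le_lt_trans lq|exact: lt_trans vT|left].
  exact: hl.
have {}uv : u < v.
  by rewrite lt_neqAle uv andbT; apply: contraTneq xu => ->; rewrite subrr -leNgt.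
have [|l [l0 lv hl]] := @level_above_left_itv R m c f a (x + level c f a u) u v hf u0 uv.
  by lra.
have [q] := rat_in_itvoo lv; rewrite in_itv/= => /andP[lq qv].
have uq : u < ratr q by exact: le_lt_trans lq.
have q0 : 0 < ratr q :> R by exact: le_lt_trans uq.
exists q; split; [by []|exact: lt_trans vT|].
have xq := hl _ lq qv.
move: u0; rewrite le_eqVlt => /predU1P[u0|u0].
  by left; move: xq; rewrite -u0 level0; lra.
right.
have [|l' [l'0 l'u hl']] := @level_below_left_itv R m c f a (level c f a (ratr q) - x)
  0 u hf (lexx 0) u0.
  by lra.
have [p] := rat_in_itvoo l'u; rewrite in_itv/= => /andP[lp pu].
exists p; split; [exact: le_lt_trans lp|exact: lt_trans uq|].
by have := hl' _ lp pu; lra.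
Qed.

End Windows.

Section Measurability.
Context {R : realType} {m : nat} {d} {T : measurableType d}.
Variables (c : 'I_m -> R) (psi : R -> T -> 'I_m).
Hypothesis mpsi : forall (t : R) j, 0 <= t -> measurable [set w | psi t w = j].
Hypothesis rpsi : forall w, right_const (psi ^~ w).

(** Measurability of a parameter-dependent integral, from Tonelli's theorem;
    the rate bound is added to make the integrand nonnegative. *)
Lemma measurable_level (b t : R) : 0 <= t ->
  measurable_fun setT (fun w => level c (psi ^~ w) b t).
Proof.
move=> t0; pose K := rate_bound c.
pose h (p : T * measurableTypeR R) := (c (psi (Num.max 0 p.2) p.1) + K) * \1_(`[0,
  t]%classic : set R) p.2.
have h0 p : 0 <= h p.
  rewrite mulr_ge0// -lerBlDr sub0r.
  by have := rate_le c (psi (Num.max 0 p.2) p.1); rewrite ler_norml => /andP[].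
have mh : measurable_fun setT (EFin \o h).
  apply/measurable_EFinP; apply: measurable_funM.
    by apply: measurable_funD; [exact: (measurable_rate c mpsi rpsi)|exact: measurable_cst].
  by apply: measurableT_comp => //; exact: measurable_indic.
have mF := @measurable_fun_fubini_tonelli_F _ _ T (measurableTypeR R) R lebesgue_measure _ mh
  (fun p => h0 p).
have fin0t : (lebesgue_measure (`[0%R, t]%classic : set R) < +oo)%E.
  by rewrite lebesgue_measure_itv/=; case: ifP => // _; rewrite ltry.
have -> : (fun w => level c (psi ^~ w) b t) =
  (fun w => b + (fine (fubini_F lebesgue_measure (EFin \o h) w) - K * t)).
  apply/funext => w; rewrite level_max; congr (_ + _); rewrite /fubini_F.
  have ir := @integrable_path_rate R m c _ (rpsi w) _ (measurable_itv _) fin0t.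
  have iK : lebesgue_measure.-integrable `[0, t] (EFin \o (fun=> K : R)).
    apply: measurable_bounded_integrable => //.
    by exists `|K|; split; [exact: num_real|move=> N hN r _ /=; exact: ltW].
  have -> : (\int[lebesgue_measure]_y (EFin \o h) (w, y) =
     \int[lebesgue_measure]_(y in `[0%R, t]) (c (psi (Num.max 0 y) w) + K)%:E)%E.
    rewrite [RHS]integral_mkcond; apply: eq_integral => y _ /=.
    rewrite patchE /h/= indicE; case: ifP => _; first by rewrite mulr1.
    by rewrite mulr0.
  have mI : measurable (`[0%R, t]%classic : set (measurableTypeR R)) by exact: measurable_itv.
  have := RintegralD mI ir iK; rewrite {1}/Rintegral => ->.
  rewrite Rintegral_cst//.
  have -> : fine (lebesgue_measure (`[0%R, t]%classic : set (measurableTypeR R))) = t.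
    rewrite lebesgue_measure_itv/= lte_fin.
    by move: t0; rewrite le_eqVlt => /predU1P[<-|->]; rewrite ?ltxx//= subr0.
  by rewrite addrK.
apply: measurable_funD; first exact: measurable_cst.
apply: measurable_funD; last exact: measurable_cst.
by apply: measurableT_comp => //; exact: fine_measurable.
Qed.

Lemma measurable_fun_gt d' (U : measurableType d') (V : U -> R) r :
  measurable_fun setT V -> measurable [set w | r < V w].
Proof.
move=> mV; rewrite -[X in measurable X]setTI.
rewrite (_ : [set w | _] = V @^-1` `]r, +oo[).
  by apply: mV => //; exact: measurable_itv.
by apply/seteqP; split => w /=; rewrite in_itv/= andbT.
Qed.

Lemma measurable_level_gt b y t : 0 <= t ->
  measurable [set w | y < level c (psi ^~ w) b t].
Proof.
by move=> t0; apply: measurable_fun_gt; exact: measurable_level.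
Qed.

Lemma measurable_level_ge b y t : 0 <= t ->
  measurable [set w | y <= level c (psi ^~ w) b t].
Proof.
move=> t0; rewrite -[X in measurable X]setTI.
rewrite (_ : [set w | _] = (fun w => level c (psi ^~ w) b t) @^-1` `[y, +oo[).
  by apply: measurable_level => //; exact: measurable_itv.
by apply/seteqP; split => w /=; rewrite in_itv/= andbT.
Qed.

Lemma measurable_exists_rat d' (U : measurableType d') (W : rat -> set U) :
  (forall q, measurable (W q)) -> measurable [set w | exists q, W q w].
Proof.
move=> mW; have := bigcupT_measurable_rat mW; congr measurable.
by apply/seteqP; split => w /= [q]; [move=> _ ?; exists q|move=> ?; exists q].
Qed.

Lemma measurable_forall_rat d' (U : measurableType d') (W : rat -> set U) :
  (forall q, measurable (W q)) -> measurable [set w | forall q, W q w].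
Proof.
move=> mW; have := measurableC (bigcupT_measurable_rat (fun q => measurableC (mW q))).
rewrite setC_bigcup; congr measurable.
apply/seteqP; split => w /= h q; last by rewrite setCK.
by have := h q I; rewrite setCK.
Qed.

Lemma measurable_conj d' (U : measurableType d') (V W : set U) :
  measurable V -> measurable W -> measurable [set w | V w /\ W w].
Proof. exact: measurableI. Qed.

Lemma measurable_disj d' (U : measurableType d') (V W : set U) :
  measurable V -> measurable W -> measurable [set w | V w \/ W w].
Proof. exact: measurableU. Qed.

Lemma measurable_imply d' (U : measurableType d') (Q : Prop) (W : set U) :
  (Q -> measurable W) -> measurable [set w | Q -> W w].
Proof.
move=> mW; have [q|q] := pselect Q.
  by have := mW q; congr measurable; apply/seteqP; split => w /= => [|/(_ q)].
by rewrite (_ : [set _ | _] = setT)//; apply/seteqP; split => // w _ /=.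
Qed.

Lemma measurable_if d' (U : measurableType d') (Q : Prop) (W : set U) :
  (Q -> measurable W) -> measurable [set w | Q /\ W w].
Proof.
move=> mW; have [q|q] := pselect Q.
  by have := mW q; congr measurable; apply/seteqP; split => w //= [].
by rewrite (_ : [set _ | _] = set0)//; apply/seteqP; split => // w [].
Qed.

Lemma measurable_climbs_out b lo hi r :
  measurable [set w | climbs_out c (psi ^~ w) b lo hi r].
Proof.
rewrite (_ : [set w | _] = [set w | exists q : rat, (0 < ratr q :> R /\ ratr q < r) /\
    (hi < level c (psi ^~ w) b (ratr q) /\
    forall p : rat, (0 < ratr p :> R /\ ratr p < ratr q :> R) ->
      lo <= level c (psi ^~ w) b (ratr p))]).
  apply: measurable_exists_rat => q; apply: measurable_if => -[q0 qr].
  apply: measurable_conj; first by apply: measurable_level_gt; exact: ltW.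
  apply: measurable_forall_rat => p; apply: measurable_imply => -[p0 pq].
  by apply: measurable_level_ge; exact: ltW.
apply/seteqP; split => w /=.
  move=> /(climbs_out_rat c b lo hi r (rpsi w))[q [q0 qr hq h]].
  by exists q; do 2 split => //; move=> p []; exact: h.
move=> [q [[q0 qr] [hq h]]]; apply/(climbs_out_rat c b lo hi r (rpsi w)).
by exists q; split => // p p0 pq; exact: h.
Qed.

Lemma measurable_beta r : measurable [set w | (beta c (psi ^~ w) < r%:E)%E].
Proof.
rewrite (_ : [set w | _] = [set w | exists q : rat, (0 < ratr q :> R /\ ratr q < r) /\
    psi (ratr q) w \in Sp c]).
  apply: measurable_exists_rat => q; apply: measurable_if => -[q0 qr].
  have : measurable (\bigcup_(j in [set j | j \in Sp c]) [set w | psi (ratr q) w = j]).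
    apply: fin_bigcup_measurable; first exact: finite_finset.
    by move=> j _; apply: mpsi; exact: ltW.
  congr measurable; apply/seteqP; split => w /= [];  last by exists (psi (ratr q) w).
  by move=> j jp e; rewrite e.
apply/seteqP; split => w /=.
  by move=> /(beta_rat c r (rpsi w))[q [q0 qr h]]; exists q.
by move=> [q [[q0 qr] h]]; apply/(beta_rat c r (rpsi w)); exists q.
Qed.

Lemma measurable_exceeds (a x : R) (V : T -> R) : 0 <= a -> a <= x ->
  measurable_fun setT V ->
  measurable [set w | exceeds c (psi ^~ w) a x (V w)].
Proof.
move=> a0 ax mV.
rewrite (_ : [set w | _] = [set w | exists q : rat, 0 < ratr q :> R /\
    (ratr q < V w /\ (x < level c (psi ^~ w) a (ratr q) \/
    exists p : rat, (0 < ratr p :> R /\ ratr p < ratr q :> R) /\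
       x < level c (psi ^~ w) a (ratr q) - level c (psi ^~ w) a (ratr p)))]).
  apply: measurable_exists_rat => q; apply: measurable_if => q0.
  apply: measurable_conj.
    exact: measurable_fun_gt.
  apply: measurable_disj; first by apply: measurable_level_gt; exact: ltW.
  apply: measurable_exists_rat => p; apply: measurable_if => -[p0 pq].
  pose D w := level c (psi ^~ w) a (ratr q) - level c (psi ^~ w) a (ratr p).
  apply: (@measurable_fun_gt _ _ D).
  by apply: measurable_funB; apply: measurable_level; exact: ltW.
apply/seteqP; split => w /=.
  move=> /(exceeds_rat c _ (rpsi w) a0 ax)[q [q0 qV h]].
  exists q; do 2 split => //.
  by case: h => [|[p [p0 pq h]]]; [left|right; exists p].
move=> [q [q0 [qV h]]]; apply/(exceeds_rat c _ (rpsi w) a0 ax); exists q; split => //.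
by case: h => [|[p [[p0 pq] h]]]; [left|right; exists p].
Qed.

End Measurability.

(** * Equality of laws and conditioning on an independent variable *)

Section PiLambda.
Context {R : realType} {d1 d2 : measure_display}.
Context {T1 : measurableType d1} {T2 : measurableType d2}.

(** Dynkin's pi-lambda theorem for two laws restricted to the events [W1] and
    [W2] and compared up to a factor.  In this form it extends from cylinders
    to all events each of the independence and Markov properties below;
    measurability of the preimages is proved along the way. *)
Lemma law_eq_pi_system (X : Type) (mu : probability T1 R) (nu : probability T2 R)
    (W1 : set T1) (W2 : set T2) (f : T1 -> X) (g : T2 -> X) (k : R)
    (G : set (set X)) :
  measurable W1 -> measurable W2 -> setI_closed G ->
  (forall C, (G C \/ C = setT) ->
     [/\ measurable (W1 `&` f @^-1` C), measurable (W2 `&` g @^-1` C) &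
       mu (W1 `&` f @^-1` C) = (k%:E * nu (W2 `&` g @^-1` C))%E]) ->
  forall C, <<s G >> C ->
     [/\ measurable (W1 `&` f @^-1` C), measurable (W2 `&` g @^-1` C) &
       mu (W1 `&` f @^-1` C) = (k%:E * nu (W2 `&` g @^-1` C))%E].
Proof.
move=> mW1 mW2 GI GE.
apply: (lambda_system_subset GI) => //; last by move=> C GC; apply: GE; left.
split => //; first by apply: GE; right.
- move=> A B BA [mA1 mA2 EA] [mB1 mB2 EB].
  have D1 : W1 `&` f @^-1` (A `\` B) = (W1 `&` f @^-1` A) `\` (W1 `&` f @^-1` B).
    apply/seteqP; split => w /=; first by move=> [W [Aw Bw]]; split => // -[].
    by move=> [[W Aw] h]; split => //; split => // Bw; apply: h.
  have D2 : W2 `&` g @^-1` (A `\` B) = (W2 `&` g @^-1` A) `\` (W2 `&` g @^-1` B).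
    apply/seteqP; split => w /=; first by move=> [W [Aw Bw]]; split => // -[].
    by move=> [[W Aw] h]; split => //; split => // Bw; apply: h.
  have I1 : W1 `&` f @^-1` A `&` (W1 `&` f @^-1` B) = W1 `&` f @^-1` B.
    by apply: setIidr => w [W Bw]; split => //; exact: BA.
  have I2 : W2 `&` g @^-1` A `&` (W2 `&` g @^-1` B) = W2 `&` g @^-1` B.
    by apply: setIidr => w [W Bw]; split => //; exact: BA.
  split; [by rewrite D1; exact: measurableD|by rewrite D2; exact: measurableD|].
  rewrite D1 D2 !measureD//; last 2 first.
    by rewrite (le_lt_trans (probability_le1 _ mA2))// ltry.
    by rewrite (le_lt_trans (probability_le1 _ mA1))// ltry.
  rewrite I1 I2.
  transitivity (k%:E * nu (W2 `&` g @^-1` A) - k%:E * nu (W2 `&` g @^-1` B))%E.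
    by congr (_ - _)%E.
  rewrite muleBr//; apply: fin_num_adde_defl.
  by rewrite fin_numN; exact: fin_num_measure.
- move=> F ndF HF.
  have U1 : W1 `&` f @^-1` (\bigcup_i F i) = \bigcup_i (W1 `&` f @^-1` F i).
    by rewrite preimage_bigcup setI_bigcupr.
  have U2 : W2 `&` g @^-1` (\bigcup_i F i) = \bigcup_i (W2 `&` g @^-1` F i).
    by rewrite preimage_bigcup setI_bigcupr.
  have m1 i : measurable (W1 `&` f @^-1` F i) by have [] := HF i.
  have m2 i : measurable (W2 `&` g @^-1` F i) by have [] := HF i.
  split; [by rewrite U1; exact: bigcupT_measurable|by rewrite U2; exact: bigcupT_measurable|].
  rewrite U1 U2.
  have c1 := @nondecreasing_cvg_mu _ _ _ mu _ m1 (bigcupT_measurable _ m1).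
  have c2 := @nondecreasing_cvg_mu _ _ _ nu _ m2 (bigcupT_measurable _ m2).
  have {}c1 := c1 _; have {}c2 := c2 _.
  have nd1 : nondecreasing_seq (fun i => W1 `&` f @^-1` F i).
    move=> i j /ndF ij; apply/subsetPset => w [Ww Fw]; split => //.
    by move/subsetPset : ij; apply.
  have nd2 : nondecreasing_seq (fun i => W2 `&` g @^-1` F i).
    move=> i j /ndF ij; apply/subsetPset => w [Ww Fw]; split => //.
    by move/subsetPset : ij; apply.
  have {}c1 := c1 nd1; have {}c2 := cvgeZl (isT : k%:E \is a fin_num) (c2 nd2).
  apply: (cvg_unique _ c1) => //.
  apply: cvg_trans c2; apply: near_eq_cvg; near=> i => /=.
  by have [_ _ ->] := HF i.
Unshelve. all: by end_near.
Qed.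

End PiLambda.

Section Freezing.
Context {R : realType} {d d1 d2 : measure_display} {T : measurableType d}.
Context {T1 : measurableType d1} {T2 : measurableType d2}.
Variables (P : probability T R) (X : {mfun T >-> T1}) (V : {mfun T >-> T2}).

Lemma measurable_frozen (D : set (T1 * T2)) : measurable D ->
  measurable_fun setT (fun x => P [set w | D (x, V w)]).
Proof.
move=> mD; have := measurable_fun_xsection (distribution P V) mD.
rewrite (_ : _ \o _ = (fun x => P [set w | D (x, V w)]))//.
apply/funext => x; rewrite /= /distribution /pushforward; congr (P _).
by apply/seteqP; split => w /=; rewrite /xsection/= inE.
Qed.

(** By independence the joint law is a product, and a product measure
    integrates the measures of the sections. *)
Lemma freezing : (forall A B, measurable A -> measurable B ->
    P (X @^-1` A `&` V @^-1` B) = (P (X @^-1` A) * P (V @^-1` B))%E) ->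
  forall D : set (T1 * T2), measurable D ->
  P [set w | D (X w, V w)] =
  (\int[distribution P X]_x P [set w | D (x, V w)])%E.
Proof.
move=> ind D mD.
have mXV : measurable_fun setT (fun w => (X w, V w)).
  by apply: measurable_fun_pair; exact: measurable_funP.
pose XV : {mfun T >-> (T1 * T2)%type} := HB.pack (fun w => (X w, V w))
  (isMeasurableFun.Build _ _ _ _ _ mXV).
have h : (distribution P X \x distribution P V)%E D = distribution P XV D.
  by apply: product_measure_unique => // A B mA mB; exact: ind.
rewrite [LHS](_ : _ = distribution P XV D)// -h.
rewrite /= /product_measure1 /=; apply: eq_integral => x _ /=.
rewrite /distribution /pushforward /=; congr (P _).
by apply/seteqP; split => w /=; rewrite /xsection/= inE.
Qed.

End Freezing.

(** * Exponential variables and Erlang clocks *)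

Section Tail.
Context {R : realType}.
Variables (nu : R) (hnu : 0 < nu).

Lemma exponential_prob_le0 z : z <= 0 -> exponential_prob nu `]-oo, z] = 0%E.
Proof.
move=> z0; rewrite /exponential_prob.
rewrite -integral_itv_bndo_bndc.
  apply: integral0_eq => x /=; rewrite in_itv/= => xz.
  by rewrite lt0_exponential_pdf// (lt_le_trans xz).
by apply/measurable_EFinP; apply: measurable_funTS; exact: measurable_exponential_pdf.
Qed.

Lemma exponential_prob_ge0 z : 0 <= z ->
  exponential_prob nu `]-oo, z] = (1 - expR (- nu * z))%:E.
Proof.
rewrite le_eqVlt => /predU1P[<-|z0].
  by rewrite exponential_prob_le0// mulr0 expR0 subrr.
have mE (A : set (measurableTypeR R)) : measurable_fun A (fun x => (exponential_pdf nu x)%:E).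
  by apply/measurable_EFinP; apply: measurable_funTS; exact: measurable_exponential_pdf.
have U : (`]-oo, z]%classic : set R) = `]-oo, 0[ `|` `[0, z].
  by apply/seteqP; split => x /=; rewrite !in_itv/=; [case: ltP => //;
    [left|right]|case=> [|/andP[]//]; move=> /ltW /le_trans; apply; exact: ltW].
have := exponential_prob_itv0c nu z0; rewrite /exponential_prob U => h.
rewrite ge0_integral_setU//=.
- rewrite h integral0_eq ?add0e ?EFinB// => x /=; rewrite in_itv/= => x0.
  by rewrite lt0_exponential_pdf.
- by move=> x _; rewrite lee_fin exponential_pdf_ge0// ltW.
- apply/disj_setPS => x [/=]; rewrite !in_itv/= => x0 /andP[x1 _].
  by have := lt_le_trans x0 x1; rewrite ltxx.
Qed.

Context {d : measure_display} {T : measurableType d}.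

Lemma measurable_rv (X : {mfun T >-> R}) (B : set R) : measurable B ->
  measurable (X @^-1` B).
Proof. by move=> mB; rewrite -[X in measurable X]setTI; exact: measurable_funP. Qed.

Lemma exponential_tail (P : probability T R) (X : {mfun T >-> R}) :
  (forall B : set R, measurable B -> distribution P X B = exponential_prob nu B) ->
  forall z, P [set w | z < X w] = if z <= 0 then 1%E else (expR (- nu * z))%:E.
Proof.
move=> hX z.
pose I : set R := `]-oo, z]%classic.
have mI : measurable I by exact: measurable_itv.
have mz : measurable (X @^-1` I) by exact: measurable_rv.
rewrite (_ : [set w | z < X w] = ~` (X @^-1` I)); last first.
  by apply/seteqP; split => w /=; rewrite /I/= in_itv/=;
    [rewrite ltNge => /negP|move=> /negP; rewrite -ltNge].
rewrite probability_setC// -[P (X @^-1` _)]/(distribution P X I) hX//.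
case: ifPn => [z0|]; first by rewrite exponential_prob_le0// sube0.
rewrite -ltNge => z0; rewrite exponential_prob_ge0 ?ltW//.
by rewrite -EFinB opprB addrC subrK.
Qed.

(** Here [z] may be negative: it stands for the part of a waiting time that the
    other terms of an Erlang variable leave to [X]. *)
Lemma exponential_memoryless (P : probability T R) (X : {mfun T >-> R}) :
  (forall B : set R, measurable B -> distribution P X B = exponential_prob nu B) ->
  forall t z : R, 0 <= t ->
  P [set w | t < X w /\ t + z < X w] =
  (P [set w | (t < X w)%R] * P [set w | (z < X w)%R])%E.
Proof.
move=> hX t z t0.
have E s : 0 <= s -> P [set w | s < X w] = (expR (- nu * s))%:E.
  move=> s0; rewrite (exponential_tail hX); case: ifPn => // s1.
  have -> : s = 0 by apply/le_anti; rewrite s1 s0.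
  by rewrite mulr0 expR0.
have [z0|z0] := leP z 0.
  have -> : [set w | t < X w /\ t + z < X w] = [set w | t < X w].
    by apply/seteqP; split => w /= => [[]//|tX]; split => //; apply: le_lt_trans tX; lra.
  by rewrite [P [set w | z < X w]](exponential_tail hX) z0 mule1.
have -> : [set w | t < X w /\ t + z < X w] = [set w | t + z < X w].
  by apply/seteqP; split => w /= => [[]//|tX]; split => //; apply: lt_trans tX; lra.
by rewrite !E ?addr_ge0// ?ltW// -EFinM -expRD mulrDr.
Qed.

End Tail.

Section Clock.
Context {R : realType}.
Variables (nu : R) (hnu : 0 < nu).

Lemma erlang0 d (T : measurableType d) (Y : nat -> {mfun T >-> R}) w :
  erlang Y 0 w = 0.
Proof. by rewrite /erlang big_ord0. Qed.

Lemma erlangS d (T : measurableType d) (Y : nat -> {mfun T >-> R}) k w :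
  erlang Y k.+1 w = Y 0 w + erlang (fun n => Y n.+1) k w.
Proof. by rewrite /erlang big_ord_recl. Qed.

Lemma erlangSr d (T : measurableType d) (Y : nat -> {mfun T >-> R}) k w :
  erlang Y k.+1 w = erlang Y k w + Y k w.
Proof. by rewrite /erlang big_ord_recr. Qed.

Lemma measurable_erlang d (T : measurableType d) (Y : nat -> {mfun T >-> R}) k :
  measurable_fun setT (erlang Y k).
Proof.
elim: k => [|k IH].
  rewrite (_ : erlang Y 0 = cst 0); first exact: measurable_cst.
  by apply/funext => w; rewrite erlang0.
rewrite (_ : erlang Y k.+1 = erlang Y k \+ Y k).
  by apply: measurable_funD => //; exact: measurable_funP.
by apply/funext => w; rewrite erlangSr.
Qed.

Lemma iid_exponential_shift d (T : measurableType d) (P : probability T R)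
    (Y : nat -> {mfun T >-> R}) :
  iid_exponential P nu Y -> iid_exponential P nu (fun n => Y n.+1).
Proof.
move=> [hd hi]; split=> [n|s B us mB]; first exact: hd.
have := hi (map S s) (fun n => B n.-1); rewrite map_inj_uniq; last exact: succn_inj.
move=> /(_ us (fun n => mB n.-1)); rewrite big_map => <-; congr (P _).
apply/seteqP; split => w h n /=.
  by move=> /mapP[j js ->]; exact: h.
by move=> ns; apply: (h n.+1); rewrite /= mem_map//; exact: succn_inj.
Qed.

Definition seq_cylinders : set (set (nat -> R)) :=
  [set E | exists N (B : nat -> set R), (forall n, measurable (B n)) /\
     E = [set y | forall n, (n < N)%N -> B n (y n)]].

Lemma setI_closed_seq_cylinders : setI_closed seq_cylinders.
Proof.
move=> _ _ [N1 [B1 [m1 ->]]] [N2 [B2 [m2 ->]]].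
exists (maxn N1 N2), (fun n => (if (n < N1)%N then B1 n else setT) `&`
  (if (n < N2)%N then B2 n else setT)); split.
  by move=> n; apply: measurableI; case: ifP.
apply/seteqP; split => y /=.
  move=> [h1 h2] n _; split; case: ifPn => //; [exact: h1|exact: h2].
by move=> h; split => n nN; have := h n; rewrite leq_max nN ?orbT => /(_ isT) [].
Qed.

(** Extends the product rule for finitely many variables to the whole future of
    the sequence. *)
Lemma first_independent d (T : measurableType d) (P : probability T R)
    (Y : nat -> {mfun T >-> R}) (B : set R) : iid_exponential P nu Y ->
  measurable B -> forall C, <<s seq_cylinders >> C ->
  P (Y 0 @^-1` B `&` (fun w n => Y n.+1 w) @^-1` C) =
  (P (Y 0%N @^-1` B) * P ((fun w n => Y n.+1 w) @^-1` C))%E.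
Proof.
move=> [hd hi] mB C sC.
have mYB := measurable_rv (Y 0) mB.
have fB : (fine (P (Y 0 @^-1` B)))%:E = P (Y 0 @^-1` B).
  by rewrite fineK// fin_num_measure.
have [] // := @law_eq_pi_system R d d T T (nat -> R) P P (Y 0 @^-1` B) setT
  (fun w n => Y n.+1 w) (fun w n => Y n.+1 w) (fine (P (Y 0 @^-1` B))) _ mYB
  measurableT setI_closed_seq_cylinders _ C sC; last first.
  by move=> _ _; rewrite setTI fB.
move=> _ [[N [D [mD ->]]]|->]; last first.
  by rewrite preimage_setT !setIT probability_setT mule1 fB.
have E : (fun w n => Y n.+1 w) @^-1` [set y | forall n, (n < N)%N -> D n (y n)] =
   \bigcap_(n in [set` map S (iota 0 N)]) (Y n @^-1` D n.-1).
  apply/seteqP; split => w /= h n /=.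
    by move=> /mapP[j]; rewrite mem_iota add0n => /= jN ->; exact: h.
  by move=> nN; apply: (h n.+1); apply/mapP; exists n; rewrite // mem_iota.
have us : uniq (map S (iota 0 N)) by rewrite map_inj_uniq ?iota_uniq//; exact: succn_inj.
have mE : measurable (\bigcap_(n in [set` map S (iota 0 N)]) (Y n @^-1` D n.-1)).
  by apply: bigcap_measurableType => n _; exact: measurable_rv.
rewrite E; split => //; first exact: measurableI.
  by rewrite setTI.
rewrite setTI fB.
pose D' n := if n is n'.+1 then D n' else B.
have mD' n : measurable (D' n) by case: n => /=.
have us0 : uniq (0%N :: map S (iota 0 N)).
  by rewrite cons_uniq us andbT; apply/mapP => -[].
have := hi _ D' us0 mD'; rewrite big_cons.
have -> : \bigcap_(n in [set` (0%N :: map S (iota 0 N))]) (Y n @^-1` D' n) =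
    Y 0%N @^-1` B `&` \bigcap_(n in [set` map S (iota 0 N)]) (Y n @^-1` D n.-1).
  apply/seteqP; split => w /=.
    move=> h; split; first by apply: (h 0%N); rewrite /= inE.
    move=> n nN; have := h n; rewrite /= inE nN orbT => /(_ isT).
    by move: nN => /= /mapP[j _ ->].
  move=> [hB h] n /=; rewrite inE => /predU1P[->//|nN].
  by have := h n nN; move: nN => /= /mapP[j _ ->].
move=> ->; congr (_ * _)%E.
rewrite (hi _ (fun n => D n.-1) us (fun n => mD n.-1)).
by rewrite !big_map.
Qed.

Definition seqT := g_sigma_algebraType seq_cylinders.

Lemma measurable_coord n : measurable_fun setT (fun y : seqT => y n).
Proof.
move=> _ B mB; rewrite setTI; apply: sub_sigma_algebra.
exists n.+1, (fun k => if k == n then B else setT); split.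
  by move=> k; case: ifP.
apply/seteqP; split => y /=; first by move=> By k _; case: eqP => [->|].
by move=> /(_ n (ltnSn n)); rewrite eqxx.
Qed.

Lemma measurable_sum_coord k : measurable_fun setT (fun y : seqT => \sum_(i < k) y i).
Proof.
by apply: measurable_sum => i; exact: measurable_coord.
Qed.

End Clock.

Section Erlang.
Context {R : realType}.
Variables (nu : R) (hnu : 0 < nu).

HB.instance Definition _ d (T : measurableType d) (Y : nat -> {mfun T >-> R}) k :=
  isMeasurableFun.Build _ _ _ _ (erlang Y k) (measurable_erlang Y k).

Definition tail_seq d (T : measurableType d) (Y : nat -> {mfun T >-> R}) (w : T)
  : @seqT R := fun n => Y n.+1 w.

Lemma measurable_tail_seq d (T : measurableType d) (Y : nat -> {mfun T >-> R}) :
  measurable_fun setT (tail_seq Y).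
Proof.
apply: (@measurability _ _ T (@seqT R) setT (tail_seq Y) (@seq_cylinders R)) => // _ [_
  [N [B [mB ->]]] <-].
rewrite setTI (_ : _ @^-1` _ = \bigcap_(n in `I_N) (Y n.+1 @^-1` B n)).
  by apply: bigcap_measurableType => n _; exact: measurable_rv.
by apply/seteqP; split.
Qed.

HB.instance Definition _ d (T : measurableType d) (Y : nat -> {mfun T >-> R}) :=
  isMeasurableFun.Build _ _ _ _ (tail_seq Y) (measurable_tail_seq Y).

(** An Erlang variable can be conditioned on its first term, as here, or on the
    sum of the other ones, as in [freeze_sum]. *)
Lemma freeze_first d (T : measurableType d) (P : probability T R)
    (Y : nat -> {mfun T >-> R}) d2 (T2 : measurableType d2)
    (v : @seqT R -> T2) (D : set (R * T2)) :
  iid_exponential P nu Y -> measurable_fun setT v -> measurable D ->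
  P [set w | D (Y 0%N w, v (tail_seq Y w))] =
  (\int[distribution P (Y 0%N)]_x P [set w | D (x, v (tail_seq Y w))])%E.
Proof.
move=> hY mv mD.
have mV : measurable_fun setT (v \o tail_seq Y).
  by apply: measurableT_comp => //; exact: measurable_tail_seq.
pose V : {mfun T >-> T2} := HB.pack (v \o tail_seq Y) (isMeasurableFun.Build _ _ _ _ _ mV).
have ind A B : measurable A -> measurable B -> P (Y 0%N @^-1` A `&` V @^-1` B) =
    (P (Y 0%N @^-1` A) * P (V @^-1` B))%E.
  move=> mA mB; apply: (first_independent hY mA (C := v @^-1` B)).
  by have := mv measurableT B mB; rewrite setTI.
exact: (freezing ind mD).
Qed.

Lemma freeze_sum d (T : measurableType d) (P : probability T R)
    (Y : nat -> {mfun T >-> R}) k (D : set (R * R)) :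
  iid_exponential P nu Y -> measurable D ->
  P [set w | D (erlang (fun n => Y n.+1) k w, Y 0%N w)] =
  (\int[distribution P (erlang (fun n => Y n.+1) k)]_x
     P [set w | D (x, Y 0%N w)])%E.
Proof.
move=> hY mD.
pose S : {mfun T >-> R} := erlang (fun n => Y n.+1) k.
have ind A B : measurable A -> measurable B -> P (S @^-1` A `&` Y 0%N @^-1` B) =
    (P (S @^-1` A) * P (Y 0%N @^-1` B))%E.
  move=> mA mB; rewrite setIC muleC.
  apply: (first_independent hY mB (C := (fun y : @seqT R => \sum_(i < k) y i) @^-1` A)).
  by have := measurable_sum_coord k measurableT mA; rewrite setTI.
exact: (freezing ind mD).
Qed.

(** The probability space varies because the clocks have to be compared under
    the different initial phases.  Induction, conditioning on the first
    term. *)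
Lemma erlang_law k : forall d (T : measurableType d) (P : probability T R)
    (Y : nat -> {mfun T >-> R}) d' (T' : measurableType d') (P' : probability T' R)
    (Y' : nat -> {mfun T' >-> R}) (h : R),
  iid_exponential P nu Y -> iid_exponential P' nu Y' ->
  P [set w | h < erlang Y k w] = P' [set w | h < erlang Y' k w].
Proof.
elim: k => [|k IH] d T P Y d' T' P' Y' h hY hY'.
  have [h0|h0] := ltP h 0.
    rewrite (_ : [set w | _] = setT); last by apply/seteqP; split => w //= _; rewrite erlang0.
    rewrite (_ : [set w | h < _] = setT); last by apply/seteqP; split => w //= _;
      rewrite erlang0.
    by rewrite !probability_setT.
  rewrite (_ : [set w | _] = set0); last by apply/seteqP; split => w //=;
    rewrite erlang0 ltNge h0.
  rewrite (_ : [set w | h < _] = set0); last by apply/seteqP; split => w //=;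
    rewrite erlang0 ltNge h0.
  by rewrite !measure0.
pose D : set (R * R) := [set p | h < p.1 + p.2].
have mD : measurable D.
  apply: measurable_fun_gt; apply: measurable_funD;
    [exact: measurable_fst|exact: measurable_snd].
have F d0 (T0 : measurableType d0) (P0 : probability T0 R) (Y0 : nat -> {mfun T0 >-> R}) :
    iid_exponential P0 nu Y0 -> P0 [set w | h < erlang Y0 k.+1 w] =
    (\int[distribution P0 (Y0 0%N)]_x P0 [set w | (h - x < erlang (fun n => Y0 n.+1) k
      w)%R])%E.
  move=> hY0; have := freeze_first hY0 (measurable_sum_coord k) mD.
  rewrite (_ : [set w | D _] = [set w | h < erlang Y0 k.+1 w]) => [->|].
    apply: eq_integral => x _; congr (P0 _); apply/seteqP.
    by split => w; rewrite /D/= ltrBlDl.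
  by apply/seteqP; split => w; rewrite /D/= erlangS.
rewrite !F//.
rewrite (eq_measure_integral (distribution P' (Y' 0%N))); last first.
  move=> A mA _; transitivity (exponential_prob nu A); first exact: hY.1.
  by apply/esym; exact: hY'.1.
apply: eq_integral => x _; apply: IH; exact: iid_exponential_shift.
Qed.

(** Induction on the current stage [n].  In stage [0] all the terms but the
    first are frozen, and the first one lacks memory; in stage [n + 1] the
    first term is over, and freezing it only shifts [t]. *)
Lemma erlang_memoryless n : forall k d (T : measurableType d) (P : probability T R)
    (Y : nat -> {mfun T >-> R}) (t h : R),
  (n < k)%N -> 0 <= h -> iid_exponential P nu Y ->
  P [set w | [/\ erlang Y n w <= t, t < erlang Y n.+1 w & t + h < erlang Y k w]] =
  (P [set w | (erlang Y n w <= t)%R /\ (t < erlang Y n.+1 w)%R] *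
   P [set w | (h < erlang Y (k - n) w)%R])%E.
Proof.
elim: n => [|n IH] [//|k] d T P Y t h nk h0 hY.
  rewrite subn0.
  have [t0|t0] := ltP t 0.
    rewrite (_ : [set w | _] = set0); last first.
      by apply/seteqP; split => w //= -[]; rewrite erlang0 leNgt t0.
    rewrite (_ : [set w | _ /\ _] = set0) ?measure0 ?mul0e//.
    by apply/seteqP; split => w //= -[]; rewrite erlang0 leNgt t0.
  pose D : set (R * R) :=
    [set p | t < p.2 /\ t + h < p.2 + p.1].
  have mfst := @measurable_fst _ _ R R.
  have msnd := @measurable_snd _ _ R R.
  have mD : measurable D.
    apply: measurable_conj; first exact: measurable_fun_gt.
    by apply: measurable_fun_gt; exact: (measurable_funD msnd mfst).
  pose D' : set (R * R) := [set p | h < p.2 + p.1].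
  have mD' : measurable D'.
    by apply: measurable_fun_gt; exact: (measurable_funD msnd mfst).
  have := freeze_sum k hY mD.
  rewrite (_ : [set w | D _] = [set w | [/\ erlang Y 0 w <= t, t < erlang Y 1 w & t + h
    < erlang Y k.+1 w]]); last first.
    by apply/seteqP; split => w; rewrite /D/= !erlangS !erlang0 addr0 => -[].
  move=> ->.
  have := freeze_sum k hY mD'.
  rewrite (_ : [set w | D' _] = [set w | h < erlang Y k.+1 w]); last first.
    by apply/seteqP; split => w; rewrite /D'/= erlangS.
  move=> ->.
  rewrite (_ : [set w | _ /\ _] = [set w | t < Y 0%N w]); last first.
    by apply/seteqP; split => w /=; rewrite !erlangS !erlang0 addr0; first by move=> [].
  rewrite -ge0_integralZl//; last exact: measurable_frozen.
  apply: eq_integral => s _.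
  have := exponential_memoryless hnu (hY.1 0%N) (h - s) t0.
  rewrite (_ : [set w | (h - s < _)%R] = [set w | D' (s, Y 0%N w)]) => [<-|].
    congr (P _); apply/seteqP; split => w; rewrite /D/= => -[? ?]; split => //; lra.
  by apply/seteqP; split => w; rewrite /D'/= ltrBlDr.
pose Y' i := Y i.+1; have hY' : iid_exponential P nu Y' := iid_exponential_shift hY.
pose v (y : @seqT R) : R * R * R :=
  (\sum_(i < n) y i, \sum_(i < n.+1) y i, \sum_(i < k) y i).
have mv : measurable_fun setT v.
  apply: measurable_fun_pair; last exact: measurable_sum_coord.
  by apply: measurable_fun_pair; exact: measurable_sum_coord.
(* [v] lists the times, counted from the first tick, of ticks [n + 1], [n + 2] and [k + 1]. *)
pose D0 : set (R * (R * R * R)) := [set p | ~ (t < p.1 + p.2.1.1) /\ t < p.1 + p.2.1.2].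
pose D : set (R * (R * R * R)) := [set p | D0 p /\ t + h < p.1 + p.2.2].
have m1 := @measurable_fst _ _ R (R * R * R)%type.
have m2 := @measurable_snd _ _ R (R * R * R)%type.
have m21 := measurableT_comp (@measurable_fst _ _ (R * R)%type R) m2.
have m22 := measurableT_comp (@measurable_snd _ _ (R * R)%type R) m2.
have m211 := measurableT_comp (@measurable_fst _ _ R R) m21.
have m212 := measurableT_comp (@measurable_snd _ _ R R) m21.
have mD0 : measurable D0.
  apply: measurable_conj.
    apply: measurableC.
    by apply: measurable_fun_gt; exact: (measurable_funD m1 m211).
  by apply: measurable_fun_gt; exact: (measurable_funD m1 m212).
have mD : measurable D.
  apply: measurable_conj => //.
  by apply: measurable_fun_gt; exact: (measurable_funD m1 m22).
have := freeze_first hY mv mD.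
rewrite (_ : [set w | D _] = [set w | [/\ erlang Y n.+1 w <= t, t < erlang Y n.+2 w
    & t + h < erlang Y k.+1 w]]); last first.
  apply/seteqP; split => w; rewrite /D/D0/= !(erlangS Y).
    by move=> [[/negP h1 h2] h3]; rewrite -leNgt in h1.
  by move=> [h1 h2 h3]; do 2 split => //; apply/negP; rewrite -leNgt.
move=> ->.
have := freeze_first hY mv mD0.
rewrite (_ : [set w | D0 _] = [set w | erlang Y n.+1 w <= t /\ t < erlang Y n.+2 w]);
  last first.
  apply/seteqP; split => w; rewrite /D0/= !(erlangS Y).
    by move=> [/negP h1 h2]; rewrite -leNgt in h1.
  by move=> [h1 h2]; split => //; apply/negP; rewrite -leNgt.
move=> ->.
have mV : measurable_fun setT (v \o tail_seq Y).
  by apply: measurableT_comp => //; exact: measurable_tail_seq.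
pose V : {mfun T >-> (R * R * R)%type} := HB.pack (v \o tail_seq Y)
  (isMeasurableFun.Build _ _ _ _ _ mV).
rewrite -ge0_integralZr//; last exact: (measurable_frozen P V mD0).
apply: eq_integral => y _.
have := IH k d T P Y' (t - y) h nk h0 hY'.
rewrite subSS (@erlang_law (k - n) _ _ P Y' _ _ P Y h hY' hY).
rewrite (_ : [set w | [/\ _, _ & _]] = [set w | D (y, v (tail_seq Y w))]); last first.
  apply/seteqP; split => w; rewrite /D/D0/= => -[].
    by move=> h1 h2 h3; split; [split; [apply/negP; rewrite -leNgt|]|]; move: h1 h2 h3;
      rewrite /erlang/Y'/tail_seq; lra.
  move=> [/negP + h2 h3]; rewrite -leNgt => h1.
  by split; move: h1 h2 h3; rewrite /erlang/Y'/tail_seq; lra.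
move=> ->; congr (P _ * _)%E.
apply/seteqP; split => w; rewrite /D0/= => -[].
  by move=> h1 h2; split; [apply/negP; rewrite -leNgt|]; move: h1 h2;
    rewrite /erlang/Y'/tail_seq; lra.
move=> /negP + h2; rewrite -leNgt => h1.
by split; move: h1 h2; rewrite /erlang/Y'/tail_seq; lra.
Qed.

End Erlang.

(** * The space of right-continuous phase paths *)

Section FiniteLaw.
Context {R : realType} {d1 d2 : measure_display}.
Context {T1 : measurableType d1} {T2 : measurableType d2}.

Lemma law_eq_finite (I : finType) (mu : probability T1 R) (nu : probability T2 R)
    (W1 : set T1) (W2 : set T2) (f : T1 -> I) (g : T2 -> I) (k : R) :
  0 <= k -> measurable W1 -> measurable W2 ->
  (forall y, measurable [set w | f w = y]) ->
  (forall y, measurable [set w | g w = y]) ->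
  (forall y, mu (W1 `&` [set w | f w = y]) = (k%:E * nu (W2 `&` [set w | g w = y]))%E) ->
  forall B : set I, mu (W1 `&` [set w | B (f w)]) = (k%:E * nu (W2 `&` [set w | B (g w)]))%E.
Proof.
move=> k0 mW1 mW2 mf mg fg B.
have E1 : W1 `&` [set w | B (f w)] = \bigcup_(y in B) (W1 `&` [set w | f w = y]).
  apply/seteqP; split => w /= [].
    by move=> Ww Bw; exists (f w).
  by move=> y By [Ww fy]; rewrite fy.
have E2 : W2 `&` [set w | B (g w)] = \bigcup_(y in B) (W2 `&` [set w | g w = y]).
  apply/seteqP; split => w /= [].
    by move=> Ww Bw; exists (g w).
  by move=> y By [Ww fy]; rewrite fy.
have t1 : trivIset B (fun y => W1 `&` [set w | f w = y]).
  by move=> y y' _ _ [w [[_ <-] [_ <-]]].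
have t2 : trivIset B (fun y => W2 `&` [set w | g w = y]).
  by move=> y y' _ _ [w [[_ <-] [_ <-]]].
have fB : finite_set B by exact: finite_finset.
rewrite E1 E2 measure_fin_bigcup//; last by move=> y _; exact: measurableI.
rewrite measure_fin_bigcup//; last by move=> y _; exact: measurableI.
rewrite ge0_mule_fsumr//.
by apply: eq_fsbigr => y _; exact: fg.
Qed.

End FiniteLaw.

Section Cylinders.
Context {R : realType} {m : nat}.

Definition nonneg_times (s : seq R) := forall t, t \in s -> 0 <= t.

Section Generic.
Context {d : measure_display} {T : measurableType d}.
Variables (psi : R -> T -> 'I_m).
Hypothesis mpsi : forall (t : R) j, 0 <= t -> measurable [set w | psi t w = j].

Lemma measurable_cylinder_point s y : nonneg_times s ->
  measurable [set w | [seq psi t w | t <- s] = y].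
Proof.
elim: s y => [|t s IH] y hs /=; first exact: measurable_cst_prop.
case: y => [|j y].
  by rewrite (_ : [set w | _] = set0)//; apply/seteqP; split.
rewrite (_ : [set w | _] = [set w | psi t w = j] `&` [set w | [seq psi t w | t <- s] = y]).
  apply: measurableI; first by apply: mpsi; apply: hs; rewrite inE eqxx.
  by apply: IH => u us; apply: hs; rewrite inE us orbT.
by apply/seteqP; split => w /=; [move=> [-> ->]|move=> [-> ->]].
Qed.

Lemma measurable_cylinder s (B : set (seq 'I_m)) : nonneg_times s ->
  measurable [set w | B [seq psi t w | t <- s]].
Proof.
move=> hs.
rewrite (_ : [set w | _] = \bigcup_(y in [set y : (size s).-tuple 'I_m | B y])
    [set w | [seq psi t w | t <- s] = y]).
  apply: fin_bigcup_measurable; first exact: finite_finset.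
  by move=> y _; exact: measurable_cylinder_point.
apply/seteqP; split => w /=; last by move=> [y By ->].
by move=> h; exists (map_tuple (psi ^~ w) (in_tuple s)).
Qed.

End Generic.

(** Right-continuity is part of the type, so that passage events are measurable
    for the sigma-algebra generated by the coordinates. *)
Record rpath := RPath { pfun :> R -> 'I_m; pfunP : right_const pfun }.

(** Conditions on the list of values, rather than prescribed values, make
    cylinders closed under intersection by concatenation of the times. *)
Definition cylinders : set (set rpath) := [set E | exists s B,
  nonneg_times s /\ E = [set f : rpath | B [seq f t | t <- s]]].

Lemma nonneg_times_cat s1 s2 : nonneg_times s1 -> nonneg_times s2 ->
  nonneg_times (s1 ++ s2).
Proof. by move=> h1 h2 t; rewrite mem_cat => /orP[/h1|/h2]. Qed.

Lemma setI_closed_cylinders : setI_closed cylinders.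
Proof.
move=> _ _ [s1 [B1 [h1 ->]]] [s2 [B2 [h2 ->]]].
exists (s1 ++ s2), [set y | B1 (take (size s1) y) /\ B2 (drop (size s1) y)].
split; first exact: nonneg_times_cat.
apply/seteqP; split => f /=; rewrite map_cat;
  by rewrite take_size_cat ?size_map// drop_size_cat ?size_map.
Qed.

Lemma measurable_path_event d (T : measurableType d) (psi : T -> rpath) :
  (forall (t : R) j, 0 <= t -> measurable [set w | psi w t = j]) ->
  forall D, <<s cylinders >> D -> measurable (psi @^-1` D).
Proof.
move=> mpsi.
have : sigma_algebra setT [set D : set rpath | measurable (psi @^-1` D)].
  split => /=.
  - by rewrite preimage_set0.
  - by move=> D mD; rewrite setTD preimage_setC; exact: measurableC.
  - by move=> F mF; rewrite preimage_bigcup; exact: bigcupT_measurable.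
move=> /smallest_sub; apply => _ [s [B [hs ->]]] /=.
exact: (@measurable_cylinder _ _ (fun t w => psi w t)).
Qed.

Lemma right_const_stop (f : rpath) r : right_const (fun s => f (Num.min s r)).
Proof.
move=> t t0; apply/near_rightP; have [rt|tr] := leP r t.
  exists 1 => // s ts _; rewrite !min_r//; exact: (le_trans rt (ltW ts)).
have [e e0 he] := (near_rightP _ _).1 (pfunP f t0).
exists (Num.min e (r - t)); first by rewrite lt_min e0 subr_gt0.
move=> s ts; rewrite -ltrBlDl lt_min => /andP[s1 s2].
by rewrite !min_l ?he//; lra.
Qed.

(** An event belongs to the past of [r] when it can be read on the path stopped
    at [r]. *)
Definition stop_path r (f : rpath) : rpath := RPath (right_const_stop f r).

End Cylinders.

Section PathSpace.
Context {R : realType} {m : nat} (i0 : 'I_m).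

(** Measurable types are inhabited; the phase provides a constant path. *)
Definition based_path (i : 'I_m) : Type := @rpath R m.

Let const_path : @rpath R m.
Proof. by exists (fun=> i0) => t _; exact: nearW. Defined.

HB.instance Definition _ := gen_eqMixin (based_path i0).
HB.instance Definition _ := gen_choiceMixin (based_path i0).
HB.instance Definition _ := isPointed.Build (based_path i0) const_path.

Definition path_space := g_sigma_algebraType (@cylinders R m : set (set (based_path i0))).

Lemma measurable_path_space_point t j : 0 <= t ->
  measurable [set f : path_space | pfun f t = j].
Proof.
move=> t0; apply: sub_sigma_algebra; exists [:: t], [set y | y = [:: j]]; split.
  by move=> u; rewrite inE => /eqP ->.
by apply/seteqP; split => f /=; [move=> ->|move=> []].
Qed.

End PathSpace.

(** * The Markov property at a fixed time *)

Section Fdd.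
Context {R : realType} {m : nat} {d : measure_display} {T : measurableType d}.
Variables (A : 'M[R]_m) (phi : R -> T -> 'I_m).
Implicit Types (P : probability T R) (s : seq R) (y : seq 'I_m).

(** The probability that the chain that is in phase [i] at time [t] takes the
    successive values [y] at the times [s]. *)
Fixpoint pathprob (i : 'I_m) (t : R) s y : R :=
  match s, y with
  | u :: s', x :: y' => expmx ((u - t) *: A) i x * pathprob x u s' y'
  | _, _ => 1
  end.

Lemma pathprobE i0 s : forall i t y, size y = size s ->
  \prod_(k < size s) expmx ((nth 0 (t :: s) k.+1 - nth 0 (t :: s) k) *: A)
     (nth i0 (i :: y) k) (nth i0 (i :: y) k.+1) = pathprob i t s y.
Proof.
elim: s => [|u s IH] i t [|x y] //= sy; first by rewrite big_ord0.
by rewrite big_ord_recl /=; congr (_ * _); rewrite -IH; [|case: sy].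
Qed.

Lemma pathprob_cat s1 r s2 y1 u y2 : size y1 = size s1 -> forall i t,
  pathprob i t (s1 ++ r :: s2) (y1 ++ u :: y2) =
  pathprob i t (rcons s1 r) (rcons y1 u) * pathprob u r s2 y2.
Proof.
elim: s1 y1 => [|v s1 IH] [|x y1] //= sy i t; first by rewrite mulr1.
by rewrite IH ?mulrA//; case: sy.
Qed.

Lemma pathprob_shift r s : forall u t y,
  pathprob u (r + t) [seq r + v | v <- s] y = pathprob u t s y.
Proof.
elim: s => [|v s IH] u t [|x y] //=.
by rewrite IH opprD addrACA subrr add0r.
Qed.

Lemma probability_setI_full P (E F : set T) : measurable E -> measurable F ->
  P E = 1%E -> P (E `&` F) = P F.
Proof.
move=> mE mF PE.
have mEC : measurable (~` E) by exact: measurableC.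
have z : P (F `&` ~` E) = 0%E.
  apply/eqP; rewrite eq_le measure_ge0 andbT.
  apply: (@le_trans _ _ (P (~` E))).
    by apply: le_measure; rewrite ?inE//; exact: measurableI.
  by rewrite probability_setC// PE subee.
rewrite -[F in RHS](setIT F) -(setUv E) setIUr measureU//.
- transitivity (P (F `&` E) + 0)%E; first by rewrite adde0 setIC.
  by congr (_ + _)%E; exact/esym.
- exact: measurableI.
- exact: measurableI.
- by rewrite setIACA setICr setI0.
Qed.

Lemma ctmc_fdd P (hP : is_ctmc P A phi) i (hi : P [set w | phi 0 w = i] = 1%E) s y :
  path <=%R 0 s -> size y = size s ->
  P [set w | [seq phi t w | t <- s] = y] = (pathprob i 0 s y)%:E.
Proof.
move=> ps sy; have [m1 _ _ h] := hP.
have s0 : nonneg_times s.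
  move=> t ts; move: ps; rewrite path_sortedE; last exact: le_trans.
  by move=> /andP[/allP/(_ t ts)].
rewrite -(probability_setI_full _ _ hi); last 2 first.
- exact: m1.
- exact: (measurable_cylinder_point m1).
have := h (size s) (nth 0 (0 :: s)) (nth i (i :: y)) erefl.
rewrite pathprobE// hi mul1e => <-; last first.
  by move=> k ks; exact: (pathP 0 ps).
congr (P _); apply/seteqP; split => w /=.
  move=> [w0 wy] [|k] //= ks; rewrite -wy (nth_map 0)//.
move=> hw; split; first exact: (hw 0%N).
apply: (@eq_from_nth _ i); rewrite size_map// => k ks.
by rewrite (nth_map 0)//; exact: (hw k.+1).
Qed.

End Fdd.

Section Markov.
Context {R : realType} {m : nat} {d : measure_display} {T : measurableType d}.
Variables (A : 'M[R]_m) (phi : R -> T -> 'I_m) (P : 'I_m -> probability T R).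
Hypothesis hphi : forall i, is_ctmc (P i) A phi.
Hypothesis hphi0 : forall i, P i [set w | phi 0 w = i] = 1%E.

(** The finite dimensional laws are only given at increasing times that start
    from [0]. *)
Lemma sorted_cylinder (i0 : 'I_m) (s : seq R) (B : set (seq 'I_m)) : nonneg_times s ->
  exists s' B', [/\ path <=%R 0 s', {subset s' <= s} &
    forall f : R -> 'I_m, B [seq f t | t <- s] <-> B' [seq f t | t <- s']].
Proof.
move=> hs; pose s' := sort <=%R s.
have ss t : (t \in s') = (t \in s) by rewrite mem_sort.
exists s', [set y | B [seq nth i0 y (index t s') | t <- s]]; split.
- rewrite path_sortedE; last exact: le_trans.
  rewrite sort_le_sorted andbT; apply/allP => t; rewrite ss; exact: hs.
- by move=> t; rewrite ss.
move=> f /=; rewrite (_ : [seq nth i0 [seq f t | t <- s'] (index t s') | t <- s] = [seq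
  f t | t <- s])//.
apply/eq_in_map => t ts; rewrite (nth_map 0) ?index_mem ?ss//.
by rewrite nth_index ?ss.
Qed.

Lemma measurable_phase (t : R) j : 0 <= t -> measurable [set w | phi t w = j].
Proof. by move=> t0; have [m1 _ _ _] := hphi j; exact: m1. Qed.

Let fin_prob i (E : set T) : measurable E -> (fine (P i E))%:E = P i E.
Proof. by move=> mE; rewrite fineK// fin_num_measure. Qed.

Let fine_prob_ge0 i (E : set T) : 0 <= fine (P i E).
Proof. by rewrite fine_ge0. Qed.

Variables (i u : 'I_m) (r : R).
Hypothesis r0 : 0 <= r.

Let past s y := [set w | [seq phi t w | t <- s] = y].
Let now := [set w | phi r w = u].
Let future s (B : set (seq 'I_m)) := [set w | B [seq phi (r + t) w | t <- s]].

Let mnow : measurable now. Proof. exact: measurable_phase. Qed.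

Let path_nonneg (s : seq R) : path <=%R 0 s -> nonneg_times s.
Proof.
rewrite path_sortedE; last exact: le_trans.
by move=> /andP[/allP h _] t /h.
Qed.

Lemma measurable_future s B : nonneg_times s -> measurable (future s B).
Proof.
move=> hs; apply: (@measurable_cylinder R m _ T (fun t => phi (r + t))) => // t j t0.
by apply: measurable_phase; rewrite addr_ge0.
Qed.

(** The product that gives the finite dimensional laws splits at time [r]. *)
Lemma markov_points (s1 s2 : seq R) y1 y2 : path <=%R 0 (rcons s1 r) -> path <=%R 0 s2 ->
  size y1 = size s1 -> size y2 = size s2 ->
  P i (past s1 y1 `&` now `&` [set w | [seq phi (r + t) w | t <- s2] = y2]) =
  (P i (past s1 y1 `&` now) * P u (past s2 y2))%E.
Proof.
move=> ps1 ps2 sz1 sz2.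
have [h psf] : path <=%R 0 (s1 ++ r :: [seq r + t | t <- s2]) /\ size (y1 ++ u :: y2) =
  size (s1 ++ r :: [seq r + t | t <- s2]).
  split; last by rewrite !size_cat /= size_map sz1 sz2.
  rewrite -cat_rcons cat_path ps1 last_rcons /=.
  rewrite -[X in path _ X _](addr0 r) path_map.
  by rewrite (eq_path (e' := <=%R))// => a b /=; rewrite lerD2l.
have e1 : past s1 y1 `&` now `&` [set w | [seq phi (r + t) w | t <- s2] = y2] =
   past (s1 ++ r :: [seq r + t | t <- s2]) (y1 ++ u :: y2).
  apply/seteqP; split => w; rewrite /past/now/= map_cat /= -map_comp.
    by move=> [[-> ->] <-].
  move=> /eqP; rewrite eqseq_cat ?size_map ?sz1// => /andP[/eqP -> /eqP[-> <-]].
  by [].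
have e2 : past s1 y1 `&` now = past (rcons s1 r) (rcons y1 u).
  apply/seteqP; split => w; rewrite /past/now/= map_rcons.
    by move=> [-> ->].
  by move=> /rcons_inj[-> ->].
rewrite e1 e2 (ctmc_fdd (hphi i) (hphi0 i) h psf).
rewrite (ctmc_fdd (hphi i) (hphi0 i) ps1) ?size_rcons ?sz1//.
rewrite (ctmc_fdd (hphi u) (hphi0 u) ps2)// -EFinM pathprob_cat//.
by have := pathprob_shift A r s2 u 0 y2; rewrite addr0 => ->.
Qed.

(** Sum over the values taken in the future, then over those of the past. *)
Lemma markov_sorted (s1 s2 : seq R) (B1 B2 : set (seq 'I_m)) : path <=%R 0 (rcons s1 r)
  -> path <=%R 0 s2 ->
  P i (now `&` future s2 B2 `&` [set w | B1 [seq phi t w | t <- s1]]) =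
  (P i (now `&` [set w | B1 [seq phi t w | t <- s1]]) *
   P u [set w | B2 [seq phi t w | t <- s2]])%E.
Proof.
move=> ps1 ps2.
have n2 := path_nonneg ps2.
have n1 : nonneg_times s1.
  by move=> t ts; apply: (path_nonneg ps1); rewrite mem_rcons inE ts orbT.
have mpast y1 : measurable (past s1 y1) by exact: (measurable_cylinder_point measurable_phase).
have m2 : measurable [set w | B2 [seq phi t w | t <- s2]].
  exact: (measurable_cylinder measurable_phase).
have mfut := measurable_future B2 n2.
have step1 (y1 : (size s1).-tuple 'I_m) : P i (now `&` future s2 B2 `&` past s1 y1) =
    ((fine (P u [set w | B2 [seq phi t w | t <- s2]]))%:E * P i (now `&` past s1 y1))%E.
  rewrite fin_prob// muleC.
  have mW : measurable (past s1 y1 `&` now) by exact: measurableI.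
  have := @law_eq_finite R _ _ T T ((size s2).-tuple 'I_m) (P i) (P u)
    (past s1 y1 `&` now) setT
    (fun w => map_tuple (fun t => phi (r + t) w) (in_tuple s2))
    (fun w => map_tuple (fun t => phi t w) (in_tuple s2))
    (fine (P i (past s1 y1 `&` now))) (fine_prob_ge0 _ _) mW measurableT _ _ _ B2.
  rewrite setTI fin_prob// => H.
  transitivity (P i (past s1 y1 `&` now `&` future s2 B2)).
    by congr (P i _); rewrite setIC setIA setIAC.
  rewrite H.
  - by rewrite [now `&` _]setIC.
  - move=> y; rewrite (_ : [set w | _] = future s2 [set z : seq 'I_m | z = tval y]).
      exact: measurable_future.
    by apply/seteqP; split => w /=; [move=> <-|move=> h; exact: val_inj].
  - move=> y; rewrite (_ : [set w | _] = past s2 y).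
      exact: (measurable_cylinder_point measurable_phase).
    by apply/seteqP; split => w /=; [move=> <-|move=> h; exact: val_inj].
  - move=> y; rewrite setTI.
    have := markov_points ps1 ps2 (size_tuple y1) (size_tuple y).
    move=> E; transitivity (P i (past s1 y1 `&` now `&` [set w | [seq phi (r + t) w | t
      <- s2] = y])).
      congr (P i (_ `&` _)).
      by apply/seteqP; split => w /=; [move=> <-|move=> h; exact: val_inj].
    rewrite E; congr (_ * P u _)%E.
    by apply/seteqP; split => w /=; [move=> h; exact: val_inj|move=> <-].
have := @law_eq_finite R _ _ T T ((size s1).-tuple 'I_m) (P i) (P i)
    (now `&` future s2 B2) now
    (fun w => map_tuple (fun t => phi t w) (in_tuple s1))
    (fun w => map_tuple (fun t => phi t w) (in_tuple s1))
    (fine (P u [set w | B2 [seq phi t w | t <- s2]])) (fine_prob_ge0 _ _)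
    (measurableI _ _ mnow mfut) mnow _ _ _ B1.
have tE (y : (size s1).-tuple 'I_m) :
   [set w | map_tuple (fun t => phi t w) (in_tuple s1) = y] = past s1 y.
  by apply/seteqP; split => w /=; [move=> <-|move=> h; exact: val_inj].
move=> ->; first by rewrite fin_prob// muleC.
- by move=> y; rewrite tE.
- by move=> y; rewrite tE.
- by move=> y; rewrite tE.
Qed.

Lemma markov_cylinder (s1 s2 : seq R) (B1 B2 : set (seq 'I_m)) :
  nonneg_times s1 -> (forall t, t \in s1 -> t <= r) -> nonneg_times s2 ->
  P i (now `&` future s2 B2 `&` [set w | B1 [seq phi t w | t <- s1]]) =
  (P i (now `&` [set w | B1 [seq phi t w | t <- s1]]) *
   P u [set w | B2 [seq phi t w | t <- s2]])%E.
Proof.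
move=> n1 r1 n2.
have [s1' [B1' [p1 sub1 e1]]] := sorted_cylinder i B1 n1.
have [s2' [B2' [p2 sub2 e2]]] := sorted_cylinder i B2 n2.
have -> : [set w | B1 [seq phi t w | t <- s1]] = [set w | B1' [seq phi t w | t <- s1']].
  by apply/seteqP; split => w /=; rewrite (e1 (phi ^~ w)).
have -> : [set w | B2 [seq phi t w | t <- s2]] = [set w | B2' [seq phi t w | t <- s2']].
  by apply/seteqP; split => w /=; rewrite (e2 (phi ^~ w)).
have -> : future s2 B2 = future s2' B2'.
  by apply/seteqP; split => w /=; rewrite /future/= (e2 (fun t => phi (r + t) w)).
apply: markov_sorted => //; rewrite rcons_path p1 /=.
have := mem_last 0 s1'; rewrite inE => /predU1P[->//|/sub1/r1//].
Qed.

Variable path : T -> @rpath R m.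
Hypothesis pathE : forall w t, path w t = phi t w.

(** The past is extended to arbitrary events; the future can remain a cylinder
    until the time is made random. *)
Lemma markov_stop (s2 : seq R) (B2 : set (seq 'I_m)) (D : set rpath) : nonneg_times s2 ->
  <<s cylinders >> D ->
  measurable (now `&` future s2 B2 `&` (fun w => stop_path r (path w)) @^-1` D) /\
  P i (now `&` future s2 B2 `&` (fun w => stop_path r (path w)) @^-1` D) =
  (P i (now `&` (fun w => stop_path r (path w)) @^-1` D) *
   P u [set w | B2 [seq phi t w | t <- s2]])%E.
Proof.
move=> n2 sD.
have mfut := measurable_future B2 n2.
have m2 : measurable [set w | B2 [seq phi t w | t <- s2]].
  exact: (measurable_cylinder measurable_phase).
have [|mE _ E] := @law_eq_pi_system R _ _ T T rpath (P i) (P i) (now `&` future s2 B2) now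
  (fun w => stop_path r (path w)) (fun w => stop_path r (path w))
  (fine (P u [set w | B2 [seq phi t w | t <- s2]])) cylinders
  (measurableI _ _ mnow mfut) mnow (@setI_closed_cylinders R m) _ D sD.
  move=> C CG.
  have [s1 [B1 [n1 ->]]] : cylinders C.
    by case: CG => // ->; exists [::], setT; split.
  pose s1' := [seq Num.min t r | t <- s1].
  have n1' : nonneg_times s1'.
    by move=> t /mapP[t' /n1 t'0 ->]; rewrite le_min t'0.
  have r1' t : t \in s1' -> t <= r by move=> /mapP[t' _ ->]; rewrite ge_min lexx orbT.
  have -> : (fun w => stop_path r (path w)) @^-1` [set f : rpath | B1 [seq f t | t <- s1]]
      = [set w | B1 [seq phi t w | t <- s1']].
    have eqm w : [seq stop_path r (path w) t | t <- s1] = [seq phi t w | t <- s1'].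
      by rewrite -map_comp; apply: eq_map => t; exact: pathE.
    by apply/seteqP; split => w /=; rewrite eqm.
  have mc : measurable [set w | B1 [seq phi t w | t <- s1']].
    exact: (measurable_cylinder measurable_phase).
  split; [by apply: measurableI => //; exact: measurableI|exact: measurableI|].
  by rewrite markov_cylinder// fin_prob// muleC.
by split=> //; rewrite E fin_prob// muleC.
Qed.

End Markov.

(** * The strong Markov property of phases and clock *)

Section Limits.
Context {R : realType} {d : measure_display} {T : measurableType d}.

Lemma measure_eventually (P : probability T R) (W_ : (set T)^nat) (W : set T) :
  (forall N, measurable (W_ N)) ->
  (forall w, exists N0, forall N, (N0 <= N)%N -> (W_ N w <-> W w)) ->
  measurable W /\ P (W_ N) @[N --> \oo] --> P W.
Proof.
move=> mW h.
have WE : W = [set w | exists N0, forall N, (N0 <= N)%N -> W_ N w].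
  apply/seteqP; split => w /=; have [N0 hN0] := h w.
    by move=> Ww; exists N0 => N /hN0 ->.
  move=> [N1 hN1]; apply/(hN0 (maxn N0 N1) (leq_maxl _ _)).
  by apply: hN1; exact: leq_maxr.
have mW' : measurable W by rewrite WE; exact: measurable_eventually.
split => //.
have cW : (\int[P]_w (\1_(W_ N) w)%:E)%E @[N --> \oo] --> (\int[P]_w (\1_W w)%:E)%E.
  apply: (@dominated_cvg _ _ _ P setT measurableT (fun N w => (\1_(W_ N) w)%:E)
    (fun w => (\1_W w)%:E) (cst 1%E)) => //.
  - by move=> N; apply/measurable_EFinP; exact: measurable_indic.
  - move=> w _; have [N0 hN0] := h w.
    apply: cvg_near_cst; exists N0 => // N /= /hN0 e.
    by rewrite !indicE; congr ((_ : bool)%:R%:E); apply/idP/idP; rewrite !inE => /e.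
  - by apply: finite_measure_integrable_cst.
  - move=> N w _; rewrite indicE; case: (_ \in _); rewrite /= ?normr1 ?normr0 lee_fin//.
rewrite integral_indic// setIT in cW.
apply: cvg_trans cW; apply: near_eq_cvg; near=> N.
by rewrite integral_indic// setIT.
Unshelve. all: by end_near.
Qed.

Lemma near_right_lt (t e : R) : \forall r \near t^'+, (r < e) = (t < e).
Proof.
apply/near_rightP; have [te|et] := ltP t e.
  by exists (e - t); [rewrite subr_gt0|move=> r _; rewrite subrKC => ->].
exists 1 => // r tr _; apply/negbTE; rewrite -leNgt.
exact: (le_trans et (ltW tr)).
Qed.

End Limits.

Section SigmaFields.
Context {R : realType} {m : nat} {d : measure_display} {T : measurableType d}.
Variables (phi : R -> T -> 'I_m) (Y : nat -> {mfun T >-> R}).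

Let phase_gen : set (set T) :=
  [set E | exists t j, 0 <= t /\ E = [set w | phi t w = j]].
Let clock_gen : set (set T) :=
  [set E | exists n B, measurable B /\ E = Y n @^-1` B].

Lemma sigma_phases_point (t : R) j : 0 <= t ->
  measurable ([set w | phi t w = j] : set (g_sigma_algebraType phase_gen)).
Proof. by move=> t0; apply: sub_sigma_algebra; exists t, j. Qed.

Lemma sigma_phasesI E F : sigma_phases phi E -> sigma_phases phi F ->
  sigma_phases phi (E `&` F).
Proof.
exact: (@measurableI _ (g_sigma_algebraType phase_gen)).
Qed.

Lemma sigma_phases_path (psi : T -> @rpath R m) (D : set rpath) :
  (forall t, 0 <= t -> exists2 s, 0 <= s & forall w, psi w t = phi s w) ->
  <<s cylinders >> D -> sigma_phases phi (psi @^-1` D).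
Proof.
move=> hpsi; apply: (@measurable_path_event _ _ _ (g_sigma_algebraType phase_gen)) => t j t0.
have [s s0 e] := hpsi t t0.
have := sigma_phases_point j s0; congr measurable.
by apply/seteqP; split => w /=; rewrite e.
Qed.

Lemma sigma_phases_cylinder (s : seq R) (B : set (seq 'I_m)) : nonneg_times s ->
  sigma_phases phi [set w | B [seq phi t w | t <- s]].
Proof.
move=> hs; apply: (@measurable_cylinder _ _ _ (g_sigma_algebraType phase_gen)) => //.
by move=> t j; exact: sigma_phases_point.
Qed.

Lemma sigma_clock_erlang k :
  measurable_fun setT (erlang Y k : g_sigma_algebraType clock_gen -> R).
Proof.
apply: measurable_sum => n _ B mB; rewrite setTI.
by apply: sub_sigma_algebra; exists n, B.
Qed.

(** The remaining clock is tested against nonnegative thresholds; [None] stands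
    for the whole line, which is not one of the corresponding rays. *)
Definition ray (o : option R) : set R :=
  if o is Some h then [set v | h < v] else setT.

Definition ray_ge0 (o : option R) : Prop := if o is Some h then is_true (0 <= h) else True.

Definition clock_event n k (r : R) o : set T :=
  [set w | (~ (r < erlang Y n w) /\ r < erlang Y n.+1 w) /\ ray o (erlang Y k w - r)].

Lemma measurable_clock_window d' (T' : measurableType d') (e1 e2 e3 : T' -> R) r o :
  measurable_fun setT e1 -> measurable_fun setT e2 -> measurable_fun setT e3 ->
  measurable [set w | (~ (r < e1 w) /\ r < e2 w) /\ ray o (e3 w - r)].
Proof.
move=> m1 m2 m3; apply: measurable_conj.
  apply: measurable_conj; last exact: measurable_fun_gt.
  by apply: measurableC; exact: measurable_fun_gt.
case: o => [h|] /=; last exact: measurable_cst_prop.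
apply: measurable_fun_gt; apply: measurable_funB => //; exact: measurable_cst.
Qed.

Lemma measurable_clock_event n k r o : measurable (clock_event n k r o).
Proof. by apply: measurable_clock_window; exact: measurable_erlang. Qed.

Lemma sigma_clock_event n k r o : sigma_clock Y (clock_event n k r o).
Proof.
apply: (@measurable_clock_window _ (g_sigma_algebraType clock_gen)); exact: sigma_clock_erlang.
Qed.

Lemma clock_event_memoryless (nu : R) (hnu : 0 < nu) (P P' : probability T R) n k r o :
  iid_exponential P nu Y -> iid_exponential P' nu Y -> ray_ge0 o -> (n < k)%N ->
  P (clock_event n k r o) =
  (P (clock_event n k r None) * P' [set w | ray o (erlang Y (k - n) w)])%E.
Proof.
move=> hY hY' o0 nk; case: o o0 => [h|] /= h0; last by rewrite probability_setT mule1.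
have := erlang_memoryless hnu r nk h0 hY.
rewrite (erlang_law (k - n) h hY hY').
rewrite (_ : clock_event n k r (Some h) = [set w | [/\ erlang Y n w <= r, r < erlang Y
  n.+1 w & r + h < erlang Y k w]]).
  move=> ->; congr (P _ * _)%E; apply/seteqP; split => w; rewrite /clock_event/=.
    by move=> [h1 h2]; split => //; split => //; apply/negP; rewrite -leNgt.
  by move=> [[/negP h1 h2] _]; rewrite -leNgt in h1.
apply/seteqP; split => w; rewrite /clock_event/=.
  by move=> [[/negP h1 h2]]; rewrite ltrBrDl -leNgt in h1 *.
move=> [h1 h2 h3]; rewrite ltrBrDl; split => //; split => //.
by apply/negP; rewrite -leNgt.
Qed.

End SigmaFields.

(** An event [E] that is decided at the random time [tau], up to an infinitesimal
    delay: passage times into an open set are of this kind.  That [E] and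
    [tau < r] belong to the past of [r] is expressed by Galmarino's criterion:
    two paths that agree until [r] are not told apart. *)
Definition optional_time (R : realType) m (E : (R -> 'I_m) -> Prop)
    (tau : (R -> 'I_m) -> \bar R) : Prop :=
  [/\ forall f, right_const f -> (0 <= tau f)%E,
      forall r, <<s cylinders >> [set f : rpath | E f /\ (tau f < r%:E)%E] &
      forall r f g, right_const f -> right_const g ->
        (forall s, 0 <= s <= r -> f s = g s) ->
        E f /\ (tau f < r%:E)%E -> E g /\ (tau g < r%:E)%E].

Section StrongMarkov.
Context {R : realType} {m : nat} {d : measure_display} {T : measurableType d}.
Variables (A : 'M[R]_m) (nu : R) (phi : R -> T -> 'I_m) (P : 'I_m -> probability T R).
Variables (Y : nat -> {mfun T >-> R}).
Hypothesis hnu : 0 < nu.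
Hypothesis hphi : forall i, is_ctmc (P i) A phi.
Hypothesis hphi0 : forall i, P i [set w | phi 0 w = i] = 1%E.
Hypothesis hY : forall i, iid_exponential (P i) nu Y.
Hypothesis hind : forall i, independent_clock (P i) phi Y.
Hypothesis rphi : forall w, right_const (phi ^~ w).

Definition the_path (w : T) : rpath := RPath (rphi w).

Variables (E : (R -> 'I_m) -> Prop) (tau : (R -> 'I_m) -> \bar R).
Hypothesis Etau : optional_time E tau.
Variables (i u : 'I_m) (n : nat).

Definition tau_slice (N l : nat) : set (@rpath R m) :=
  [set f : rpath | E f /\ (tau f < (mesh N l)%:E)%E] `\`
  [set f : rpath | E f /\ (tau f < (l%:R / N.+1%:R)%:E)%E].

Lemma tau_sliceP N l (f : rpath) : tau_slice N l f <->
  E f /\ exists2 t, tau f = t%:E & cell N l t.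
Proof.
have [t0 _ _] := Etau; split.
  move=> [[Ef tl] h]; split => //.
  have := t0 f (pfunP f); case et : (tau f) tl => [t| |] // tl _.
  exists t => //; rewrite lte_fin /mesh ltr_pdivlMr// in tl.
  rewrite /cell/= tl andbT -ler_pdivrMr// leNgt; apply/negP => tl'.
  by apply: h; split => //; rewrite et lte_fin.
move=> [Ef [t et /andP[h1 h2]]]; split.
  by split => //; rewrite et lte_fin /mesh ltr_pdivlMr.
by move=> -[_]; rewrite et lte_fin ltr_pdivlMr// ltNge h1.
Qed.

Lemma tau_slice_sigma N l : <<s cylinders >> (tau_slice N l).
Proof.
have [_ h _] := Etau.
apply: (@measurableD _ (path_space i)); exact: h.
Qed.

Lemma tau_slice_stop N l w : tau_slice N l (the_path w) <->
  tau_slice N l (stop_path (mesh N l) (the_path w)).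
Proof.
have [_ _ h] := Etau.
have lt_mesh : l%:R / N.+1%:R <= mesh N l :> R by rewrite /mesh ler_pM2r ?invr_gt0// ler_nat.
have st (s : R) : 0 <= s <= mesh N l -> the_path w s = stop_path (mesh N l) (the_path w) s.
  by move=> /andP[_ sl]; rewrite /= min_l.
have st' (s : R) : 0 <= s <= l%:R / N.+1%:R -> the_path w s = stop_path (mesh N l)
  (the_path w) s.
  by move=> /andP[s0 sl]; apply: st; rewrite s0 (le_trans sl).
split=> -[h1 h2]; split.
- by apply: h h1 => //; [exact: pfunP|exact: pfunP].
- move=> h3; apply: h2; apply: h h3; [exact: pfunP|exact: pfunP|].
  by move=> s /st' ->.
- by apply: h h1; [exact: pfunP|exact: pfunP|move=> s /st ->].
- by move=> h3; apply: h2; apply: h h3; [exact: pfunP|exact: pfunP|exact: st'].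
Qed.

Section FixedTest.
Variables (k : nat) (s : seq R) (B : set (seq 'I_m)) (o : option R).
Hypotheses (nk : (n < k)%N) (hs : nonneg_times s) (ho : ray_ge0 o).

Let mass := P u ([set w | B [seq phi t w | t <- s]] `&`
  [set w | ray o (erlang Y (k - n) w)]).

Definition snapshot (r : R) B o : set T :=
  [set w | phi r w = u /\ B [seq phi (r + t) w | t <- s]] `&` clock_event Y n k r o.

Lemma measurable_slice N l B' o' :
  measurable ((tau_slice N l \o the_path) `&` snapshot (mesh N l) B' o').
Proof.
have mp := measurable_phase hphi.
apply: measurableI.
  by apply: (measurable_path_event (psi := the_path)) => //; exact: tau_slice_sigma.
apply: measurableI; last exact: measurable_clock_event.
apply: measurable_conj; first by apply: mp; exact: mesh_ge0.
by apply: (measurable_future hphi (mesh_ge0 N l)).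
Qed.

(** At a grid point the future and the past of the phases, the remaining and the
    elapsed clock, and finally phases and clock are separated. *)
Lemma slice_factor N l :
  P i ((tau_slice N l \o the_path) `&` snapshot (mesh N l) B o) =
  (P i ((tau_slice N l \o the_path) `&` snapshot (mesh N l) setT None) * mass)%E.
Proof.
pose r : R := mesh N l; have r0 : 0 <= r := mesh_ge0 N l.
pose D := (fun w => stop_path r (the_path w)) @^-1` tau_slice N l.
have DE : (tau_slice N l \o the_path : set T) = D.
  by apply/seteqP; split => w /tau_slice_stop.
pose now := [set w | phi r w = u].
pose fut (B : set (seq 'I_m)) := [set w | B [seq phi (r + t) w | t <- s]].
have n1 : nonneg_times [:: r] by move=> t; rewrite inE => /eqP ->.
have nr : nonneg_times [seq r + t | t <- s].
  by move=> t /mapP[v /hs v0 ->]; rewrite addr_ge0.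
have snow : sigma_phases phi now.
  have := @sigma_phases_cylinder R m d T phi [:: r] [set y | y = [:: u]] n1;
    congr sigma_phases.
  by apply/seteqP; split => w /=; [move=> []|move=> ->].
have sfut B' : sigma_phases phi (fut B').
  have := @sigma_phases_cylinder R m d T phi _ B' nr; congr sigma_phases.
  by apply/seteqP; split => w /=; rewrite -map_comp.
have sD : sigma_phases phi D.
  apply: sigma_phases_path; last exact: tau_slice_sigma.
  move=> t t0; exists (Num.min t r) => //; by rewrite le_min t0.
have fact B' o' : ray_ge0 o' -> P i (D `&` snapshot r B' o') =
    (P i (now `&` fut B' `&` D) * (P i (clock_event Y n k r None) * P u [set w | ray o'
      (erlang Y (k - n) w)]))%E.
  move=> o'0; rewrite -(@clock_event_memoryless R d T Y nu hnu (P i) (P u) n k r o')//.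
  rewrite -hind; last 2 first.
  - by apply: sigma_phasesI => //; exact: sigma_phasesI.
  - exact: sigma_clock_event.
  congr (P i _); rewrite /snapshot setIA; congr (_ `&` _).
  by rewrite setIC.
have massE : mass = (P u [set w | B [seq phi t w | t <- s]] *
    P u [set w | ray o (erlang Y (k - n) w)])%E.
  apply: hind; first exact: sigma_phases_cylinder.
  case: o ho => [h|] h0 /=; last by apply: (@measurableT _ (g_sigma_algebraType _)).
  by apply: (@measurable_fun_gt _ _ (g_sigma_algebraType _)); exact: sigma_clock_erlang.
rewrite DE !fact// massE.
have [_ ->] := markov_stop hphi hphi0 i u r0 (path := the_path) (fun _ _ => erefl) B hs
  (tau_slice_sigma N l).
have [_ ->] := markov_stop hphi hphi0 i u r0 (path := the_path) (fun _ _ => erefl) setT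
  hs (tau_slice_sigma N l).
by rewrite !probability_setT !mule1 muleACA.
Qed.

Definition grid_event N B o : set T :=
  \bigcup_l ((tau_slice N l \o the_path) `&` snapshot (mesh N l) B o).

Definition stopped_event B o : set T := [set w | [/\ E (phi ^~ w),
  (tau (phi ^~ w) < +oo)%E & snapshot (fine (tau (phi ^~ w))) B o w]].

Let mass_fin : mass \is a fin_num.
Proof.
apply: fin_num_measure; apply: measurableI.
    exact: (measurable_cylinder (measurable_phase hphi)).
  case: o => [h|] /=; last exact: measurable_cst_prop.
  by apply: measurable_fun_gt; exact: measurable_erlang.
Qed.

Lemma measurable_grid N B' o' : measurable (grid_event N B' o').
Proof. by apply: bigcupT_measurable => l; exact: measurable_slice. Qed.

Lemma grid_factor N : P i (grid_event N B o) = (P i (grid_event N setT None) * mass)%E.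
Proof.
have tI B' o' : trivIset setT (fun l => (tau_slice N l \o the_path) `&` snapshot (mesh
  N l) B' o').
  move=> l l' _ _ [w [[/tau_sliceP[_ [t et tl]] _] [/tau_sliceP[_ [t' et' tl']] _]]].
  by move: et'; rewrite et => -[tt]; rewrite -tt in tl'; exact: (cell_inj tl tl').
rewrite /grid_event !measure_semi_bigcup//;
  try (by move=> l; exact: measurable_slice);
  try (by exact: measurable_grid).
rewrite -[mass](fineK mass_fin) muleC -nneseriesZl; last by move=> l _; exact: measure_ge0.
apply: eq_eseriesr => l _; rewrite (fineK mass_fin) [RHS]muleC.
exact: slice_factor.
Qed.

(** The stage conditions are weak on the left and strict on the right, the only
    choice for which they are right-continuous. *)
Lemma snapshot_near w (t : R) B' o' : 0 <= t ->
  \forall r \near t^'+, snapshot r B' o' w <-> snapshot t B' o' w.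
Proof.
move=> t0.
have near_eq (v : R) : 0 <= v -> \forall r \near t^'+, phi (r + v) w = phi (t + v) w.
  move=> v0; have [e e0 he] := (near_rightP _ _).1 (rphi w (addr_ge0 t0 v0)).
  apply/near_rightP; exists e => // r tr re; apply: he; first by rewrite ltrD2r.
  by rewrite addrAC ltrD2r.
have near_map : \forall r \near t^'+, [seq phi (r + v) w | v <- s] = [seq phi (t + v) w
  | v <- s].
  elim: s hs => [|v s' IH] hs'; first exact: nearW.
  have v0 : 0 <= v by apply: hs'; rewrite inE eqxx.
  have {}IH := IH (fun x xs => hs' x ltac:(by rewrite inE xs orbT)).
  near=> r => /=; congr (_ :: _); first by near: r; exact: near_eq.
  by near: r.
have near_ray : \forall r \near t^'+, ray o' (erlang Y k w - r) <-> ray o' (erlang Y k w - t).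
  case: o' => [h|] /=; last exact: nearW.
  have := near_right_lt t (erlang Y k w - h); apply: filterS => r.
  by rewrite ltrBrDl -ltrBrDr => ->; rewrite ltrBrDl -ltrBrDr.
near=> r; rewrite /snapshot/clock_event/=.
have -> : phi r w = phi t w by near: r; exact: rphi.
have -> : [seq phi (r + v) w | v <- s] = [seq phi (t + v) w | v <- s] by near: r.
have -> : (r < erlang Y n w) = (t < erlang Y n w) by near: r; exact: near_right_lt.
have -> : (r < erlang Y n.+1 w) = (t < erlang Y n.+1 w) by near: r; exact: near_right_lt.
have re : ray o' (erlang Y k w - r) <-> ray o' (erlang Y k w - t) by near: r.
by rewrite re.
Unshelve. all: by end_near.
Qed.

Lemma grid_cvg B' o' : measurable (stopped_event B' o') /\
  P i (grid_event N B' o') @[N --> \oo] --> P i (stopped_event B' o').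
Proof.
apply: measure_eventually => [N|w]; first exact: measurable_grid.
have [t0 _ _] := Etau; have {}t0 := t0 _ (rphi w).
have [Ew|nEw] := pselect (E (phi ^~ w)); last first.
  exists 0%N => N _; split; last by case.
  by move=> [l _ [/tau_sliceP[]]].
case et : (tau (phi ^~ w)) t0 => [t| |] // t0; last first.
  exists 0%N => N _; split; last by case; rewrite et.
  by move=> [l _ [/tau_sliceP[_ [t]]]]; rewrite /= et.
rewrite lee_fin in t0.
have [N0 hN0] := mesh_near (snapshot_near w B' o' t0).
exists N0 => N N0N; split.
  move=> [l _ [/tau_sliceP[_ [t']]]]; rewrite /= et => -[<-] tl h.
  by split; rewrite ?et ?ltry//=; apply/(hN0 N l).
move=> [_ _]; rewrite et /= => h; have [l tl] := cell_ex N t0.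
exists l => //; split; last by apply/(hN0 N l N0N tl).
by apply/tau_sliceP; split => //; exists t.
Qed.

(** Both sides of the factorisation on the grid converge, since the grid point
    that follows [tau] tends to [tau] from the right. *)
Lemma stopped_factor : P i (stopped_event B o) = (P i (stopped_event setT None) * mass)%E.
Proof.
have [_ c1] := grid_cvg B o; have [_ c2] := grid_cvg setT None.
apply: (cvg_unique _ c1) => //.
have := cvgeZr mass_fin c2; apply: cvg_trans; apply: near_eq_cvg; near=> N.
by rewrite grid_factor.
Unshelve. all: by end_near.
Qed.

End FixedTest.

End StrongMarkov.

Section PathAndClock.
Context {R : realType} {m : nat}.

Definition timed_cylinders : set (set (@rpath R m * R)) :=
  [set E | exists s B o, [/\ nonneg_times s, ray_ge0 o &
     E = [set p : rpath * R | B [seq p.1 t | t <- s] /\ ray o p.2]]].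

Lemma setI_closed_timed_cylinders : setI_closed timed_cylinders.
Proof.
move=> _ _ [s1 [B1 [q1 [h1 r1 ->]]]] [s2 [B2 [q2 [h2 r2 ->]]]].
exists (s1 ++ s2), [set y | B1 (take (size s1) y) /\ B2 (drop (size s1) y)].
have [q [ro oE]] : exists o, ray_ge0 o /\ forall v : R, ray o v <-> ray q1 v /\ ray q2 v.
  case: q1 r1 => [a|] /= a0; case: q2 r2 => [b|] /= b0.
  - exists (Some (Num.max a b)); split; first by rewrite /= le_max a0.
    by move=> v /=; rewrite gt_max; split=> [/andP//|[-> ->]].
  - by exists (Some a); split => // v; split => [va|[]].
  - by exists (Some b); split => // v; split => [vb|[]].
  - by exists None; split => // v; split.
exists q; split; [exact: nonneg_times_cat|by []|].
apply/seteqP; split => -[f v] /=; rewrite map_cat take_size_cat ?size_map//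
  drop_size_cat ?size_map// oE.
  by move=> [[b1 v1] [b2 v2]].
by move=> [[b1 b2] [v1 v2]].
Qed.

Variable (c : 'I_m -> R) (i0 : 'I_m).

Let PR := g_sigma_algebraType (timed_cylinders : set (set (based_path i0 * R)%type)).

(** The rays with nonnegative thresholds only see the positive part of the clock
    coordinate, and so does [exceeds]. *)
Lemma timed_exceeds (a x : R) : 0 <= a -> a <= x ->
  <<s timed_cylinders >> [set p : rpath * R | exceeds c p.1 a x p.2].
Proof.
move=> a0 ax.
have mpt (t : R) j : 0 <= t -> measurable ([set p | (p.1 : rpath) t = j] : set PR).
  move=> t0; apply: sub_sigma_algebra.
  exists [:: t], [set y | y = [:: j]], None; split => //.
    by move=> v; rewrite inE => /eqP ->.
  by apply/seteqP; split => p /=; [move=> ->|case=> -[]].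
have mV : measurable_fun setT (fun p : PR => Num.max 0 p.2).
  apply: (measurability _ (RGenOInfty.measurableE R)) => // _ [_ [h ->] <-].
  rewrite setTI.
  have [h0|h0] := ltP h 0.
    rewrite (_ : _ @^-1` _ = setT); first exact: measurableT.
    by apply/seteqP; split => // p _ /=; rewrite in_itv/= andbT lt_max h0.
  apply: sub_sigma_algebra; exists [::], setT, (Some h); split => //.
  apply/seteqP; split => p /=; rewrite in_itv/= andbT lt_max ltNge h0/=; first by [].
  by case.
have := @measurable_exceeds R m _ PR c (fun t p => (p.1 : rpath) t) mpt (fun p => pfunP
  p.1) a x _ a0 ax mV.
rewrite (_ : [set w | _] = [set p : rpath * R | exceeds c p.1 a x p.2])//.
apply/seteqP; split => p /= -[v [v0 vT cv]]; exists v; split => //.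
  by move: vT; rewrite lt_max ltNge (ltW v0).
by rewrite lt_max vT orbT.
Qed.

End PathAndClock.

Section StrongMarkovEvents.
Context {R : realType} {m : nat} {d : measure_display} {T : measurableType d}.
Variables (A : 'M[R]_m) (nu : R) (phi : R -> T -> 'I_m) (P : 'I_m -> probability T R).
Variables (Y : nat -> {mfun T >-> R}).
Hypothesis hnu : 0 < nu.
Hypothesis hphi : forall i, is_ctmc (P i) A phi.
Hypothesis hphi0 : forall i, P i [set w | phi 0 w = i] = 1%E.
Hypothesis hY : forall i, iid_exponential (P i) nu Y.
Hypothesis hind : forall i, independent_clock (P i) phi Y.
Hypothesis rphi : forall w, right_const (phi ^~ w).

Variables (E : (R -> 'I_m) -> Prop) (tau : (R -> 'I_m) -> \bar R).
Hypothesis Etau : optional_time E tau.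
Variables (i u : 'I_m) (n k : nat).

Definition stopped_at : set T :=
  [set w | E (phi ^~ w) /\ Phi_at phi Y w (tau (phi ^~ w)) u n].

Lemma stopped_atE : stopped_at = stopped_event phi Y E tau u n k [::] setT None.
Proof.
have [t0 _ _] := Etau.
apply/seteqP; split => w; rewrite /stopped_at/stopped_event/snapshot/clock_event/path_of/=.
  move=> [Ew [ty p1 p2 p3]]; have tf := finite_of_lt (t0 _ (rphi w)) ty.
  split => //; split => //; split => //.
  by rewrite tf !lee_fin lte_fin in p2 p3; split => //; apply/negP; rewrite -leNgt.
move=> [Ew ty [[p1 _] [[p2 p3] _]]]; have tf := finite_of_lt (t0 _ (rphi w)) ty.
split => //; split => //; rewrite tf ?lee_fin ?lte_fin//.
by rewrite leNgt; apply/negP.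
Qed.

Lemma fine_tau_ge0 w : 0 <= fine (tau (phi ^~ w)).
Proof. by have [t0 _ _] := Etau; apply: fine_ge0; exact: t0. Qed.

Definition restarted (w : T) : rpath * R :=
  (RPath (right_const_shift (rphi w) (fine_tau_ge0 w)),
   erlang Y k w - fine (tau (phi ^~ w))).

Lemma measurable_stopped_at : measurable stopped_at.
Proof.
have n0 : nonneg_times ([::] : seq R) by [].
rewrite (stopped_atE).
by have [] := @grid_cvg R m d T A phi P Y hphi rphi E tau Etau i u n k [::] n0 setT None.
Qed.

Lemma strong_markov C : (n < k)%N -> <<s timed_cylinders >> C ->
  measurable (stopped_at `&` restarted @^-1` C) /\
  P i (stopped_at `&` restarted @^-1` C) =
  (P i stopped_at * P u [set w | C (RPath (rphi w), erlang Y (k - n) w)])%E.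
Proof.
move=> nk sC.
have mS := measurable_stopped_at.
have PS : P i stopped_at \is a fin_num by exact: fin_num_measure.
have [|mE _ EE] := @law_eq_pi_system R d d T T (rpath * R)%type (P i) (P u) stopped_at setT
  restarted (fun w => (RPath (rphi w), erlang Y (k - n) w)) (fine (P i stopped_at))
  timed_cylinders mS measurableT (@setI_closed_timed_cylinders R m) _ C sC.
  move=> C' C'G.
  have [s [B [q [hs ho ->]]]] : timed_cylinders C'.
    case: C'G => // ->; exists [::], setT, None; split => //.
    by apply/seteqP; split => p //=.
  have e1 : stopped_at `&` restarted @^-1` [set p : rpath * R | B [seq p.1 t | t <- s]
    /\ ray q p.2] =
      stopped_event phi Y E tau u n k s B q.
    rewrite stopped_atE; apply/seteqP; split => w;
      rewrite /stopped_event/snapshot/clock_event/=.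
      by move=> [[Ew ty [[p1 _] [p2 _]]] [b1 b2]].
    by move=> [Ew ty [[p1 b1] [p2 b2]]].
  have e2 : stopped_at = stopped_event phi Y E tau u n k s setT None.
    by rewrite stopped_atE; apply/seteqP; split => w.
  have [mg _] := @grid_cvg R m d T A phi P Y hphi rphi E tau Etau i u n k s hs B q.
  rewrite e1 setTI; split => //.
    apply: measurable_conj; first exact: (measurable_cylinder (measurable_phase hphi)).
    case: q {ho e1 mg} => [h|] /=; last exact: measurable_cst_prop.
    by apply: measurable_fun_gt; exact: measurable_erlang.
  rewrite fineK// e2.
  exact: (stopped_factor hnu hphi hphi0 hY hind rphi Etau).
by split => //; rewrite EE fineK// setTI.
Qed.

Lemma strong_markov_exceeds c (a x : R) : (n < k)%N -> 0 <= a -> a <= x ->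
  let F := [set w | exceeds c (shift_path (phi ^~ w) (fine (tau (phi ^~ w)))) a x
                      (erlang Y k w - fine (tau (phi ^~ w)))] in
  measurable (stopped_at `&` F) /\
  P i (stopped_at `&` F) =
  (P i stopped_at * P u [set w | exceeds c (phi ^~ w) a x (erlang Y (k - n) w)])%E.
Proof.
by move=> nk a0 ax F; exact: (strong_markov nk (timed_exceeds c i a0 ax)).
Qed.

End StrongMarkovEvents.

(** * Renewal equations *)

Section OptionalTimes.
Context {R : realType} {m : nat}.
Variables (c : 'I_m -> R) (i0 : 'I_m).

Let psi (t : R) (f : path_space i0) : 'I_m := pfun f t.
Let mpsi (t : R) j : 0 <= t -> measurable [set f | psi t f = j].
Proof. exact: measurable_path_space_point. Qed.
Let rpsi f : right_const (psi ^~ f). Proof. exact: (pfunP f). Qed.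

Lemma optional_above (b lo hi : R) :
  optional_time (fun f => (tau_above c f b hi < tau_below c f b lo)%E)
                (fun f => tau_above c f b hi).
Proof.
split => [f hf|r|r f g hf hg fg]; first exact: tau_above_ge0.
  have := measurable_climbs_out c mpsi rpsi b lo hi r.
  rewrite (_ : [set w | _] = [set f : rpath | (tau_above c f b hi < tau_below c f b lo)%E
    /\ (tau_above c f b hi < r%:E)%E])//.
  by apply/seteqP; split => f /(climbs_outP c b lo hi r (pfunP f)).
by rewrite !climbs_outP//; exact: climbs_out_congr.
Qed.

Lemma optional_below (b lo hi : R) :
  optional_time (fun f => (tau_below c f b lo < tau_above c f b hi)%E)
                (fun f => tau_below c f b lo).
Proof.
split => [f hf|r|r f g hf hg fg]; first exact: tau_below_ge0.
  have := measurable_climbs_out (fun i => - c i) mpsi rpsi (- b) (- hi) (- lo) r.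
  rewrite (_ : [set w | _] = [set f : rpath | (tau_below c f b lo < tau_above c f b hi)%E
    /\ (tau_below c f b lo < r%:E)%E])//.
  by apply/seteqP; split => f /(falls_outP c b lo hi r (pfunP f)).
by rewrite !falls_outP//; exact: climbs_out_congr.
Qed.

Lemma optional_beta : optional_time (fun=> True) (beta c).
Proof.
split => [f hf|r|r f g hf hg fg]; first exact: beta_ge0.
  have := measurable_beta c mpsi rpsi r.
  rewrite (_ : [set w | _] = [set f : rpath | True /\ (beta c f < r%:E)%E])//.
  by apply/seteqP; split => f //= [].
move=> [_ /beta_ltP[t [t0 tr ft]]]; split => //; apply/beta_ltP; exists t.
by split => //; rewrite -fg// !ltW.
Qed.

End OptionalTimes.

Section Decomposition.
Context {R : realType} {m : nat} {d : measure_display} {T : measurableType d}.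
Variables (A : 'M[R]_m) (nu : R) (phi : R -> T -> 'I_m) (P : 'I_m -> probability T R).
Variables (Y : nat -> {mfun T >-> R}).
Hypothesis hnu : 0 < nu.
Hypothesis hphi : forall i, is_ctmc (P i) A phi.
Hypothesis hphi0 : forall i, P i [set w | phi 0 w = i] = 1%E.
Hypothesis hY : forall i, iid_exponential (P i) nu Y.
Hypothesis hind : forall i, independent_clock (P i) phi Y.
Hypothesis rphi : forall w, right_const (phi ^~ w).

(** Where this fails, which is on a null event, the stages may overlap. *)
Definition ticking : set T := [set w | forall n, 0 < Y n w].

Lemma measurable_ticking : measurable ticking.
Proof.
rewrite (_ : ticking = \bigcap_n [set w | 0 < Y n w]).
  by apply: bigcapT_measurable => n; apply: measurable_fun_gt; exact: measurable_funP.
by apply/seteqP; split => w h n; [move=> _; exact: h|exact: (h n I)].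
Qed.

Lemma ticking_full i : P i ticking = 1%E.
Proof.
have m0 n : measurable [set w | 0 < Y n w].
  by apply: measurable_fun_gt; exact: measurable_funP.
have N : (P i).-negligible (~` ticking).
  rewrite (_ : ~` ticking = \bigcup_n ~` [set w | 0 < Y n w]); last first.
    apply/seteqP; split => w /=; first by move=> /existsNP[n h]; exists n.
    by move=> [n _ h] h'; apply: h; exact: h'.
  apply: negligible_bigcup => n.
  exists (~` [set w | 0 < Y n w]); split => //; first exact: measurableC.
  rewrite [LHS]probability_setC// (exponential_tail hnu ((hY i).1 n)) lexx subee//.
have mt := measurable_ticking.
have h : P i (~` ticking) = 0%E := measure_negligible (measurableC mt) N.
move: h; rewrite [X in X = _]probability_setC//.
have f : P i ticking \is a fin_num by exact: fin_num_measure measurable_ticking.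
rewrite -(fineK f) -EFinB => -[] /eqP; rewrite subr_eq0 => /eqP <- //.
Qed.

Lemma erlang_mono w n n' : ticking w -> (n <= n')%N -> erlang Y n w <= erlang Y n' w.
Proof.
move=> tw; elim: n' => [|n' IH]; first by rewrite leqn0 => /eqP ->.
rewrite leq_eqVlt => /predU1P[-> //|nn']; rewrite erlangSr.
by apply: (le_trans (IH nn')); rewrite lerDl ltW.
Qed.

Lemma stage_ex w t k : 0 <= t -> t < erlang Y k w ->
  exists n, [/\ (n < k)%N, erlang Y n w <= t & t < erlang Y n.+1 w].
Proof.
move=> t0; elim: k => [|k IH]; first by rewrite erlang0 ltNge t0.
have [tk|kt] := ltP t (erlang Y k w); last by move=> tk; exists k.
by move=> _; have [n [nk h1 h2]] := IH tk; exists n; split => //; exact: ltnW.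
Qed.

Lemma stage_uniq w t n n' : ticking w ->
  erlang Y n w <= t -> t < erlang Y n.+1 w ->
  erlang Y n' w <= t -> t < erlang Y n'.+1 w -> n = n'.
Proof.
move=> tw a1 a2 b1 b2; apply/eqP; rewrite eqn_leq; apply/andP; split.
  rewrite leqNgt; apply/negP => /(erlang_mono tw) h.
  by have := lt_le_trans b2 (le_trans h a1); rewrite ltxx.
rewrite leqNgt; apply/negP => /(erlang_mono tw) h.
by have := lt_le_trans a2 (le_trans h b1); rewrite ltxx.
Qed.

Lemma Pr_partition (I : finType) i (F : set T) (F_ : I -> set T) :
  measurable F -> (forall y, measurable (F_ y)) ->
  (forall w, ticking w -> F w <-> exists y, F_ y w) ->
  (forall w y y', ticking w -> F_ y w -> F_ y' w -> y = y') ->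
  Pr P i F = \sum_y Pr P i (F_ y).
Proof.
move=> mF mF_ FE Fdisj; have mt := measurable_ticking.
have full (Z : set T) : measurable Z -> P i Z = P i (ticking `&` Z).
  by move=> mZ; rewrite (probability_setI_full mt mZ (ticking_full i)).
rewrite /Pr full//.
rewrite (_ : ticking `&` F = \bigcup_(y in [set: I]) (ticking `&` F_ y)); last first.
  apply/seteqP; split => w /=.
    by move=> [tw /(FE w tw)[y Fy]]; exists y.
  by move=> [y _ [tw Fy]]; split => //; apply/(FE w tw); exists y.
rewrite measure_fin_bigcup//; last 3 first.
- exact: finite_finset.
- by move=> y y' _ _ [w [[tw Fy] [_ Fy']]]; exact: (Fdisj w).
- by move=> y _; exact: measurableI.
have -> : [set: I] = [set` index_enum I].
  by apply/seteqP; split => y //= _; rewrite mem_index_enum.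
rewrite -fsbig_seq ?index_enum_uniq// -sum_fine; last first.
  by move=> y _; apply: fin_num_measure; exact: measurableI.
by apply: eq_bigr => y _; rewrite [in RHS]full.
Qed.

(** The exit, the stage and the phase at the exit partition the event, up to the
    null event where the clock does not increase. *)
Lemma exit_decomposition (X : finType) (E : X -> (R -> 'I_m) -> Prop)
    (tau : X -> (R -> 'I_m) -> \bar R) (G : X -> set T) i k (F : set T) :
  measurable F -> (forall e, optional_time (E e) (tau e)) ->
  (forall e j n, (n < k)%N -> measurable (stopped_at phi Y (E e) (tau e) j n `&` G e)) ->
  (forall e e' f, E e f -> E e' f -> e = e') ->
  (forall w, F w <-> exists e, [/\ E e (phi ^~ w),
     (tau e (phi ^~ w) < (erlang Y k w)%:E)%E & G e w]) ->
  Pr P i F = \sum_e \sum_(n < k) \sum_j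
    Pr P i (stopped_at phi Y (E e) (tau e) j n `&` G e).
Proof.
move=> mF opt mZ Edisj FE.
pose Z (y : X * ('I_k * 'I_m)) : set T :=
  stopped_at phi Y (E y.1) (tau y.1) y.2.2 y.2.1 `&` G y.1.
have mZ' y : measurable (Z y) by case: y => e [n j]; apply: mZ; exact: ltn_ord.
have FZ w : ticking w -> F w <-> exists y, Z y w.
  move=> tw; split => [/FE|].
    move=> [e [Ee te Ge]]; have [t0 _ _] := opt e.
    have {}t0 := t0 _ (rphi w); have tf := finite_of_lt t0 te.
    have [||n [nk h1 h2]] := @stage_ex w (fine (tau e (phi ^~ w))) k.
    - exact: fine_ge0.
    - by rewrite -lte_fin -tf.
    exists (e, (Ordinal nk, phi (fine (tau e (phi ^~ w))) w)); split => //; split => //.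
    split => //=.
    - by rewrite tf ltry.
    - by rewrite tf lee_fin.
    - by rewrite tf lte_fin.
  move=> [[e [n j]] [[Ee [ty _ h1 h2]] Ge]]; apply/FE; exists e; split => //.
  by apply: (lt_le_trans h2); rewrite lee_fin erlang_mono.
have Zdisj w y y' : ticking w -> Z y w -> Z y' w -> y = y'.
  case: y y' => e [n j] [e' [n' j']] tw /= [[/= Ee [ty p1 h1 h2]] _] [[/= Ee' [ty' p1'
    h1' h2']] _].
  have ee := Edisj _ _ _ Ee Ee'; rewrite -ee in ty' p1' h1' h2' *.
  rewrite -p1 -p1'; congr (_, (_, _)).
  have [t0 _ _] := opt e; have {}t0 := t0 _ (rphi w); have tf := finite_of_lt t0 ty.
  rewrite tf ?lee_fin ?lte_fin in h1 h2 h1' h2'.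
  exact/val_inj/(stage_uniq tw h1 h2 h1' h2').
rewrite (Pr_partition i mF mZ' FZ Zdisj).
pose g e (p : 'I_k * 'I_m) := Pr P i (stopped_at phi Y (E e) (tau e) p.2 p.1 `&` G e).
transitivity (\sum_e \sum_p g e p); first by rewrite pair_bigA; apply: eq_bigr => -[e p].
apply: eq_bigr => e _.
transitivity (\sum_(n < k) \sum_j g e (n, j)); last by [].
by rewrite pair_bigA; apply: eq_bigr => -[n j].
Qed.

End Decomposition.

Section Renewal.
Context {R : realType} {m : nat} {d : measure_display} {T : measurableType d}.
Variables (A : 'M[R]_m) (nu : R) (phi : R -> T -> 'I_m) (P : 'I_m -> probability T R).
Variables (Y : nat -> {mfun T >-> R}) (c : 'I_m -> R).
Hypothesis hnu : 0 < nu.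
Hypothesis hphi : forall i, is_ctmc (P i) A phi.
Hypothesis hphi0 : forall i, P i [set w | phi 0 w = i] = 1%E.
Hypothesis hY : forall i, iid_exponential (P i) nu Y.
Hypothesis hind : forall i, independent_clock (P i) phi Y.
Hypothesis rphi : forall w, right_const (phi ^~ w).
Hypothesis hc : forall i, c i != 0.

Definition crossing i (a x : R) k : R :=
  Pr P i [set w | exceeds c (phi ^~ w) a x (erlang Y k w)].

Lemma measurable_crossing (a x : R) k : 0 <= a -> a <= x ->
  measurable [set w | exceeds c (phi ^~ w) a x (erlang Y k w)].
Proof.
move=> a0 ax; apply: (measurable_exceeds c (measurable_phase hphi) rphi a0 ax).
exact: measurable_erlang.
Qed.

Lemma delta_crossing i (a x : R) k : 0 <= a -> a <= x ->
  1 - delta c P phi Y i a x k = crossing i a x k.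
Proof.
move=> a0 ax; rewrite /delta /crossing /Pr.
have mc := measurable_crossing k a0 ax.
rewrite (_ : [set w | queue_max _ _ _ _ <= _] =
    ~` [set w | exceeds c (phi ^~ w) a x (erlang Y k w)]); last first.
  apply/seteqP; split => w /=; rewrite /path_of.
    by move=> h /(queue_max_exceeds c _ (rphi w) a0 ax); rewrite ltNge h.
  move=> h; rewrite leNgt; apply/negP => h'; apply: h.
  exact/(queue_max_exceeds c _ (rphi w) a0 ax).
rewrite probability_setC// fineB//; last exact: fin_num_measure.
by rewrite subKr.
Qed.

(** [None] is for an exit after which [x] is exceeded whatever happens. *)
Definition crossing_after (o : option R) j x k : R :=
  if o is Some a then crossing j a x k else 1.

Definition crosses_after (o : option R) x k (tau : (R -> 'I_m) -> \bar R) : set T :=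
  if o is Some a then
    [set w | exceeds c (shift_path (phi ^~ w) (fine (tau (phi ^~ w)))) a x
               (erlang Y k w - fine (tau (phi ^~ w)))]
  else setT.

(** The strong Markov property applied to each term of the decomposition; [S e]
    collects the phases in which the exit [e] can take place. *)
Lemma renewal (X : finType) (E : X -> (R -> 'I_m) -> Prop)
    (tau : X -> (R -> 'I_m) -> \bar R) (o : X -> option R) (S : X -> {set 'I_m})
    i (a x : R) k : 0 <= a -> a <= x ->
  (forall e, if o e is Some b then 0 <= b <= x else true) ->
  (forall e, optional_time (E e) (tau e)) ->
  (forall e e' f, E e f -> E e' f -> e = e') ->
  (forall e f, right_const f -> E e f -> (tau e f < +oo)%E -> f (fine (tau e f)) \in S e) ->
  (forall w, exceeds c (phi ^~ w) a x (erlang Y k w) <->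
     exists e, [/\ E e (phi ^~ w), (tau e (phi ^~ w) < (erlang Y k w)%:E)%E &
       crosses_after (o e) x k (tau e) w]) ->
  crossing i a x k = \sum_e \sum_(n < k) \sum_(j in S e)
    Pr P i (stopped_at phi Y (E e) (tau e) j n) * crossing_after (o e) j x (k - n).
Proof.
move=> a0 ax ob opt Edisj ES FE.
have SM e j n : (n < k)%N ->
    measurable (stopped_at phi Y (E e) (tau e) j n `&` crosses_after (o e) x k (tau e)) /\
    Pr P i (stopped_at phi Y (E e) (tau e) j n `&` crosses_after (o e) x k (tau e)) =
    Pr P i (stopped_at phi Y (E e) (tau e) j n) * crossing_after (o e) j x (k - n).
  move=> nk; have := ob e; rewrite /Pr/crossing_after/crosses_after.
  have mS := measurable_stopped_at Y hphi rphi (opt e) i j n k.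
  case: (o e) => [b /andP[b0 bx]|_]; last by rewrite setIT mulr1.
  have [mI ->] := strong_markov_exceeds hnu hphi hphi0 hY hind rphi (opt e) i j c nk b0 bx.
  split => //; rewrite fineM//; first exact: fin_num_measure.
  by apply: fin_num_measure; exact: measurable_crossing.
rewrite /crossing (exit_decomposition hnu hY rphi i (measurable_crossing k a0 ax) opt _
  Edisj FE); last first.
  by move=> e j n /(SM e j)[].
apply: eq_bigr => e _; apply: eq_bigr => n _.
rewrite [RHS]big_mkcond; apply: eq_bigr => j _ /=.
have [_ ->] := SM e j n (ltn_ord n); case: ifPn => // jS.
rewrite (_ : stopped_at _ _ _ _ _ _ = set0); first by rewrite /Pr measure0 mul0r.
apply/seteqP; split => // w [Ew [ty p1 _ _]]; move/negP : jS; apply.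
by rewrite -p1; exact: ES.
Qed.

End Renewal.

(** * Matrix form of the renewal equations *)

Section Substochastic.
Context {R : realType}.

(** A vector fixed by the matrix would satisfy a strict inequality at a
    coordinate of largest modulus. *)
Lemma unitmx_substochastic p (M : 'M[R]_p) :
  (forall i j, 0 <= M i j) -> (forall i, \sum_j M i j < 1) -> 1%:M - M \in unitmx.
Proof.
move=> M0 M1; rewrite -unitmx_tr -row_free_unit -kermx_eq0.
apply/rowV0P => v /sub_kermxP vM; apply/rowP => i0; rewrite mxE.
have vE i : v 0 i = \sum_j M i j * v 0 j.
  have := congr1 (fun N : 'rV_p => N 0 i) vM.
  rewrite linearB /= trmx1 mulmxBr mulmx1 !mxE => /eqP; rewrite subr_eq0 => /eqP ->.
  by apply: eq_bigr => j _; rewrite mxE mulrC.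
have [i _ imax] := @arg_maxP _ R 'I_p i0 xpredT (fun i => `|v 0 i|) erefl.
have vi0 : `|v 0 i| = 0.
  apply/eqP; rewrite eq_le normr_ge0 andbT leNgt; apply/negP => vi.
  have : `|v 0 i| <= \sum_j M i j * `|v 0 i|.
    rewrite {1}vE; apply: (le_trans (ler_norm_sum _ _ _)); apply: ler_sum => j _.
    by rewrite normrM (ger0_norm (M0 i j)) ler_wpM2l//; exact: imax.
  by rewrite -mulr_suml leNgt gtr_pMl// M1.
by apply/normr0_eq0/le_anti; rewrite normr_ge0 andbT -vi0; exact: imax.
Qed.

(** In the renewal equations the first term of the double sum contains the
    unknown itself and has to be set apart. *)
Lemma sum_split_first p q (k : nat) (Q : nat -> 'M[R]_(p, q)) (V : nat -> nat -> 'cV[R]_q) :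
  (0 < k)%N ->
  \sum_(n < k) Q n *m (\sum_(l < (k - n)%N) V n l) =
  Q 0%N *m V 0%N 0%N +
  \sum_(n < k) \sum_(l < k | (1 <= n + l <= k.-1)%N) Q n *m V n l.
Proof.
move=> k0.
have E (n : 'I_k) : \sum_(l < (k - n)%N) V n l = \sum_(l < k | (n + l < k)%N) V n l.
  rewrite (big_ord_widen_cond _ xpredT (V n) (leq_subr n k)).
  by apply: eq_bigl => l; rewrite ltn_subRL.
under eq_bigr do rewrite E mulmx_sumr.
rewrite !pair_big_dep /=.
pose z : 'I_k := Ordinal k0.
rewrite (bigD1 (z, z)) //=; congr (_ + _).
apply: eq_bigl => -[n l] /=; rewrite xpair_eqE -!val_eqE /=.
by case: k k0 {E z} n l => // k _ n l /=; lia.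
Qed.

End Substochastic.

Section RenewalMatrices.
Context {R : realType} {m : nat} {d : measure_display} {T : measurableType d}.
Variables (A : 'M[R]_m) (nu : R) (phi : R -> T -> 'I_m) (P : 'I_m -> probability T R).
Variables (Y : nat -> {mfun T >-> R}) (c : 'I_m -> R).
Hypothesis hnu : 0 < nu.
Hypothesis hphi : forall i, is_ctmc (P i) A phi.
Hypothesis hphi0 : forall i, P i [set w | phi 0 w = i] = 1%E.
Hypothesis hY : forall i, iid_exponential (P i) nu Y.
Hypothesis hind : forall i, independent_clock (P i) phi Y.
Hypothesis rphi : forall w, right_const (phi ^~ w).
Hypothesis hc : forall i, c i != 0.

Let cross i a x k := crossing phi P Y c i a x k.
Let Lam := Lambda c P phi Y.
Let Psi := Psi c P phi Y.
Let hLam := hLambda c P phi Y.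
Let hPsi := hPsi c P phi Y.
Let Ups := Upsilon c P phi Y.
Let cdp := cdelta_plus c P phi Y.
Let cdm := cdelta_minus c P phi Y.

Lemma cdelta_plusE (a x : R) k i : 0 <= a -> a <= x -> cdp a x k i 0 = cross (enum_val
  i) a x k.
Proof. by move=> a0 ax; rewrite !mxE (delta_crossing Y c hphi rphi). Qed.

Lemma cdelta_minusE (a x : R) k i : 0 <= a -> a <= x -> cdm a x k i 0 = cross (enum_val
  i) a x k.
Proof. by move=> a0 ax; rewrite !mxE (delta_crossing Y c hphi rphi). Qed.

Lemma sum_mulmxE p q (k : nat) (M : 'I_k -> 'M[R]_(p, q)) (v : 'I_k -> 'cV[R]_q) i :
  (\sum_(n < k) M n *m v n) i 0 = \sum_(n < k) \sum_l M n i l * v n l 0.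
Proof. by rewrite summxE; apply: eq_bigr => n _; rewrite mxE. Qed.

Lemma renewal_up (a x : R) k : 0 <= a -> a <= x ->
  cdp a x k = \sum_(n < k) Lam (x - a) n *m const_mx 1 +
    \sum_(n < k) Psi (x - a) n *m cdm a x (k - n)%N.
Proof.
move=> a0 ax; have xa : 0 <= x - a by rewrite subr_ge0.
apply/matrixP => i j; rewrite ord1 cdelta_plusE//.
rewrite [RHS]mxE !sum_mulmxE.
pose E (e : bool) f := if e then (tau_above c f 0 (x - a) < tau_below c f 0 0)%E
  else (tau_below c f 0 0 < tau_above c f 0 (x - a))%E.
pose tau (e : bool) f := if e then tau_above c f 0 (x - a) else tau_below c f 0 0.
pose o (e : bool) := if e then None else Some a.
pose S (e : bool) := if e then Sp c else Sm c.
have i0 := enum_val i.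
rewrite /cross (@renewal _ _ _ _ A nu phi P Y c hnu hphi hphi0 hY hind rphi _ E tau o S
  _ a x k a0 ax).
- rewrite big_bool /=; congr (_ + _); apply: eq_bigr => n _.
    rewrite big_enum_val; apply: eq_bigr => l _ /=.
    by rewrite !mxE.
  rewrite big_enum_val; apply: eq_bigr => l _ /=.
  by rewrite cdelta_minusE// !mxE.
- by case=> //=; rewrite a0.
- by case; [exact: (optional_above c i0)|exact: (optional_below c i0)].
- case=> -[] f //= h h'; by have := lt_trans h h'; rewrite ltxx.
- case=> f hf /= h ty; rewrite inE.
    by apply: (rate_tau_above hc hf xa); exact: (finite_of_lt (tau_above_ge0 _ _ _ _) ty).
  by apply: (rate_tau_below hc hf (lexx 0)); exact: (finite_of_lt (tau_below_ge0 c hf _ _) ty).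
move=> w; rewrite (exceeds_up hc _ (rphi w) a0 ax); split.
  by move=> [[h1 h2]|[h1 h2 h3]]; [exists true|exists false].
by move=> [[] [h1 h2 h3]]; [left|right].
Qed.

Lemma renewal_boundary (x : R) k : 0 <= x ->
  cdm 0 x k = \sum_(n < k) Ups n *m cdp 0 x (k - n)%N.
Proof.
move=> x0; apply/matrixP => i j; rewrite ord1 cdelta_minusE//.
rewrite sum_mulmxE.
have i0 := enum_val i.
rewrite /cross (@renewal _ _ _ _ A nu phi P Y c hnu hphi hphi0 hY hind rphi unit
  (fun _ _ => True) (fun _ => beta c) (fun _ => Some 0) (fun _ => Sp c) _ 0 x k (lexx 0) x0).
- rewrite (big_pred1 tt); last by case.
  apply: eq_bigr => n _; rewrite big_enum_val; apply: eq_bigr => l _ /=.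
  rewrite cdelta_plusE// !mxE; congr (Pr _ _ _ * _).
  by apply/seteqP; split => w /= [].
- by rewrite lexx.
- by move=> _; exact: (optional_beta c i0).
- by case; case.
- by move=> _ f hf _ ty; apply: (phase_beta hf); exact: (finite_of_lt (beta_ge0 _ _) ty).
move=> w; rewrite (exceeds_boundary c (erlang Y k w) (rphi w) x0); split.
  by move=> [h1 h2]; exists tt.
by move=> [_ [_ h1 h2]].
Qed.

Lemma renewal_down (a x : R) k : 0 <= a -> a <= x ->
  cdm a x k = \sum_(n < k) (hPsi a n *m cdp a x (k - n)%N +
                           hLam a n *m cdm 0 x (k - n)%N).
Proof.
move=> a0 ax; have x0 : 0 <= x by exact: le_trans ax.
apply/matrixP => i j; rewrite ord1 cdelta_minusE//.
rewrite big_split [RHS]mxE !sum_mulmxE.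
pose E (e : bool) f := if e then (tau_above c f a a < tau_below c f a 0)%E
  else (tau_below c f a 0 < tau_above c f a a)%E.
pose tau (e : bool) f := if e then tau_above c f a a else tau_below c f a 0.
pose o (e : bool) := if e then Some a else Some 0.
pose S (e : bool) := if e then Sp c else Sm c.
have i0 := enum_val i.
rewrite /cross (@renewal _ _ _ _ A nu phi P Y c hnu hphi hphi0 hY hind rphi _ E tau o S
  _ a x k a0 ax).
- rewrite big_bool /=; congr (_ + _); apply: eq_bigr => n _.
    rewrite big_enum_val; apply: eq_bigr => l _ /=.
    by rewrite cdelta_plusE// !mxE.
  rewrite big_enum_val; apply: eq_bigr => l _ /=.
  by rewrite cdelta_minusE// !mxE.
- by case=> //=; rewrite ?a0 ?lexx.
- by case; [exact: (optional_above c i0)|exact: (optional_below c i0)].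
- case=> -[] f //= h h'; by have := lt_trans h h'; rewrite ltxx.
- case=> f hf /= h ty; rewrite inE.
    by apply: (rate_tau_above hc hf (lexx a));
      exact: (finite_of_lt (tau_above_ge0 _ _ _ _) ty).
  by apply: (rate_tau_below hc hf a0); exact: (finite_of_lt (tau_below_ge0 c hf _ _) ty).
move=> w; rewrite (exceeds_down hc _ (rphi w) a0 ax); split.
  by move=> [[h1 h2 h3]|[h1 h2 h3]]; [exists true|exists false].
by move=> [[] [h1 h2 h3]]; [left|right].
Qed.

End RenewalMatrices.

(** * Invertibility *)

Section RowSums.
Context {R : realType} {m : nat} {d : measure_display} {T : measurableType d}.
Variables (A : 'M[R]_m) (nu : R) (phi : R -> T -> 'I_m) (P : 'I_m -> probability T R).
Variables (Y : nat -> {mfun T >-> R}) (c : 'I_m -> R).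
Hypothesis hnu : 0 < nu.
Hypothesis hphi : forall i, is_ctmc (P i) A phi.
Hypothesis hphi0 : forall i, P i [set w | phi 0 w = i] = 1%E.
Hypothesis hY : forall i, iid_exponential (P i) nu Y.
Hypothesis hind : forall i, independent_clock (P i) phi Y.
Hypothesis rphi : forall w, right_const (phi ^~ w).

Lemma Pr_ge0 i (E : set T) : 0 <= Pr P i E.
Proof. by rewrite /Pr fine_ge0. Qed.

Section Exit.
Variables (E : (R -> 'I_m) -> Prop) (tau : (R -> 'I_m) -> \bar R).
Hypothesis Etau : optional_time E tau.
Variables (i : 'I_m) (S : {set 'I_m}).

Let Z n : set T := \bigcup_(l in [set: 'I_#|S|]) stopped_at phi Y E tau (enum_val l) n.

Let mZl l n : measurable (stopped_at phi Y E tau (enum_val (l : 'I_#|S|)) n).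
Proof. exact: (measurable_stopped_at Y hphi rphi Etau i _ n 0%N). Qed.

Let mZ n : measurable (Z n).
Proof. by apply: fin_bigcup_measurable => //; exact: finite_finset. Qed.

Lemma sum_stopped n :
  \sum_(l < #|S|) Pr P i (stopped_at phi Y E tau (enum_val l) n) = Pr P i (Z n).
Proof.
rewrite /Pr /Z measure_fin_bigcup//; last 2 first.
- exact: finite_finset.
- by move=> l l' _ _ [w [[_ [_ e _ _]] [_ [_ e' _ _]]]]; apply: enum_val_inj; rewrite -e -e'.
have -> : [set: 'I_#|S|] = [set` index_enum 'I_#|S|].
  by apply/seteqP; split => y //= _; rewrite mem_index_enum.
rewrite -fsbig_seq ?index_enum_uniq// -sum_fine//.
by move=> l _; exact: fin_num_measure.
Qed.

Lemma sum_stopped_le1 n :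
  \sum_(l < #|S|) Pr P i (stopped_at phi Y E tau (enum_val l) n) <= 1.
Proof.
rewrite sum_stopped /Pr -lee_fin fineK; last exact: fin_num_measure.
exact: probability_le1.
Qed.

(** For some [r > 0] the exit is later than [r] with positive probability, and
    independently the first tick is earlier than [r] with positive
    probability; then the exit is not in stage [0]. *)
Lemma sum_stopped_lt1 :
  (forall f, right_const f -> f 0 = i -> E f -> (0 < tau f)%E) ->
  \sum_(l < #|S|) Pr P i (stopped_at phi Y E tau (enum_val l) 0) < 1.
Proof.
move=> tau_gt0; have [t0 opt _] := Etau.
pose r q : R := q.+1%:R^-1; have r0 q : 0 < r q by rewrite /r invr_gt0.
pose D q := (the_path rphi) @^-1` [set f : rpath | E f /\ (tau f < (r q)%:E)%E].
have sD q : sigma_phases phi (~` D q).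
  apply: (@sigma_phases_path _ _ _ _ phi (the_path rphi) (~` [set f : rpath | E f /\
    (tau f < (r q)%:E)%E])).
    by move=> t tt; exists t.
  rewrite -setTD; apply: sigma_algebraCD; exact: opt.
have mD q : measurable (~` D q).
  apply: measurableC; apply: (@measurable_path_event _ _ _ _ (the_path rphi)) => //.
  exact: (measurable_phase hphi).
have [q Dq] : exists q, (0 < P i (~` D q))%E.
  apply: contrapT => /forallNP h.
  have N : (P i).-negligible (\bigcup_q ~` D q).
    apply: negligible_bigcup => q; exists (~` D q); split => //.
    by apply/eqP; rewrite eq_le measure_ge0 andbT leNgt; apply/negP; exact: h.
  (* A path from [i] along which [tau] is less than every [r q] has [tau <= 0]. *)
  have N0 : (P i).-negligible [set w | phi 0 w = i].
    apply: negligibleS N => w /= w0; apply: contrapT => h'.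
    have Dw q : D q w.
      by apply: contrapT => nD; apply: h'; exists q.
    have [Ew _] := Dw 0%N.
    have tp : (0 < tau (phi ^~ w))%E by apply: tau_gt0.
    have [_ tl] := Dw 0%N.
    have tf := finite_of_lt (ltW tp) tl.
    have fp : 0 < fine (tau (phi ^~ w)) by rewrite -lte_fin -tf.
    have [q0 _ hq] := near_infty_natSinv_lt (PosNum fp).
    have [_] := Dw q0; rewrite /= tf lte_fin ltNge => /negP; apply.
    by apply: ltW; exact: (hq q0 (leqnn _)).
  have : P i [set w | phi 0 w = i] = 0%E := measure_negligible (measurable_phase hphi i
    (lexx 0)) N0.
  by rewrite hphi0 => /eqP; rewrite eqe oner_eq0.
pose C := [set w | r q < Y 0%N w].
have mC : measurable C by apply: measurable_fun_gt; exact: measurable_funP.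
have sC : sigma_clock Y (~` C).
  pose G : set (set T) := [set F | exists n B, measurable B /\ F = Y n @^-1` B].
  apply: (@measurableC _ (g_sigma_algebraType G)).
  apply: (@measurable_fun_gt _ _ (g_sigma_algebraType G)) => _ B mB.
  by rewrite setTI; apply: sub_sigma_algebra; exists 0%N, B.
have PC : (0 < P i (~` C))%E.
  rewrite probability_setC// (exponential_tail hnu ((hY i).1 0%N)).
  rewrite leNgt r0 /= -EFinB lte_fin subr_gt0 expR_lt1 mulNr oppr_lt0.
  by rewrite mulr_gt0.
have PDC : (0 < P i (~` D q `&` ~` C))%E by rewrite hind// mule_gt0.
have mDC : measurable (~` D q `&` ~` C) by apply: measurableI => //; exact: measurableC.
rewrite sum_stopped /Pr -lte_fin fineK; last exact: fin_num_measure.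
apply: (@le_lt_trans _ _ (P i (~` (~` D q `&` ~` C)))).
  apply: le_measure; rewrite ?inE//; first exact: measurableC.
  move=> w [l _ [Ew [ty _ _ h]]] [nD nC]; apply: nD; split => //.
  apply: (lt_le_trans h); rewrite lee_fin erlangS erlang0 addr0 leNgt.
  by apply/negP => h'; apply: nC.
have xf : P i (~` D q `&` ~` C) \is a fin_num by exact: fin_num_measure.
rewrite probability_setC//; move: PDC; rewrite -(fineK xf) -EFinB !lte_fin.
by rewrite ltrBlDr ltrDl.
Qed.

End Exit.

Lemma unitmx_exit p (S : {set 'I_m}) (M : 'M[R]_(p, #|S|)) (N : 'M[R]_(#|S|, p)) :
  (forall i j, 0 <= M i j) -> (forall i j, 0 <= N i j) ->
  (forall i, \sum_j M i j < 1) -> (forall i, \sum_j N i j <= 1) ->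
  1%:M - M *m N \in unitmx.
Proof.
move=> M0 N0 M1 N1; apply: unitmx_substochastic => [i j|i].
  by rewrite mxE sumr_ge0// => l _; rewrite mulr_ge0.
under eq_bigr do rewrite mxE.
rewrite exchange_big; apply: le_lt_trans (M1 i); apply: ler_sum => l _.
by rewrite -mulr_sumr ler_piMr.
Qed.

Hypothesis hc : forall i, c i != 0.

Lemma Psi_row_lt1 x i : \sum_j Psi c P phi Y x 0 i j < 1.
Proof.
rewrite (eq_bigr (fun l => Pr P (enum_val i) (stopped_at phi Y
  (fun f => (tau_below c f 0 0 < tau_above c f 0 x)%E)
  (fun f => tau_below c f 0 0) (enum_val l) 0))); last by move=> l _; rewrite !mxE.
apply: (sum_stopped_lt1 (optional_below c (enum_val i) 0 0 x)) => f hf f0 Ef.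
rewrite lt0e tau_below_ge0// andbT; apply/eqP => t0.
have := rate_tau_below hc hf (lexx 0) t0; rewrite f0.
by have := enum_valP i; rewrite inE => /lt_trans h /h; rewrite ltxx.
Qed.

Lemma Upsilon_row_le1 n i : \sum_j Upsilon c P phi Y n i j <= 1.
Proof.
rewrite (eq_bigr (fun l => Pr P (enum_val i) (stopped_at phi Y
  (fun=> True) (beta c) (enum_val l) n))); last first.
  by move=> l _; rewrite !mxE; congr Pr; apply/seteqP; split => w //= -[].
exact: (sum_stopped_le1 (optional_beta c (enum_val i))).
Qed.

Lemma hPsi_row_le1 a n i : \sum_j hPsi c P phi Y a n i j <= 1.
Proof.
rewrite (eq_bigr (fun l => Pr P (enum_val i) (stopped_at phi Y
  (fun f => (tau_above c f a a < tau_below c f a 0)%E)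
  (fun f => tau_above c f a a) (enum_val l) n))); last by move=> l _; rewrite !mxE.
exact: (sum_stopped_le1 (optional_above c (enum_val i) a 0 a)).
Qed.

(** The queue starts above [x].  The only exception is a negative value of the
    clock, a null event: the maximum is then taken over an empty set and has
    the conventional value [0]. *)
Lemma delta_above_start i a x k : 0 < a -> x < a -> delta c P phi Y i a x k = 0.
Proof.
move=> a0 xa; rewrite /delta/Pr.
have E : [set w | queue_max c (path_of phi w) a (erlang Y k w) <= x] =
    [set w | 0 <= x /\ erlang Y k w < 0].
  apply/seteqP; split => w /=; have [e0|e0] := ltP (erlang Y k w) 0.
  - have -> : queue_max c (path_of phi w) a (erlang Y k w) = 0.
      rewrite /queue_max (_ : [set _ | _ in _] = set0) ?sup0//.
      apply/seteqP; split => // _ [v /= /[!in_itv]/= /andP[v0 v1] _].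
      by have := lt_le_trans e0 (le_trans v0 v1); rewrite ltxx.
    by [].
  - move=> h; have := queue_max_ge c (rphi w) (ltW a0) e0.
    by move=> /le_trans /(_ h); rewrite leNgt xa.
  - move=> [x0 _]; rewrite /queue_max (_ : [set _ | _ in _] = set0) ?sup0//.
    apply/seteqP; split => // _ [v /= /[!in_itv]/= /andP[v0 v1] _].
    by have := lt_le_trans e0 (le_trans v0 v1); rewrite ltxx.
  - by move=> [_ ].
have mE : measurable [set w | 0 <= x /\ erlang Y k w < 0].
  apply: measurable_conj; first exact: measurable_cst_prop.
  rewrite (_ : (fun w => erlang Y k w < 0) = ([set w | 0 < - erlang Y k w] : set T) :> set T).
    by apply: measurable_fun_gt; apply: measurableT_comp => //; exact: measurable_erlang.
  by apply/seteqP; split => w /=; rewrite oppr_gt0.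
rewrite E -(probability_setI_full (measurable_ticking Y) mE (ticking_full hnu hY i)).
rewrite (_ : _ `&` _ = set0) ?measure0//.
apply/seteqP; split => // w [tw [_]].
by have := erlang_mono tw (leq0n k); rewrite erlang0 leNgt => /negP.
Qed.

End RowSums.

(** * The distribution of the maximum *)

Theorem theorem5p6 (R : realType) (d : measure_display) (T : measurableType d)
  (m : nat) (A : 'M[R]_m) (c : 'I_m -> R) (nu : R) (L k : nat)
  (P : 'I_m -> probability T R) (phi : R -> T -> 'I_m)
  (Y : nat -> {mfun T >-> R})
  (hA : is_generator A) (hc : forall i, c i != 0) (hnu : 0 < nu)
  (hL : (1 <= L)%N) (hk : (1 <= k <= L)%N)
  (hphi : forall i, is_ctmc (P i) A phi)
  (hphi0 : forall i, P i [set w | phi 0 w = i] = 1%E)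
  (hY : forall i, iid_exponential (P i) nu Y)
  (hind : forall i, independent_clock (P i) phi Y) :
  let Lam := Lambda c P phi Y in
  let Psi := Psi c P phi Y in
  let hLam := hLambda c P phi Y in
  let hPsi := hPsi c P phi Y in
  let Ups := Upsilon c P phi Y in
  let dp := delta_plus c P phi Y in
  let dm := delta_minus c P phi Y in
  let cdp := cdelta_plus c P phi Y in
  let cdm := cdelta_minus c P phi Y in
  (forall x : R, 0 <= x ->
    [/\ 1%:M - Psi x 0%N *m Ups 0%N \in unitmx,
        cdp 0 x k =
          invmx (1%:M - Psi x 0%N *m Ups 0%N) *m
          (\sum_(n < k) Lam x n *m const_mx 1 +
           \sum_(n < k) \sum_(l < k | (1 <= n + l <= k.-1)%N)
              Psi x n *m Ups l *m cdp 0 x (k - n - l)%N),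
        dp 0 x k = const_mx 1 - cdp 0 x k
      & dm 0 x k = const_mx 1 - \sum_(n < k) Ups n *m cdp 0 x (k - n)%N]) /\
  (forall a : R, 0 < a ->
    (forall x : R, a <= x ->
      [/\ 1%:M - Psi (x - a) 0%N *m hPsi a 0%N \in unitmx,
          cdp a x k =
            invmx (1%:M - Psi (x - a) 0%N *m hPsi a 0%N) *m
            (\sum_(n < k) Lam (x - a) n *m const_mx 1 +
             Psi (x - a) 0%N *m hLam a 0%N *m cdm 0 x k +
             \sum_(n < k) \sum_(l < k | (1 <= n + l <= k.-1)%N)
                Psi (x - a) n *m
                (hPsi a l *m cdp a x (k - n - l)%N +
                 hLam a l *m cdm 0 x (k - n - l)%N)),
          dp a x k = const_mx 1 - cdp a x k
        & dm a x k =
            const_mx 1 -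
            \sum_(n < k) (hPsi a n *m cdp a x (k - n)%N +
                          hLam a n *m cdm 0 x (k - n)%N)]) /\
    (forall x : R, x < a -> dp a x k = 0 /\ dm a x k = 0)).
Proof.
move=> Lam Psi hLam hPsi Ups dp dm cdp cdm.
have [k0 _] := andP hk.
(* [T] is pointed, hence there is at least one phase. *)
have rphi w : right_const (phi ^~ w).
  by move=> t t0; have [_ h _ _] := hphi (phi 0 point); exact: h.
have Pr0 := Pr_ge0 P.
have solve p (Q : 'M[R]_p) (v b : 'cV[R]_p) :
    1%:M - Q \in unitmx -> v = b + Q *m v -> v = invmx (1%:M - Q) *m b.
  move=> uQ e; rewrite -[LHS](mulKmx uQ); congr (_ *m _).
  by rewrite mulmxBl mul1mx {1}e addrK.
split=> [x x0|a a0].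
  have uQ : 1%:M - Psi x 0%N *m Ups 0%N \in unitmx.
    apply: unitmx_exit => [i j|i j|i|i].
    - by rewrite mxE.
    - by rewrite mxE.
    - exact: (Psi_row_lt1 hnu hphi hphi0 hY hind rphi hc).
    - exact: (Upsilon_row_le1 Y hphi rphi).
  have ren j : cdm 0 x j = \sum_(n < j) Ups n *m cdp 0 x (j - n)%N.
    exact: (renewal_boundary c hnu hphi hphi0 hY hind rphi j x0).
  split => //.
  - apply: solve => //.
    have up : cdp 0 x k = \sum_(n < k) Lam (x - 0) n *m const_mx 1 +
        \sum_(n < k) Psi (x - 0) n *m cdm 0 x (k - n)%N.
      exact: (renewal_up hnu hphi hphi0 hY hind rphi hc k (lexx 0) x0).
    rewrite [LHS]up subr0 -addrA; congr (_ + _).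
    under eq_bigr do rewrite ren.
    rewrite (sum_split_first _ (fun n l => Ups l *m cdp 0 x (k - n - l)%N) k0).
    rewrite !subn0 mulmxA addrC; congr (_ + _).
    by apply: eq_bigr => n _; apply: eq_bigr => l _; rewrite mulmxA.
  - by rewrite /cdp /cdelta_plus subKr.
  - by rewrite -ren /cdm /cdelta_minus subKr.
split=> [x ax|x xa]; last first.
  by split; apply/matrixP => i j; rewrite !mxE (delta_above_start c hnu hY rphi).
have a0' := ltW a0; have x0 := le_trans a0' ax.
have uQ : 1%:M - Psi (x - a) 0%N *m hPsi a 0%N \in unitmx.
  apply: unitmx_exit => [i j|i j|i|i].
  - by rewrite mxE.
  - by rewrite mxE.
  - exact: (Psi_row_lt1 hnu hphi hphi0 hY hind rphi hc).
  - exact: (hPsi_row_le1 Y hphi rphi).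
have ren j : cdm a x j = \sum_(n < j) (hPsi a n *m cdp a x (j - n)%N +
    hLam a n *m cdm 0 x (j - n)%N).
  exact: (renewal_down hnu hphi hphi0 hY hind rphi hc j a0' ax).
split => //.
- apply: solve => //.
  have up : cdp a x k = \sum_(n < k) Lam (x - a) n *m const_mx 1 +
      \sum_(n < k) Psi (x - a) n *m cdm a x (k - n)%N.
    exact: (renewal_up hnu hphi hphi0 hY hind rphi hc k a0' ax).
  rewrite [LHS]up -!addrA; congr (_ + _).
  under eq_bigr do rewrite ren.
  rewrite (sum_split_first _ (fun n l => hPsi a l *m cdp a x (k - n - l)%N +
    hLam a l *m cdm 0 x (k - n - l)%N) k0).
  rewrite !subn0 mulmxDr !mulmxA.
  by rewrite -addrA [LHS]addrC -addrA.
- by rewrite /cdp /cdelta_plus subKr.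
- by rewrite -ren /cdm /cdelta_minus subKr.
Qed.
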